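(* Let $\mathbb{H}^n(-1)$ be the $n$-dimensional hyperbolic space in the upper half space model $\left(\mathbb{R}^n_+,\frac{dx_1^2+dx_2^2+\cdots+dx_n^2}{x_n^2}\right)$, where $\mathbb{R}^n_+=\{x\in\mathbb{R}^n: x_n>0\}$, and let $\Omega$ be a bounded connected domain in $\mathbb{H}^n(-1)$. Let $a,b$ be real constants with $a>0$ such that $\Omega\subset\{x\in\mathbb{R}^n_+: a\le x_n^2\le b\}$. Then the eigenvalues $0<\lambda_1<\lambda_2\le\lambda_3\le\cdots$ of the Dirichlet problem $\Delta u=-\lambda u$ in $\Omega$, $u|_{\partial\Omega}=0$, satisfy, for every integer $k\ge1$, $$\sum_{i=1}^k(\lambda_{k+1}-\lambda_i)^2\le\frac ba\,\frac4n\sum_{i=1}^k(\lambda_{k+1}-\lambda_i)\left(\lambda_i-\frac{n^2-2n-4}{4}\right).$$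
   Context: $\Delta$ is the Laplacian (Laplace--Beltrami operator, the divergence of the gradient) of the hyperbolic metric. Eigenvalues are repeated according to multiplicity; the Dirichlet condition is understood in the usual sense ($u\in H^1_0(\Omega)$). *)

(* Defs.v *)
From HB Require Import structures.
From mathcomp Require Import all_boot all_order all_algebra.
From mathcomp Require Import all_classical all_reals all_analysis.

Set Implicit Arguments.
Unset Strict Implicit.
Unset Printing Implicit Defensive.

Import Order.TTheory GRing.Theory Num.Theory.
Import numFieldNormedType.Exports.

Local Open Scope classical_set_scope.
Local Open Scope ring_scope.

(* Row vectors carry the product sigma-algebra, which is the Borel one. *)
Definition rV_display : measure_display.
Proof. exact. Qed.

Section measurable_rV.
Context (R : realType) (n : nat).

Definition rV_coord (i : 'I_n) (v : 'rV[R]_n) : measurableTypeR R := v ord0 i.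

Let rV_set0 : g_sigma_preimage rV_coord set0.
Proof. exact: sigma_algebra0. Qed.

Let rV_setC A : g_sigma_preimage rV_coord A -> g_sigma_preimage rV_coord (~` A).
Proof. exact: sigma_algebraC. Qed.

Let rV_bigcup (F : (set 'rV[R]_n)^nat) :
  (forall i, g_sigma_preimage rV_coord (F i)) ->
  g_sigma_preimage rV_coord (\bigcup_i (F i)).
Proof. exact: sigma_algebra_bigcup. Qed.

HB.instance Definition _ := @isMeasurable.Build rV_display
  'rV[R]_n (g_sigma_preimage rV_coord) rV_set0 rV_setC rV_bigcup.

Lemma measurable_rV_coord (i : 'I_n) : measurable_fun setT (rV_coord i).
Proof.
move=> _ Y mY; rewrite setTI; apply: sub_sigma_algebra => /=.
rewrite -bigcup_seq/=; exists i => /=; first by rewrite mem_index_enum.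
by exists Y => //; rewrite setTI.
Qed.

Lemma measurable_fun_rVP d (T : measurableType d) (f : T -> 'rV[R]_n) :
  (forall i, measurable_fun setT (rV_coord i \o f)) -> measurable_fun setT f.
Proof.
move=> mf _ A mA; rewrite setTI.
have : g_sigma_preimage (fun i => rV_coord i \o f) (f @^-1` A).
  by rewrite g_sigma_preimage_comp; exists A => //; rewrite setTI.
apply: smallest_sub; first exact: sigma_algebra_measurable.
move=> B; rewrite -bigcup_seq/= => -[i _ [C mC <-]].
exact: mf.
Qed.

End measurable_rV.

Section lebesgue_rV.
Context (R : realType).

Definition rV_cons n (p : measurableTypeR R * 'rV[R]_n) : 'rV[R]_n.+1 :=
  \row_i (if unlift ord0 i is Some j then p.2 ord0 j else p.1).

Definition rV_uncons n (v : 'rV[R]_n.+1) : measurableTypeR R * 'rV[R]_n :=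
  (v ord0 ord0, \row_i v ord0 (lift ord0 i)).

Lemma measurable_rV_cons n : measurable_fun setT (@rV_cons n).
Proof.
apply: measurable_fun_rVP => i.
have [j ->|->] := unliftP ord0 i.
- rewrite (_ : _ \o _ = rV_coord j \o snd); last first.
    by apply/funext => p; rewrite /= /rV_coord mxE liftK.
  by apply: measurableT_comp => //; exact: measurable_rV_coord.
- rewrite (_ : _ \o _ = fst)//.
  by apply/funext => p; rewrite /= /rV_coord mxE unlift_none.
Qed.

Lemma measurable_rV_uncons n : measurable_fun setT (@rV_uncons n).
Proof.
apply/measurable_fun_pairP; split => /=.
- exact: (@measurable_rV_coord R n.+1 ord0).
- apply: measurable_fun_rVP => i.
  rewrite (_ : _ \o _ = rV_coord (lift ord0 i)); last first.
    by apply/funext => p; rewrite /= /rV_coord mxE.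
  exact: measurable_rV_coord.
Qed.

Lemma rV_consK n : cancel (@rV_cons n) (@rV_uncons n).
Proof.
move=> [x v]; rewrite /rV_uncons mxE unlift_none; congr pair.
by apply/rowP => i; rewrite !mxE liftK.
Qed.

Lemma rV_unconsK n : cancel (@rV_uncons n) (@rV_cons n).
Proof.
move=> v; apply/rowP => i; rewrite mxE.
by have [j ->|->] := unliftP ord0 i; rewrite ?mxE.
Qed.

Lemma product_sigma_finite d1 d2 (T1 : measurableType d1)
    (T2 : measurableType d2) (m1 : {sigma_finite_measure set T1 -> \bar R})
    (m2 : {sigma_finite_measure set T2 -> \bar R}) :
  sigma_finite setT (m1 \x m2)%E.
Proof.
have /sigma_finiteP[F [TF ndF Foo]] := sigma_finiteT m1.
have /sigma_finiteP[G [TG ndG Goo]] := sigma_finiteT m2.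
exists (fun n => F n `*` G n).
  rewrite -setXTT TF TG predeqE => -[x y]; split.
    move=> [/= [n _ Fnx] [k _ Gky]]; exists (maxn n k) => //; split.
    - by move: x Fnx; exact/subsetPset/ndF/leq_maxl.
    - by move: y Gky; exact/subsetPset/ndG/leq_maxr.
  by move=> [n _ []/= ? ?]; split; exists n.
move=> k; have [? ?] := Foo k; have [? ?] := Goo k.
split; first exact: measurableX.
by rewrite product_measure1E// lte_mul_pinfty// ge0_fin_numE.
Qed.

Section step.
Context n (mu : {sigma_finite_measure set 'rV[R]_n -> \bar R}).

Definition leb_step : set 'rV[R]_n.+1 -> \bar R :=
  pushforward (@lebesgue_measure R \x mu)%E (@rV_cons n).

Let leb_step0 : leb_step set0 = 0%E.
Proof. by rewrite /leb_step /pushforward preimage_set0 measure0. Qed.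

Let leb_step_ge0 A : (0 <= leb_step A)%E.
Proof. by rewrite /leb_step /pushforward measure_ge0. Qed.

Let leb_step_sigma_additive : semi_sigma_additive leb_step.
Proof.
move=> F mF tF mUF; rewrite /leb_step /pushforward preimage_bigcup.
have mp A : measurable A -> measurable (@rV_cons n @^-1` A).
  by move=> mA; rewrite -[X in measurable X]setTI; exact: measurable_rV_cons.
apply: measure_semi_sigma_additive => [i| |].
- exact: mp.
- apply/trivIsetP => i j _ _ ij; rewrite -preimage_setI.
  by move/trivIsetP : tF => /(_ i j Logic.I Logic.I ij) ->; rewrite preimage_set0.
- by rewrite -preimage_bigcup; exact: mp.
Qed.

HB.instance Definition _ := isMeasure.Build _ _ _ leb_step
  leb_step0 leb_step_ge0 leb_step_sigma_additive.

Let leb_step_sigma_finite : sigma_finite setT leb_step.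
Proof.
have [F TF Foo] := product_sigma_finite (@lebesgue_measure R) mu.
exists (fun i => @rV_uncons n @^-1` F i).
  by rewrite -preimage_bigcup -TF preimage_setT.
move=> i; have [mFi Fioo] := Foo i; split.
  by rewrite -[X in measurable X]setTI; exact: measurable_rV_uncons.
rewrite /leb_step /pushforward (_ : _ @^-1` _ = F i)//.
by apply/seteqP; split=> p /=; rewrite rV_consK.
Qed.

HB.instance Definition _ := Measure_isSigmaFinite.Build _ _ _ leb_step
  leb_step_sigma_finite.

End step.

Fixpoint lebesgue_rV n : {sigma_finite_measure set 'rV[R]_n -> \bar R} :=
  match n with
  | 0 => dirac (0 : 'rV[R]_0)
  | m.+1 => leb_step (lebesgue_rV m)
  end.

Lemma lebesgue_rV_box n (a b : 'rV[R]_n) :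
  (forall i, a ord0 i <= b ord0 i) ->
  lebesgue_rV n [set v | forall i, a ord0 i <= v ord0 i <= b ord0 i] =
  (\prod_i (b ord0 i - a ord0 i))%:E.
Proof.
elim: n a b => [|n IHn] a b ab.
  rewrite big_ord0 /= /dirac indicE mem_set//=.
  by case.
rewrite big_ord_recl/= /leb_step /pushforward.
set A := [set x : measurableTypeR R | a ord0 ord0 <= x <= b ord0 ord0].
pose a' : 'rV[R]_n := \row_i a ord0 (lift ord0 i).
pose b' : 'rV[R]_n := \row_i b ord0 (lift ord0 i).
set B := [set v : 'rV[R]_n | forall i, a' ord0 i <= v ord0 i <= b' ord0 i].
have AE : A = `[a ord0 ord0, b ord0 ord0]%classic.
  by apply/seteqP; split => x /=; rewrite in_itv.
have mA : measurable A by rewrite AE; exact: measurable_itv.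
have mB : measurable B.
  rewrite (_ : B = \bigcap_(i : 'I_n)
      (@rV_coord R n i @^-1` `[a' ord0 i, b' ord0 i]%classic)).
    apply: fin_bigcap_measurable => [|i _]; first exact: finite_finset.
    rewrite -[X in measurable X]setTI; exact: measurable_rV_coord.
  apply/seteqP; split => [v Bv i _|v Bv i].
    by rewrite /= in_itv; exact: Bv.
  by have := Bv i Logic.I; rewrite /= in_itv.
rewrite (_ : _ @^-1` _ = A `*` B); last first.
  apply/seteqP; split => [[x v] /= xv|[x v] [/= Ax Bv] i].
    split; first by have := xv ord0; rewrite mxE unlift_none.
    by move=> i; have := xv (lift ord0 i); rewrite !mxE liftK.
  by rewrite mxE; have [j ->|->//] := unliftP ord0 i; have := Bv j; rewrite !mxE.
have mAE : @lebesgue_measure R A = (b ord0 ord0 - a ord0 ord0)%:E.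
  rewrite AE lebesgue_measure_itv/= lte_fin.
  have := ab ord0; rewrite le_eqVlt => /orP[/eqP ->|->]; last by rewrite EFinB.
  by rewrite ltxx subrr.
rewrite product_measure1E// [X in (X * _)%E]mAE IHn => [|i]; last by rewrite !mxE.
rewrite EFinM; congr (_ * _)%E.
by congr EFin; apply: eq_bigr => i _; rewrite !mxE.
Qed.

End lebesgue_rV.

Section smooth.
Context (R : realType) (n : nat).
Implicit Types (f : 'rV[R]_n -> R) (U : set 'rV[R]_n).

Definition partial (i : 'I_n) f (x : 'rV[R]_n) : R := 'D_(delta_mx ord0 i) f x.

Definition smooth f := forall (s : seq 'I_n) (x : 'rV[R]_n),
  differentiable (foldr partial f s) x.

(* C_c^oo(U), its elements being extended by 0 to R^n. *)
Definition test_function U f :=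
  [/\ smooth f, compact (closure [set x | f x != 0])
    & closure [set x | f x != 0] `<=` U].

End smooth.

Section hyperbolic.
Context (R : realType) (m : nat).
Local Notation point := 'rV[R]_m.+1.
Implicit Types (x y : point) (f u : point -> R) (X : point -> point)
  (Omega : set point).

(* x_n, the dimension being n = m.+1 *)
Definition height x : R := x ord0 ord_max.

Definition half_space : set point := [set x | 0 < height x].

(* arcosh (1 + |x - y|^2 / (2 x_n y_n)), with arcosh t = ln (t + sqrt (t^2 - 1)) *)
Definition arcosh (t : R) : R := ln (t + Num.sqrt (t ^+ 2 - 1)).

Definition hdist x y : R :=
  arcosh (1 + (\sum_i (x ord0 i - y ord0 i) ^+ 2) / (2 * height x * height y)).

Definition hbounded Omega :=
  exists p r, half_space p /\ forall x, Omega x -> hdist p x <= r.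

Definition hdomain Omega :=
  [/\ Omega `<=` half_space, open Omega, connected Omega & Omega !=set0].

(* Tangent vectors are given by their components in the coordinate frame, in
   which the metric is g_ij = delta_ij / x_n^2 and sqrt(det g) = x_n^-n. *)
Definition hnorm2 x (v : point) : R := (\sum_i v ord0 i ^+ 2) / height x ^+ 2.

Definition hgrad f x : point := height x ^+ 2 *: \row_i partial i f x.

Definition hdiv X x : R :=
  height x ^+ m.+1 *
  \sum_i partial i (fun y => height y ^- m.+1 * X y ord0 i) x.

Definition hlaplacian f : point -> R := hdiv (hgrad f).

(* Integration against the Riemannian volume x_n^-n dx *)
Definition hintegral Omega f : \bar R :=
  (\int[lebesgue_rV R m.+1]_(x in Omega) (f x * height x ^- m.+1)%:E)%E.

(* H^1_0(Omega), the closure of C_c^oo(Omega) for the H^1 norm: the limit G of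
   the gradients is then the weak gradient of u. *)
Definition H10 Omega u :=
  measurable_fun Omega u /\
  exists (phi : nat -> point -> R) (G : point -> point),
  [/\ measurable_fun Omega G,
      forall j, test_function Omega (phi j),
      hintegral Omega (fun x => (phi j x - u x) ^+ 2) @[j --> \oo] --> 0%E
    & hintegral Omega (fun x => hnorm2 x (hgrad (phi j) x - G x)) @[j --> \oo]
        --> 0%E].

(* The solutions, 0 included, of (Laplacian u = - mu u, u = 0 on the boundary),
   the equation being understood in the sense of distributions on Omega. *)
Definition dirichlet_eigenspace Omega (mu : R) u :=
  H10 Omega u /\
  forall phi, test_function Omega phi ->
    hintegral Omega (fun x => u x * hlaplacian phi x) =
    hintegral Omega (fun x => - mu * u x * phi x).

Definition ae_on Omega (P : point -> Prop) :=
  {ae lebesgue_rV R m.+1, forall x, Omega x -> P x}.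

(* E has a basis of d elements, functions being identified when they agree
   almost everywhere on Omega. *)
Definition has_dim Omega (E : set (point -> R)) (d : nat) :=
  exists v : 'I_d -> point -> R,
  [/\ forall i, E (v i),
      forall c : 'I_d -> R, ae_on Omega (fun x => \sum_i c i * v i x = 0) ->
        forall i, c i = 0
    & forall u, E u -> exists c : 'I_d -> R,
        ae_on Omega (fun x => u x = \sum_i c i * v i x)].

(* [lam 0 <= lam 1 <= ...] lists the Dirichlet eigenvalues of Omega: each real
   mu occurs as many times as the dimension of its eigenspace (never, if it is
   not an eigenvalue).  Indices start at 0, so that [lam i] is lambda_(i+1). *)
Definition dirichlet_eigenvalues Omega (lam : nat -> R) :=
  {homo lam : i j / (i <= j)%N >-> i <= j} /\
  forall mu : R, exists d : nat,
    has_dim Omega (dirichlet_eigenspace Omega mu) d /\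
    ([set i | lam i = mu] #= `I_d)%card.

End hyperbolic.

(* Main.v *)
Require Import Defs.
From HB Require Import structures.
From mathcomp Require Import all_boot all_order all_algebra.
From mathcomp Require Import ring lra.
From mathcomp Require Import all_classical all_reals all_analysis.
From mathcomp Require Import measurable_realfun.

Set Implicit Arguments.
Unset Strict Implicit.
Unset Printing Implicit Defensive.

Import Order.TTheory GRing.Theory Num.Theory.
Import numFieldNormedType.Exports.

Local Open Scope classical_set_scope.
Local Open Scope ring_scope.

(** Let [h] be the height [x_n], with [n = m + 1]. In terms of Lebesgue measure
    and of the Euclidean gradient [D], the L^2 form and the Dirichlet form of the
    hyperbolic metric are
      [B(u, v) = \int u v h^-n]  and  [E(u, v) = \int <Du, Dv> h^2 h^-n];
    they are called [mass] and [energy] below.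

    The inequality is of Yang's type. Let [u_i] be orthonormal eigenfunctions,
    [k] the number of terms of the sums, [lam_k] the eigenvalue that follows the
    first [k] ones, and [d_i = lam_k - lam_i]. For a coordinate [x_q] the function
    [x_q u_i] minus its projection on [u_0, .., u_(k-1)] is admissible in the
    variational principle for [lam_k]. Let [p_i] be the commutator
    [2 <grad x_q, grad u_i> + u_i Delta x_q]; then
    [E(x_q u_i, w) = lam_i B(x_q u_i, w) - B(p_i, w)]. The numbers
    [a_ij = B(x_q u_i, u_j)] are symmetric in [i] and [j], and
    [B(p_i, u_j) = (lam_i - lam_j) a_ij], so that their contributions cancel when
    the estimates given by the variational principle and by Cauchy-Schwarz are
    summed. What is left is [yang_commutator]:
      [\sum_i d_i^2 (- B(x_q u_i, p_i)) <= \sum_i d_i B(p_i, p_i)].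
    Here [- B(x_q u_i, p_i) = \int u_i^2 |grad x_q|^2 = \int u_i^2 h^2 h^-n] is at
    least [a] ([trial_commutator]). The sum over [q] of the [B(p_i, p_i)] is at
    most [4 b (lam_i - (n^2 - 2 n) / 4)], because [p_i] contains a factor [h] whose
    square is at most [b], and the remaining integrals are computed by parts
    ([commutator_bound]). Summing over the [n] coordinates gives the theorem.

    The eigenvalues are known only as the numbers that occur as often as the
    dimensions of the eigenspaces tell, so the variational principle ([rayleigh])
    has to be derived. If a function orthogonal to [u_0, .., u_(k-1)] had a
    Rayleigh quotient smaller than [lam_k], there would be a minimizer of the
    quotient among these functions, by the direct method ([minimizer]). By the
    Euler-Lagrange equation it would be an eigenfunction with an eigenvalue
    smaller than [lam_k], hence a combination of the functions to which it is
    orthogonal. The direct method rests on the completeness of L^2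
    ([L2_complete]) and on Friedrichs' inequality ([friedrichs]), which bounds the
    L^2 norm by a small multiple of the Dirichlet form and finitely many linear
    forms.

    Elements of H^1_0 are handled through [sob], the closure of the test functions
    in the Euclidean H^1 norm. As [Omega] lies in a Euclidean box and [h] is
    bounded from below on it, the weights lie between positive constants, and this
    is the space of the statement ([H10_sob] and [sob_H10]). *)

(** * Square-integrable functions *)
Section pointwise.
Context (T : Type) (R : realType).
Implicit Types (f g : T -> R).

Lemma mulfE f g x : (f * g) x = f x * g x. Proof. by []. Qed.
Lemma addfE f g x : (f + g) x = f x + g x. Proof. by []. Qed.
Lemma oppfE f x : (- f) x = - f x. Proof. by []. Qed.
Lemma scalefE a f x : (a *: f) x = a * f x. Proof. by []. Qed.
Lemma zerofE x : (0 : T -> R) x = 0. Proof. by []. Qed.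
Lemma sumfE I (s : seq I) (P : pred I) (F : I -> T -> R) x :
  (\sum_(i <- s | P i) F i) x = \sum_(i <- s | P i) F i x.
Proof. by rewrite fct_sumE. Qed.

Definition pointwE := (mulfE, addfE, oppfE, scalefE, zerofE, sumfE).

End pointwise.

Section square_integrable.
Context d (T : measurableType d) (R : realType).
Variables (mu : {measure set T -> \bar R}) (D : set T).
Implicit Types (f g h : T -> R).

Definition L1 f := mu.-integrable D (EFin \o f).

Definition L2 f := measurable_fun D f /\ L1 (f * f).

Definition ip f g : R := Rintegral mu D (f * g).

Hypothesis mD : measurable D.

Lemma L1D f g : L1 f -> L1 g -> L1 (f + g).
Proof. by move=> f1 g1; rewrite /L1 (_ : _ \o _ = (EFin \o f) \+ (EFin \o g))//; exact: integrableD. Qed.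

Lemma L1Z a f : L1 f -> L1 (a *: f).
Proof. by move=> f1; have := integrableZl mD a f1. Qed.

Lemma L1_le f g : measurable_fun D f -> (forall x, D x -> `|f x| <= g x) ->
  L1 g -> L1 f.
Proof.
move=> mf fg g1; apply: (le_integrable mD _ _ g1); first exact/measurable_EFinP.
by move=> x Dx /=; rewrite lee_fin (le_trans (fg x Dx))// ler_norm.
Qed.

Lemma L2M f g : L2 f -> L2 g -> L1 (f * g).
Proof.
move=> [mf f2] [mg g2]; apply: (L1_le _ _ (L1D f2 g2)).
  exact: measurable_funM.
move=> x Dx; rewrite !pointwE normrM -2![in leRHS]expr2 -[f x ^+ 2]real_normK ?num_real//.
rewrite -[g x ^+ 2]real_normK ?num_real//.
by have := normr_ge0 (f x); have := normr_ge0 (g x); nra.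
Qed.

Lemma L2_0 : L2 0.
Proof.
split; first exact: measurable_cst.
by rewrite /L1 (_ : _ \o _ = cst 0%E); [exact: integrable0|apply/funext => x /=; rewrite !pointwE mulr0].
Qed.

Lemma L2D f g : L2 f -> L2 g -> L2 (f + g).
Proof.
move=> f2 g2; split; first exact: measurable_funD f2.1 g2.1.
rewrite mulrDl !mulrDr; apply: L1D; apply: L1D; exact: L2M.
Qed.

Lemma L2Z a f : L2 f -> L2 (a *: f).
Proof.
move=> f2; split; first exact: measurable_funM (measurable_cst a) f2.1.
rewrite (_ : _ * _ = a *: (a *: (f * f))); last first.
  by apply/funext => x; rewrite !pointwE; ring.
do 2 apply: L1Z; exact: L2M.
Qed.

Lemma L2N f : L2 f -> L2 (- f).
Proof. by move=> f2; rewrite -scaleN1r; exact: L2Z. Qed.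

Lemma L2B f g : L2 f -> L2 g -> L2 (f - g).
Proof. by move=> f2 g2; apply: L2D => //; exact: L2N. Qed.

Lemma L2_sum I (s : seq I) (P : pred I) (F : I -> T -> R) :
  (forall i, P i -> L2 (F i)) -> L2 (\sum_(i <- s | P i) F i).
Proof. by move=> F2; apply: big_ind => //; [exact: L2_0|exact: L2D]. Qed.

Lemma L2_mul C h f : measurable_fun D h -> (forall x, D x -> `|h x| <= C) ->
  L2 f -> L2 (h * f).
Proof.
move=> mh hC f2; split; first exact: measurable_funM mh f2.1.
apply: (L1_le _ _ (L1Z (C ^+ 2) f2.2)).
  by apply: measurable_funM; apply: measurable_funM => //; exact: f2.1.
move=> x Dx; rewrite mulrACA !pointwE normrM -!expr2 !ger0_norm ?sqr_ge0//.
rewrite ler_wpM2r ?sqr_ge0// -[h x ^+ 2]real_normK ?num_real//.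
by rewrite lerXn2r// ?nnegrE// (le_trans _ (hC x Dx)).
Qed.

Lemma ipC f g : ip f g = ip g f.
Proof. by rewrite /ip mulrC. Qed.

Lemma ip0l g : ip 0 g = 0.
Proof. by rewrite /ip mul0r /Rintegral integral0. Qed.

Lemma ipDl f g h : L2 f -> L2 g -> L2 h -> ip (f + g) h = ip f h + ip g h.
Proof. by move=> f2 g2 h2; rewrite /ip mulrDl; apply: RintegralD => //; exact: L2M. Qed.

Lemma ipZl a f g : L2 f -> L2 g -> ip (a *: f) g = a * ip f g.
Proof.
move=> f2 g2; rewrite /ip -(RintegralZl a mD (L2M f2 g2)).
by apply: eq_Rintegral => x _ /=; rewrite ?pointwE; ring.
Qed.

Lemma ipDr f g h : L2 f -> L2 g -> L2 h -> ip h (f + g) = ip h f + ip h g.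
Proof. by move=> *; rewrite ipC ipDl// !(ipC h). Qed.

Lemma ipZr a f g : L2 f -> L2 g -> ip g (a *: f) = a * ip g f.
Proof. by move=> *; rewrite ipC ipZl// (ipC g). Qed.

Lemma ipNl f g : L2 f -> L2 g -> ip (- f) g = - ip f g.
Proof. by move=> *; rewrite -scaleN1r ipZl// mulN1r. Qed.

Lemma ipNr f g : L2 f -> L2 g -> ip g (- f) = - ip g f.
Proof. by move=> *; rewrite -scaleN1r ipZr// mulN1r. Qed.

Lemma ipBl f g h : L2 f -> L2 g -> L2 h -> ip (f - g) h = ip f h - ip g h.
Proof. by move=> *; rewrite ipDl ?ipNl//; exact: L2N. Qed.

Lemma ipBr f g h : L2 f -> L2 g -> L2 h -> ip h (f - g) = ip h f - ip h g.
Proof. by move=> *; rewrite ipDr ?ipNr//; exact: L2N. Qed.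

Lemma ip_suml I (s : seq I) (P : pred I) (F : I -> T -> R) g :
  (forall i, P i -> L2 (F i)) -> L2 g ->
  ip (\sum_(i <- s | P i) F i) g = \sum_(i <- s | P i) ip (F i) g.
Proof.
move=> F2 g2; pose K (f : T -> R) (r : R) := L2 f /\ ip f g = r.
suff [] : K (\sum_(i <- s | P i) F i) (\sum_(i <- s | P i) ip (F i) g) by [].
apply: big_ind2 => [|f1 r1 f2 r2 [f12 <-] [f22 <-]|i Pi].
- split; first exact: L2_0.
  by rewrite -(scale0r (0 : T -> R)) ipZl ?mul0r//; exact: L2_0.
- by split; [exact: L2D|rewrite ipDl].
- by split => //; exact: F2.
Qed.

Lemma ip_sumr I (s : seq I) (P : pred I) (F : I -> T -> R) g :
  (forall i, P i -> L2 (F i)) -> L2 g ->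
  ip g (\sum_(i <- s | P i) F i) = \sum_(i <- s | P i) ip g (F i).
Proof. by move=> F2 g2; rewrite ipC ip_suml//; apply: eq_bigr => i _; exact: ipC. Qed.

Lemma ip_ge0 f : 0 <= ip f f.
Proof. by apply: Rintegral_ge0 => x _ /=; rewrite ?pointwE -expr2 sqr_ge0. Qed.

(** The function [t |-> |f - t g|^2] is nonnegative; it is quadratic in [t], or
    affine when [g] is null. *)
Lemma ip_CS f g : L2 f -> L2 g -> ip f g ^+ 2 <= ip f f * ip g g.
Proof.
move=> f2 g2.
have E t : 0 <= ip f f - 2 * t * ip f g + t ^+ 2 * ip g g.
  have tg2 : L2 (t *: g) by exact: L2Z.
  have := ip_ge0 (f - t *: g); rewrite ipBl//; last exact: L2B.
  rewrite !ipBr// !ipZl// !ipZr// (ipC g f); nra.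
have := ip_ge0 f; have g0 := ip_ge0 g => f0.
have [g0'|gn0] := eqVneq (ip g g) 0.
  have [->|fn0] := eqVneq (ip f g) 0; first by rewrite expr0n/= mulr_ge0.
  have := E ((ip f f + 1) / (2 * ip f g)); rewrite g0' mulr0 addr0.
  rewrite (_ : 2 * _ * _ = ip f f + 1); last by field.
  lra.
have g_gt0 : 0 < ip g g by rewrite lt_neqAle eq_sym gn0.
have := E (ip f g / ip g g).
rewrite (_ : _ - _ + _ = (ip f f * ip g g - ip f g ^+ 2) / ip g g); last by field.
by rewrite pmulr_lge0 ?invr_gt0// subr_ge0.
Qed.

Lemma ipD_le f g : L2 f -> L2 g ->
  ip (f + g) (f + g) <= 2 * ip f f + 2 * ip g g.
Proof.
move=> f2 g2; have := ip_ge0 (f - g).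
have fg2 : L2 (f + g) by exact: L2D.
have fg2' : L2 (f - g) by exact: L2B.
rewrite ipBl// !ipBr// ipDl// !ipDr//; lra.
Qed.

Lemma ip_eq0 f : L2 f -> ip f f = 0 -> {ae mu, forall x, D x -> f x = 0}.
Proof.
move=> f2 f0.
have : ae_eq mu D (EFin \o (f * f)) (cst 0%E).
  apply/ae_eq_integral_abs => //.
    by apply/measurable_EFinP/measurable_funM; exact: f2.1.
  rewrite -[RHS]/(0%:E) -f0 /ip /Rintegral fineK.
    by apply: eq_integral => x _ /=; rewrite ger0_norm// !pointwE -expr2 sqr_ge0.
  exact: (integrable_fin_num mD f2.2).
apply: filterS => x /= fx Dx; have := fx Dx => -[] /eqP.
by rewrite !pointwE mulf_eq0 orbb => /eqP.
Qed.

Lemma ip_ae f g h : L2 f -> L2 g -> L2 h ->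
  {ae mu, forall x, D x -> f x = g x} -> ip f h = ip g h.
Proof.
move=> f2 g2 h2 fg; congr fine; apply: ae_eq_integral => //.
- by apply/measurable_EFinP/measurable_funM; [exact: f2.1|exact: h2.1].
- by apply/measurable_EFinP/measurable_funM; [exact: g2.1|exact: h2.1].
- by apply: filterS fg => x fgx Dx; rewrite /= !pointwE fgx.
Qed.

Lemma eq_ip f1 f2 g1 g2 : (forall x, D x -> f1 x * g1 x = f2 x * g2 x) ->
  ip f1 g1 = ip f2 g2.
Proof. by move=> E; apply: eq_Rintegral => x /set_mem Dx /=; rewrite ?pointwE E. Qed.

Lemma ip_le f1 f2 g1 g2 : L2 f1 -> L2 g1 -> L2 f2 -> L2 g2 ->
  (forall x, D x -> f1 x * g1 x <= f2 x * g2 x) -> ip f1 g1 <= ip f2 g2.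
Proof. by move=> *; apply: le_Rintegral => //; exact: L2M. Qed.

Lemma ge0_integral_sumr (I : finType) (u : I -> T -> R) :
  (forall i, measurable_fun D (u i)) -> (forall i x, 0 <= u i x) ->
  (\int[mu]_(x in D) (\sum_i u i x)%:E = \sum_i \int[mu]_(x in D) (u i x)%:E)%E.
Proof.
move=> mu_ u0; under eq_integral do rewrite -sumEFin.
rewrite ge0_integral_sum// => [i|i x _]; first exact/measurable_EFinP.
by rewrite lee_fin.
Qed.

Lemma EFin_ip f g : L2 f -> L2 g ->
  (ip f g)%:E = (\int[mu]_(x in D) (f x * g x)%:E)%E.
Proof. by move=> f2 g2; rewrite /ip /Rintegral fineK//; exact: integrable_fin_num (L2M f2 g2). Qed.

Lemma L2P f : measurable_fun D f ->
  (\int[mu]_(x in D) (f x ^+ 2)%:E < +oo)%E -> L2 f.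
Proof.
move=> mf foo; split => //; apply/integrableP; split.
  by apply/measurable_EFinP/measurable_funM.
rewrite (eq_integral (fun x => (f x ^+ 2)%:E))// => x _ /=.
by rewrite ger0_norm// !pointwE -expr2 ?sqr_ge0.
Qed.

(** The series of the [4 ^ k (f (k + 1) - f k)^2] has finite integral, so almost
    everywhere its terms are bounded and [f k x] converges geometrically; Fatou's
    lemma then carries the bounds on the norms to the limit. *)
Lemma L2_complete (f : nat -> T -> R) :
  (forall k, L2 (f k)) ->
  (forall k j, (k <= j)%N -> ip (f j - f k) (f j - f k) <= 8^-1 ^+ k) ->
  exists g, L2 g /\ forall k, ip (g - f k) (g - f k) <= 8^-1 ^+ k.
Proof.
move=> f2 fC.
have fB j k : L2 (f j - f k) by exact: L2B.
pose s k x : \bar R := (4 ^+ k * (f k.+1 x - f k x) ^+ 2)%:E.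
have ms k : measurable_fun D (s k).
  apply/measurable_EFinP; apply: measurable_funM; first exact: measurable_cst.
  by apply: measurable_funX; exact: (fB k.+1 k).1.
have s0 k x : (0 <= s k x)%E by rewrite lee_fin mulr_ge0 ?sqr_ge0// exprn_ge0.
pose S x := (\sum_(k <oo) s k x)%E.
have mS : measurable_fun D S by apply: ge0_emeasurable_sum => // k x Dx _; exact: s0.
have S1 : mu.-integrable D S.
  apply/integrableP; split => //.
  have S0 x : (0 <= S x)%E by apply: nneseries_ge0 => n _ _; exact: s0.
  under eq_integral do rewrite gee0_abs//.
  rewrite /S integral_nneseries//.
  have le k : (\int[mu]_(x in D) s k x <= (2^-1 ^+ k)%:E)%E.
    rewrite /s; under eq_integral do rewrite EFinM.
    rewrite ge0_integralZl//; last 2 first.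
    - by apply/measurable_EFinP; apply: measurable_funX; exact: (fB k.+1 k).1.
    - by move=> x _; rewrite lee_fin sqr_ge0.
    have -> : (\int[mu]_(x in D) ((f k.+1 x - f k x) ^+ 2)%:E)%E =
        (ip (f k.+1 - f k) (f k.+1 - f k))%:E.
      by rewrite EFin_ip.
    rewrite -EFinM lee_fin; apply: le_trans (ler_wpM2l _ (fC k k.+1 _)) _ => //.
    by rewrite -exprMn (_ : 4 * 8^-1 = 2^-1 :> R)//; field.
  apply: (@le_lt_trans _ _ (\sum_(k <oo) (2^-1 ^+ k)%:E)%E).
    by apply: lee_nneseries => [k _ _|k _]; [exact: integral_ge0|exact: le].
  apply: (@le_lt_trans _ _ 2%:E); last exact: ltry.
  apply: lime_le; first by apply: is_cvg_nneseries => k _ _; rewrite lee_fin exprn_ge0.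
  near=> n; rewrite sumEFin lee_fin.
  have := @geometric_le_lim _ n 1 (2^-1 : R).
  rewrite ger0_norm// invf_lt1// ltr1n mul1r => /(_ ler01).
  rewrite invr_gt0 ltr0n => /(_ isT isT).
  rewrite (_ : (1 - 2^-1)^-1 = 2 :> R); last by field.
  by apply: le_trans; rewrite /series/=; under [leRHS]eq_bigr do rewrite mul1r.
pose A := D `&` [set x | S x \is a fin_num].
have mA : measurable A by exact: emeasurable_fin_num.
have cA x : A x -> cvgn (f ^~ x).
  move=> [Dx Sx]; pose c := Num.sqrt (fine (S x)).
  have dle k : `|f k.+1 x - f k x| <= c * 2^-1 ^+ k.
    have : (s k x <= S x)%E.
      apply: le_trans (nneseries_lim_ge k.+1 (fun n _ _ => s0 n x)).
      by rewrite big_nat_recr//= leeDr// sume_ge0.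
    rewrite -(fineK Sx) lee_fin => le.
    rewrite -(@ler_pXn2r _ 2)// ?nnegrE ?mulr_ge0 ?sqrtr_ge0 ?exprn_ge0//.
    rewrite real_normK ?num_real// exprMn sqr_sqrtr ?fine_ge0 ?nneseries_ge0//.
    rewrite -exprM mulnC exprM (_ : 2^-1 ^+ 2 = 4^-1 :> R); last by field.
    by rewrite exprVn ler_pdivlMr ?exprn_gt0// mulrC.
  have -> : f ^~ x = (fun k => f 0%N x + series (telescope (f ^~ x)) k).
    by apply/funext => k; rewrite telescopeK addrC subrK.
  apply: is_cvgD; first exact: is_cvg_cst.
  apply: normed_cvg.
  apply: (@series_le_cvg _ _ (geometric c 2^-1)) => [n|n|n|].
  - exact: normr_ge0.
  - by rewrite geometric_ge0// sqrtr_ge0.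
  - exact: dle.
  - by apply: is_cvg_geometric_series; rewrite ger0_norm// invf_lt1// ltr1n.
have mDA : mu (D `\` A) = 0%E.
  have [N [mN N0 DN]] := integrable_ae mD S1.
  apply: (subset_measure0 _ mN _ N0); first exact: measurableD.
  by move=> x [Dx nA]; apply: DN => /= fS; apply: nA; split => //; exact: fS.
pose g := (fun x => limn (f ^~ x)) \_ A.
have mg : measurable_fun D g.
  apply/(measurable_restrict _ mA mD); rewrite setIidr; last by move=> x [].
  apply: (@measurable_fun_cvg _ _ _ _ f) => [k|x Ax]; last exact: cA.
  by apply: measurable_funS (f2 k).1 => // x [].
have gf k : (\int[mu]_(x in D) ((g x - f k x) ^+ 2)%:E <= (8^-1 ^+ k)%:E)%E.
  have m2 (h : T -> R) : measurable_fun D h ->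
      measurable_fun D (fun x => ((h x - f k x) ^+ 2)%:E).
    move=> mh; apply/measurable_EFinP/measurable_funX/measurable_funB => //.
    exact: (f2 k).1.
  rewrite (@ge0_negligible_integral _ _ _ mu D (D `\` A))//; last 3 first.
  - exact: measurableD.
  - exact: m2.
  - by move=> x _; rewrite lee_fin sqr_ge0.
  rewrite setDD (setIidr (_ : A `<=` D)); last by move=> x [].
  pose h j x := ((f j x - f k x) ^+ 2)%:E.
  rewrite (eq_integral (fun x => limn_einf (h ^~ x))); last first.
    move=> x /set_mem Ax; rewrite /g patchE mem_set//.
    apply/esym; apply: (cvg_limn_einf_sup _).1; apply/cvg_EFin; first exact: nearW.
    apply: cvgM; apply: cvgB; solve [exact: cA|exact: cvg_cst].
  apply: le_trans (fatou mu mA _ _) _ => [j|j x _|].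
  - by apply: measurable_funS (m2 _ (f2 j).1) => // x [].
  - by rewrite lee_fin sqr_ge0.
  rewrite limn_einf_lim; apply: lime_le; first exact: is_cvg_einfs.
  apply: nearW => n; pose j := maxn n k.
  apply: (@le_trans _ _ (\int[mu]_(x in A) h j x)%E).
    by apply: ereal_inf_lbound; exists j => //=; exact: leq_maxl.
  apply: (@le_trans _ _ (\int[mu]_(x in D) h j x)%E).
    apply: ge0_subset_integral => //; last by move=> x [].
    - exact: m2 (f2 j).1.
    - by move=> x _; rewrite lee_fin sqr_ge0.
  have := fC k j (leq_maxr _ _); rewrite -lee_fin EFin_ip//; exact: fB.
exists g; have gk k : L2 (g - f k).
  apply: L2P; first exact: measurable_funB mg (f2 k).1.
  exact: le_lt_trans (gf k) (ltry _).
split=> [|k]; first by rewrite -(subrK (f 0%N) g); exact: L2D.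
rewrite -lee_fin EFin_ip//; exact: gf.
Unshelve. all: by end_near. Qed.

End square_integrable.

(** * Row vectors as a topological and measurable space *)
Section topology_rV.
Context (R : realType).

Lemma nbhs_rVP n (x : 'rV[R]_n) (P : set 'rV[R]_n) :
  nbhs x P <-> exists2 e, 0 < e &
    forall y : 'rV[R]_n, (forall i, `|x ord0 i - y ord0 i| < e) -> P y.
Proof.
rewrite nbhs_ballP; split => [[e /= e0 eP]|[e e0 eP]]; exists e => //= y xy.
  apply: eP; split => // i j; rewrite (ord1 i) -ball_normE /=; exact: xy.
by apply: eP => i; have := xy.2 ord0 i; rewrite -ball_normE.
Qed.

Let rat_box n (p : 'rV[rat]_n * rat) : set 'rV[R]_n :=
  [set v | forall i, `|v ord0 i - ratr (p.1 ord0 i)| < ratr p.2].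

Let measurable_rat_box n (p : 'rV[rat]_n * rat) : measurable (rat_box p).
Proof.
rewrite (_ : rat_box p = \bigcap_(i : 'I_n)
    (@rV_coord R n i @^-1` ball (ratr (p.1 ord0 i) : R) (ratr p.2))).
  apply: fin_bigcap_measurable => [|i _]; first exact: finite_finset.
  rewrite -[X in measurable X]setTI; apply: measurable_rV_coord => //.
  exact: measurable_ball.
by apply/seteqP; split => [v pv i _|v pv i]; [|have := pv i Logic.I];
  rewrite /= -ball_normE /= distrC; [exact: pv|].
Qed.

(** There are countably many boxes with rational data, and an open set is the
    union of those that it contains. *)
Lemma open_measurable_rV n (U : set 'rV[R]_n) : open U -> measurable U.
Proof.
move=> oU.
rewrite (_ : U = \bigcup_p (if `[< rat_box p `<=` U >] then rat_box p else set0)).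
  apply: countable_bigcupT_measurable => [|p]; first exact: countableP.
  by case: ifPn => _; [exact: measurable_rat_box|exact: measurable0].
apply/seteqP; split => [x Ux|x [p _]]; last by case: ifPn => // /asboolP; exact.
have /nbhs_rVP[e e0 eU] : nbhs x U by exact: open_nbhs_nbhs.
have [r /andP[r0 re]] : exists r : rat, ratr r \in `]0, (e / 2)[.
  by apply: rat_in_itvoo; lra.
have /choice[q qx] i : exists q : rat, `|x ord0 i - ratr q| < ratr r.
  have [q /andP[qi qi']] : exists q : rat, ratr q \in `](x ord0 i - ratr r), (x ord0 i + ratr r)[.
    have [|q qi] := @rat_in_itvoo R (x ord0 i - ratr r) (x ord0 i + ratr r); first by move: r0; rewrite /= bnd_simp; lra.
    by exists q.
  by exists q; rewrite distrC ltr_distl; move: qi qi'; rewrite !bnd_simp => -> ->.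
exists (\row_i q i, r) => //; case: ifPn => [_ i|/asboolP[]].
  by rewrite /= mxE; exact: qx.
move=> y yq; apply: eU => i; have := yq i; rewrite /= mxE => yi.
have := qx i; rewrite distrC in yi; move=> xi.
have := ler_distD (ratr (q i)) (x ord0 i) (y ord0 i).
by move: re; rewrite bnd_simp; lra.
Qed.

Lemma continuous_on_measurable_rV n (U : set 'rV[R]_n) (f : 'rV[R]_n -> R) :
  open U -> (forall x, U x -> {for x, continuous f}) -> measurable_fun U f.
Proof.
move=> oU cf; apply: (measurability _ (RGenOInfty.measurableE R)) => //.
move=> _ [_ [a ->] <-]; apply: open_measurable_rV.
rewrite openE => x [Ux /=]; rewrite in_itv/= andbT => fxa.
apply: filterI; first exact: open_nbhs_nbhs.
apply: (cf x Ux); apply: open_nbhs_nbhs; split; first exact: rray_open.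
by rewrite /= in_itv/= andbT.
Qed.

Lemma continuous_measurable_rV n (f : 'rV[R]_n -> R) :
  continuous f -> measurable_fun setT f.
Proof. by move=> cf; apply: (@continuous_on_measurable_rV n setT f openT) => x _; exact: cf. Qed.

Lemma continuous_rV_cons n (t : R) : continuous (fun v : 'rV[R]_n => rV_cons (t, v)).
Proof.
move=> v A /nbhs_rVP[e e0 eA]; apply/nbhs_rVP; exists e => // w vw.
by apply: eA => i; rewrite !mxE; case: unliftP => [k _|_] //=; rewrite subrr normr0.
Qed.

Lemma continuous_rV_consl n (v : 'rV[R]_n) :
  continuous (fun t : R => rV_cons (t : measurableTypeR R, v)).
Proof.
move=> t A /nbhs_rVP[e e0 eA]; apply/nbhs_ballP; exists e => // s ts.
by apply: eA => i; rewrite !mxE; case: unliftP => [k _|_] //=; rewrite subrr normr0.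
Qed.

Lemma rV_consD n (t s : R) (v w : 'rV[R]_n) (h : R) :
  rV_cons (h * s + t : measurableTypeR R, h *: w + v) =
  h *: rV_cons (s : measurableTypeR R, w) + rV_cons (t : measurableTypeR R, v).
Proof. by apply/rowP => i; rewrite !mxE; case: unliftP => [j _|_] /=; rewrite ?mxE. Qed.

Lemma rV_cons_lift n (p : 'I_n) :
  rV_cons (0 : measurableTypeR R, delta_mx ord0 p) = delta_mx ord0 (lift ord0 p).
Proof.
apply/rowP => i; rewrite !mxE; case: unliftP => [j ->|->] /=; rewrite ?mxE//=.
Qed.

Lemma rV_cons_ord0 n :
  rV_cons (1 : measurableTypeR R, 0) = delta_mx ord0 ord0 :> 'rV[R]_n.+1.
Proof. by apply/rowP => i; rewrite !mxE; case: unliftP => [j ->|->] /=; rewrite ?mxE. Qed.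

(** Only the restriction of a function to a line enters its derivative along
    that line. *)
Lemma is_derive_line (V W : normedModType R) (f : V -> R) (g : W -> R) x v y w d :
  (forall h : R, f (h *: v + x) = g (h *: w + y)) ->
  is_derive x v f d -> is_derive y w g d.
Proof.
move=> fg [fd <-].
have E : (fun h : R => h^-1 *: ((f \o shift x) (h *: v) - f x)) =
         (fun h : R => h^-1 *: ((g \o shift y) (h *: w) - g y)).
  by apply/funext => h; have := fg 0; rewrite !scale0r !add0r /= => ->; rewrite fg.
by apply: DeriveDef; rewrite /derivable /derive -E.
Qed.

End topology_rV.

Section fubini_rV.
Context (R : realType) (n : nat).
Implicit Types (F : 'rV[R]_n.+1 -> \bar R).

HB.instance Definition _ :=
  isMeasurableFun.Build _ _ _ _ (@rV_cons R n) (@measurable_rV_cons R n).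

Local Open Scope ereal_scope.

Let leb : {sigma_finite_measure set (measurableTypeR R) -> \bar R} := @lebesgue_measure R.

(** By definition the Lebesgue measure in dimension [n + 1] is the image of a
    product measure under [rV_cons]. *)
Lemma integral_rV_pair F : measurable_fun setT F -> (forall x, 0 <= F x) ->
  \int[lebesgue_rV R n.+1]_x F x = \int[leb \x lebesgue_rV R n]_p F (rV_cons p).
Proof.
move=> mF F0.
transitivity (\int[pushforward (leb \x lebesgue_rV R n) (@rV_cons R n)]_x F x).
  exact: eq_measure_integral.
rewrite ge0_integral_pushforward ?preimage_setT//; exact: measurable_rV_cons.
Qed.

Lemma tonelli_rV F : measurable_fun setT F -> (forall x, 0 <= F x) ->
  \int[lebesgue_rV R n.+1]_x F x =
  \int[leb]_t \int[lebesgue_rV R n]_v F (rV_cons (t, v)).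
Proof.
move=> mF F0; rewrite integral_rV_pair// fubini_tonelli1//.
exact: measurableT_comp (@measurable_rV_cons R n).
Qed.

Lemma integrable_rV_pair F : (lebesgue_rV R n.+1).-integrable setT F ->
  (leb \x lebesgue_rV R n).-integrable setT (F \o (@rV_cons R n)).
Proof.
move=> /integrableP[mF Foo]; apply/integrableP; split.
  exact: measurableT_comp (@measurable_rV_cons R n).
rewrite -(@integral_rV_pair (abse \o F))//; last by move=> x; exact: abse_ge0.
exact: measurableT_comp mF.
Qed.

Lemma fubini_rV F : (lebesgue_rV R n.+1).-integrable setT F ->
  \int[lebesgue_rV R n.+1]_x F x =
    \int[leb]_t \int[lebesgue_rV R n]_v F (rV_cons (t, v)) /\
  \int[lebesgue_rV R n.+1]_x F x =
    \int[lebesgue_rV R n]_v \int[leb]_t F (rV_cons (t, v)).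
Proof.
move=> iF; have iF' := integrable_rV_pair iF.
suff -> : \int[lebesgue_rV R n.+1]_x F x = \int[leb \x lebesgue_rV R n]_p F (rV_cons p).
  by split; [rewrite -(integral12_prod_meas1 iF')|rewrite -(integral21_prod_meas1 iF')].
transitivity (\int[pushforward (leb \x lebesgue_rV R n) (@rV_cons R n)]_x F x).
  exact: eq_measure_integral.
rewrite (integral_pushforward (@measurable_rV_cons R n) (measurable_int _ iF))//.
Qed.

End fubini_rV.

(** * Functions of class C^1 with bounded support *)
Section C1_compact.
Context (R : realType).

Definition box_supported n (M : R) (f : 'rV[R]_n -> R) :=
  forall (x : 'rV[R]_n) i, M < `|x ord0 i| -> f x = 0.

(** The partial derivatives are part of the data, so that the class is visibly
    stable under restriction to the slices on which the first coordinate is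
    constant ([C1_box_slice]). *)
Definition C1_box n (M : R) (f : 'rV[R]_n -> R) (Df : 'I_n -> 'rV[R]_n -> R) :=
  [/\ continuous f /\ box_supported M f,
      forall p, continuous (Df p) /\ box_supported M (Df p)
    & forall p x, is_derive x (delta_mx ord0 p) f (Df p x)].

Definition slice n (f : 'rV[R]_n.+1 -> R) (t : R) (v : 'rV[R]_n) : R :=
  f (rV_cons (t : measurableTypeR R, v)).

Lemma C1_box_slice n M (f : 'rV[R]_n.+1 -> R) Df t : C1_box M f Df ->
  C1_box M (slice f t) (fun p => slice (Df (lift ord0 p)) t).
Proof.
move=> [[cf sf] cD dD].
have cs (g : 'rV[R]_n.+1 -> R) : continuous g -> box_supported M g ->
    continuous (slice g t) /\ box_supported M (slice g t).
  move=> cg sg; split=> [v|v i vi].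
    by move=> B /cg; exact: continuous_rV_cons.
  by apply: (sg _ (lift ord0 i)); rewrite mxE liftK.
split => [|p|p x]; [exact: cs|by apply: cs; have [] := cD (lift ord0 p)|].
apply: is_derive_line (dD (lift ord0 p) (rV_cons (t : measurableTypeR R, x))).
by move=> h; rewrite /slice -rV_cons_lift -rV_consD mulr0 add0r.
Qed.

Lemma box_supported_bounded n M (f : 'rV[R]_n -> R) :
  continuous f -> box_supported M f -> exists2 C, 0 <= C & forall x, `|f x| <= C.
Proof.
move=> cf sf.
pose A := [set v : 'rV[R]_n | forall i, `[- M, M]%classic (v ord0 i)].
have cA : compact A.
  exact: (@rV_compact R n (fun=> `[- M, M]%classic) (fun=> @segment_compact R _ _)).
have [A0|A0] := pselect (A !=set0); last first.
  exists 0 => // x; rewrite (_ : f x = 0) ?normr0//.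
  have : ~ A x by move=> Ax; apply: A0; exists x.
  move=> /existsNP[i]; rewrite /= in_itv/= -ler_norml => /negP; rewrite -ltNge.
  exact: sf.
have [|c _ cmax] := @EVT_max_rV R n (fun x => `|f x|) A A0 cA.
  apply: continuous_subspaceT => x.
  exact: (continuous_comp (cf x) (@norm_continuous _ _ _)).
exists `|f c| => // x; have [/mem_set/cmax//|] := pselect (A x).
move=> /existsNP[i]; rewrite /= in_itv/= -ler_norml => /negP; rewrite -ltNge.
by move=> /sf ->; rewrite normr0.
Qed.

Definition box n (M : R) : set 'rV[R]_n := [set v | forall i, - M <= v ord0 i <= M].

Lemma measurable_box n M : measurable (@box n M).
Proof.
rewrite (_ : box M = \bigcap_(i : 'I_n) (@rV_coord R n i @^-1` `[- M, M]%classic)).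
  apply: fin_bigcap_measurable => [|i _]; first exact: finite_finset.
  by rewrite -[X in measurable X]setTI; exact: measurable_rV_coord.
by apply/seteqP; split => [v Bv i _|v Bv i]; [|have := Bv i Logic.I];
  rewrite /= in_itv//=; exact: Bv.
Qed.

Lemma lebesgue_box n M : 0 <= M ->
  lebesgue_rV R n (@box n M) = ((2 * M) ^+ n)%:E.
Proof.
move=> M0; rewrite (_ : box M = [set v | forall i,
  (const_mx (- M) : 'rV_n) ord0 i <= v ord0 i <= (const_mx M : 'rV_n) ord0 i]).
  rewrite lebesgue_rV_box => [|i]; last by rewrite !mxE; lra.
  congr EFin; under eq_bigr do rewrite !mxE opprK.
  by rewrite big_const_ord iter_mulr mulr1 (_ : M + M = 2 * M)//; ring.
by apply/seteqP; split => v /= vb i; have := vb i; rewrite !mxE.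
Qed.

Lemma box_supported_integrable n M (f : 'rV[R]_n -> R) :
  measurable_fun setT f -> (exists2 C, 0 <= C & forall x, `|f x| <= C) ->
  box_supported M f -> (lebesgue_rV R n).-integrable setT (EFin \o f).
Proof.
move=> mf [C C0 fC] sf.
have [M0|M0] := ltP M 0.
  (* a box of negative size is empty, except in dimension 0 *)
  have [n0|[i]] : n = 0%N \/ exists i : 'I_n, True.
  - by case: n {f mf fC sf} => [|n]; [left|right; exists ord0].
  - subst n; apply: measurable_bounded_integrable => //.
      by rewrite /= diracE mem_set// ltry.
    exists C; split => [|y Cy x _]; first exact: num_real.
    by apply: le_trans (fC x) _; exact: ltW.
  move=> _; rewrite (_ : EFin \o f = cst 0%E); first exact: integrable0.
  apply/funext => x /=; congr EFin; apply: (sf x i).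
  exact: lt_le_trans M0 (normr_ge0 _).
have : (lebesgue_rV R n).-integrable (box M) (EFin \o f).
  apply: measurable_bounded_integrable => //.
  - exact: measurable_box.
  - by rewrite [X in (X < _)%E]lebesgue_box// ltry.
  - exact: measurable_funTS.
  - exists C; split => [|y Cy x _]; first exact: num_real.
    by apply: le_trans (fC x) _; exact: ltW.
move=> /(integrable_mkcond _ (@measurable_box n M)).
rewrite (_ : _ \_ _ = EFin \o f)//; apply/funext => x.
rewrite patchE; case: ifPn => // /negP; rewrite inE => /existsNP[i].
by rewrite -ler_norml => /negP; rewrite -ltNge => /sf /= ->.
Qed.

Lemma C1_box_integrable n M (f : 'rV[R]_n -> R) :
  continuous f -> box_supported M f ->
  (lebesgue_rV R n).-integrable setT (EFin \o f).
Proof.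
move=> cf sf; apply: (box_supported_integrable _ _ sf).
  exact: continuous_measurable_rV.
exact: (box_supported_bounded cf sf).
Qed.

(** By Fubini's theorem the integral can be taken along the lines of direction
    [p] first, where the fundamental theorem of calculus expresses it by values
    of [f] outside of its support. *)
Lemma integral_partial0 n M (f : 'rV[R]_n -> R) Df p : C1_box M f Df ->
  (\int[lebesgue_rV R n]_x (Df p x)%:E = 0)%E.
Proof.
elim: n => [|n IHn] in f Df p *; first by case: p.
move=> fD; have [[cf sf] cD dD] := fD; have [cDp sDp] := cD p.
have [E1 E2] := fubini_rV (C1_box_integrable cDp sDp).
have [j|] := unliftP ord0 p => pE.
  rewrite E1 -[RHS](@integral0 _ _ _ (@lebesgue_measure R) setT).
  apply: eq_integral => t _ /=; rewrite pE.
  exact: IHn _ _ _ (C1_box_slice t fD).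
rewrite E2 -[RHS](@integral0 _ _ _ (lebesgue_rV R n) setT).
apply: eq_integral => v _ /=.
pose F (t : R) : R := f (rV_cons (t : measurableTypeR R, v)).
pose g (t : R) : R := Df p (rV_cons (t : measurableTypeR R, v)).
have dF t : is_derive t (1 : R) F (g t).
  apply: is_derive_line (dD p (rV_cons (t : measurableTypeR R, v))) => h.
  by rewrite /F pE -rV_cons_ord0 -rV_consD scaler0 add0r.
have cl (h : 'rV[R]_n.+1 -> R) : continuous h ->
    continuous (fun t : R => h (rV_cons (t : measurableTypeR R, v))).
  by move=> ch t; move=> B /ch; exact: continuous_rV_consl.
pose K : R := `|M| + 1.
have MK : M < K by rewrite /K (le_lt_trans (ler_norm M))// ltrDl.
have K0 : 0 < K by rewrite /K ltr_pwDr.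
transitivity (\int[@lebesgue_measure R]_(t in `[(- K)%R, K]) (g t)%:E)%E; last first.
  rewrite (@continuous_FTC2 _ _ F); last 4 first.
  - by lra.
  - apply: continuous_subspaceT; exact: cl.
  - split.
    + by move=> t _; have [] := dF t.
    + by apply: cvg_at_right_filter; exact: cl.
    + by apply: cvg_at_left_filter; exact: cl.
  - by move=> t _; rewrite derive1E; have [_ ->] := dF t.
  rewrite /F !(sf _ ord0) ?mxE ?unlift_none ?subee//= ?normrN ger0_norm//; exact: ltW.
rewrite [RHS]integral_mkcond; apply: eq_integral => t _.
rewrite patchE; case: ifPn => // /negP; rewrite inE /= in_itv/= -ler_norml => /negP.
rewrite -ltNge => Kt; rewrite /= (sDp _ ord0)// mxE unlift_none/=.
exact: lt_trans Kt.
Qed.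

End C1_compact.

(** * Friedrichs' inequality *)
Section one_dimensional.
Context (R : realType).
Local Notation leb := (@lebesgue_measure R).

Lemma leb_itv (a b : R) : a <= b -> leb `[a, b[%classic = (b - a)%:E.
Proof.
rewrite le_eqVlt => /orP[/eqP ->|ab]; rewrite lebesgue_measure_itv/= lte_fin.
  by rewrite ltxx subrr.
by rewrite ab EFinB.
Qed.

Lemma leb_itvcc (a b : R) : a <= b -> leb `[a, b]%classic = (b - a)%:E.
Proof.
rewrite le_eqVlt => /orP[/eqP ->|ab]; rewrite lebesgue_measure_itv/= lte_fin.
  by rewrite ltxx subrr.
by rewrite ab EFinB.
Qed.

(** The fundamental theorem of calculus, followed by the Cauchy-Schwarz
    inequality. *)
Lemma sqr_increment_le (F g : R -> R) (a b s t : R) : continuous g ->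
  (forall x, is_derive x (1 : R) F (g x)) -> a <= s -> s <= t -> t <= b ->
  (((F t - F s) ^+ 2)%:E <= (b - a)%:E * \int[leb]_(x in `[a, b[) (g x ^+ 2)%:E)%E.
Proof.
move=> cg dF as_ st tb.
have mg D : measurable_fun D g by apply: measurable_funTS; exact: continuous_measurable_fun.
have [<-|s_t] := eqVneq s t.
  rewrite subrr expr0n/= mule_ge0 ?lee_fin ?subr_ge0//; first lra.
  by apply: integral_ge0 => x _; rewrite lee_fin sqr_ge0.
have {}st : s < t by rewrite lt_neqAle s_t.
have mI : measurable (`[s, t] : set R) by exact: measurable_itv.
have g2 : L2 leb `[s, t]%classic g.
  apply: L2P => //; first exact: mg.
  have iv : leb.-integrable `[s, t]%classic (EFin \o (fun x => g x ^+ 2)).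
    apply: continuous_compact_integrable; first exact: segment_compact.
    by apply: continuous_subspaceT => x; apply: cvgM; exact: cg.
  exact: integrable_lty iv.
have one2 : L2 leb `[s, t]%classic (cst 1).
  apply: L2P => //.
  rewrite (_ : (fun _ => _) = cst 1%E); last by apply/funext => x /=; rewrite expr1n.
  by rewrite integral_cst// mul1e [X in (X < _)%E]leb_itvcc ?ltry// ltW.
have -> : F t - F s = ip leb `[s, t]%classic g (cst 1).
  apply: EFin_inj; rewrite EFin_ip//.
  under eq_integral do rewrite mulr1.
  rewrite (@continuous_FTC2 _ _ F)//.
  - exact: continuous_subspaceT.
  - have cF : continuous F.
      move=> x; apply: differentiable_continuous; apply/derivable1_diffP.
      by have [] := dF x.
    split.
    + by move=> x _; have [] := dF x.
    + by apply: cvg_at_right_filter; exact: cF.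
    + by apply: cvg_at_left_filter; exact: cF.
  - by move=> x _; rewrite derive1E; have [_ ->] := dF x.
apply: (@le_trans _ _ ((t - s)%:E * \int[leb]_(x in `[s, t]) (g x ^+ 2)%:E)%E).
  have -> : (\int[leb]_(x in `[s, t]) (g x ^+ 2)%:E)%E = (ip leb `[s, t]%classic g g)%:E.
    by rewrite EFin_ip//; apply: eq_integral => x _; rewrite expr2.
  rewrite -EFinM lee_fin (le_trans (ip_CS _ g2 one2))// mulrC ler_wpM2r ?ip_ge0//.
  rewrite -lee_fin EFin_ip//.
  under eq_integral do rewrite mulr1.
  by rewrite (@integral_cst _ _ _ leb _ mI 1%E) mul1e [X in (X <= _)%E]leb_itvcc// ltW.
have m2 D : measurable_fun D (fun x => (g x ^+ 2)%:E).
  by apply/measurable_EFinP; exact: measurable_funX.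
apply: lee_pmul.
- by rewrite lee_fin subr_ge0 ltW.
- by apply: integral_ge0 => x _; rewrite lee_fin sqr_ge0.
- by rewrite lee_fin; lra.
- rewrite [leRHS]integral_itv_bndo_bndc//.
  apply: ge0_subset_integral => //.
  + exact: m2.
  + by move=> x _; rewrite lee_fin sqr_ge0.
  + by move=> x /=; rewrite !in_itv/= => /andP[sx xt]; rewrite (le_trans as_ sx) (le_trans xt tb).
Qed.

Lemma integral_itv_split (phi : R -> \bar R) (a h : R) K :
  measurable_fun setT phi -> (forall x, 0 <= phi x)%E -> 0 <= h ->
  (\int[leb]_(x in `[a, (a + h *+ K)%R[) phi x =
   \sum_(i < K) \int[leb]_(x in `[(a + h *+ i)%R, (a + h *+ i.+1)%R[) phi x)%E.
Proof.
move=> mphi phi0 h0; elim: K => [|K IHK].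
  by rewrite mulr0n addr0 set_itvco0 integral_set0 big_ord0.
rewrite big_ord_recr/= -IHK.
rewrite (@itv_bndbnd_setU _ _ _ (BLeft (a + h *+ K))) ?bnd_simp; last 2 first.
- by rewrite lerDl mulrn_wge0.
- by rewrite lerD2l mulrSr lerDl.
rewrite ge0_integral_setU//.
- exact: measurable_funTS.
- apply/disj_setPS => x [] /=; rewrite !in_itv/= => /andP[_ xl] /andP[xr _].
  by move: (lt_le_trans xl xr); rewrite ltxx.
Qed.

(** [h * g t] differs from the integral of [g] by the integral over [s] of the
    increments [g t - g s], whose absolute values are at most [sqrt kappa]. *)
Lemma mean_approx (g : R -> R) (a h kappa : R) : 0 < h -> 0 <= kappa ->
  measurable_fun setT g ->
  (forall s t, s \in `[a, (a + h)%R[ -> t \in `[a, (a + h)%R[ ->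
     (g t - g s) ^+ 2 <= kappa) ->
  (\int[leb]_(x in `[a, (a + h)%R[) (g x ^+ 2)%:E <=
   (2 / h * (\int[leb]_(x in `[a, (a + h)%R[) g x) ^+ 2 + 2 * h * kappa)%:E)%E.
Proof.
move=> h0 k0 mg gk; set I := `[a, (a + h)%R[%classic.
have mI : measurable I by exact: measurable_itv.
have lI : leb I = h%:E by rewrite leb_itv ?lerDl ?ltW// addrAC subrr add0r.
have aI : a \in `[a, a + h[ by rewrite in_itv/= lexx ltrDl.
have dk s t : s \in `[a, a + h[ -> t \in `[a, a + h[ -> `|g t - g s| <= Num.sqrt kappa.
  by move=> sI tI; rewrite -sqrtr_sqr ler_wsqrtr// gk.
have ig (phi : R -> R) C : measurable_fun setT phi ->
    (forall s, s \in `[a, a + h[ -> `|phi s| <= C) -> leb.-integrable I (EFin \o phi).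
  move=> mphi phiC; apply: measurable_bounded_integrable => //.
  - by rewrite [X in (X < _)%E]lI ltry.
  - exact: measurable_funTS.
  - exists C; split => [|y Cy x Ix]; first exact: num_real.
    by apply: le_trans (phiC x Ix) _; exact: ltW.
have g1 : leb.-integrable I (EFin \o g).
  apply: (ig g (`|g a| + Num.sqrt kappa)) => // s sI.
  by rewrite -[g s](subrK (g a)) (le_trans (ler_normD _ _))// addrC lerD2l dk.
set A := (\int[leb]_(x in I) g x)%R.
have gA t : t \in `[a, a + h[ -> g t ^+ 2 <= 2 / h ^+ 2 * A ^+ 2 + 2 * kappa.
  move=> tI.
  have mB : measurable_fun setT (fun s => g t - g s).
    by apply: measurable_funB => //; exact: measurable_cst.
  have i1 : leb.-integrable I (EFin \o (fun s => g t - g s)).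
    by apply: (ig _ (Num.sqrt kappa)) => // s sI; exact: dk.
  have Ic (c : R) : \int[leb]_(x in I) c = h * c.
    by rewrite Rintegral_cst//= mulrC; congr (_ * _); exact: (congr1 fine lI).
  have ic (c : R) : leb.-integrable I (EFin \o cst c).
    by apply: (ig _ `|c|) => //; exact: measurable_cst.
  have E : h * g t - A = \int[leb]_(s in I) (g t - g s).
    rewrite RintegralB//; last exact: ic.
    by rewrite Ic.
  have : `|h * g t - A| <= h * Num.sqrt kappa.
    rewrite E (le_trans (le_normr_Rintegral _ i1))//.
    rewrite -Ic.
    apply: le_Rintegral => //.
    - by apply: (ig _ (Num.sqrt kappa)) => [|s sI]; [exact: measurableT_comp|rewrite normr_id dk].
    - exact: ic.
    - by move=> s sI; exact: dk.
  rewrite ler_norml => /andP[l1 l2].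
  have sk := sqr_sqrtr k0; have s0 := sqrtr_ge0 kappa.
  have hg : (h * g t) ^+ 2 <= 2 * A ^+ 2 + 2 * (h ^+ 2 * kappa).
    set B := h * Num.sqrt kappa in l1 l2; rewrite (_ : h ^+ 2 * kappa = B ^+ 2); last by rewrite exprMn sk.
    have : (h * g t - A) ^+ 2 <= B ^+ 2.
      by rewrite -real_normK ?num_real// lerXn2r ?nnegrE ?mulr_ge0 ?(ltW h0)// ler_norml l1.
    by have := sqr_ge0 (h * g t - 2 * A); nra.
  rewrite -(ler_pM2l (_ : 0 < h ^+ 2)) ?exprn_gt0// -exprMn (le_trans hg)//.
  rewrite le_eqVlt; apply/orP; left; apply/eqP; field; exact: lt0r_neq0.
apply: (@le_trans _ _ (\int[leb]_(x in I) (cst (2 / h ^+ 2 * A ^+ 2 + 2 * kappa)%:E) x)%E).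
  apply: ge0_le_integral => //.
  - by move=> x _; rewrite lee_fin sqr_ge0.
  - by apply/measurable_EFinP; apply: measurable_funX; exact: measurable_funTS.
rewrite integral_cst// [X in (_ * X)%E]lI -EFinM lee_fin.
rewrite le_eqVlt; apply/orP; left; apply/eqP; field; exact: lt0r_neq0.
Qed.

(** The interval [[-M, M[] is cut into [K] pieces of length [h], and [mean_approx]
    is applied to each piece. [E] stands for the square of a derivative: only the
    estimate of the increments that it provides is available for the functions to
    which this is applied. *)
Lemma friedrichs1 (g E : R -> R) (M W h : R) K : h = 2 * M / K%:R -> (0 < K)%N -> 0 < M -> 0 <= W ->
  measurable_fun setT g -> measurable_fun setT E -> (forall t, 0 <= E t) ->
  (forall t, M <= `|t| -> g t = 0) ->
  (forall a b s t : R, a < b -> s \in `[a, b[ -> t \in `[a, b[ ->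
     (((g t - g s) ^+ 2)%:E <= (W * (b - a))%:E * \int[leb]_(x in `[a, b[) (E x)%:E)%E) ->
  (\int[leb]_x (E x)%:E < +oo)%E ->
  (\int[leb]_x (g x ^+ 2)%:E <=
   (\sum_(i < K) 2 / h *
      (\int[leb]_(x in `[(- M + h *+ i)%R, (- M + h *+ i.+1)%R[) g x) ^+ 2)%:E
   + (2 * h ^+ 2 * W)%:E * \int[leb]_x (E x)%:E)%E.
Proof.
move=> hE K0 M0 W0 mg mE E0 gM gE Eoo.
have KR : 0 < K%:R :> R by rewrite ltr0n.
have h0 : 0 < h by rewrite hE divr_gt0// mulr_gt0.
have hK : - M + h *+ K = M.
  by rewrite -mulr_natr hE; field; exact: lt0r_neq0.
have mg2 : measurable_fun setT (fun x => (g x ^+ 2)%:E).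
  by apply/measurable_EFinP; exact: measurable_funX.
have mE' : measurable_fun setT (fun x => (E x)%:E) by exact/measurable_EFinP.
have E0' x : (0 <= (E x)%:E)%E by rewrite lee_fin.
pose I i : set R := `[(- M + h *+ i)%R, (- M + h *+ i.+1)%R[%classic.
pose e i := fine (\int[leb]_(x in I i) (E x)%:E).
have eE i : (\int[leb]_(x in I i) (E x)%:E = (e i)%:E)%E.
  rewrite fineK// ge0_fin_numE ?integral_ge0//.
  apply: le_lt_trans Eoo; apply: ge0_subset_integral => //; exact: measurable_itv.
have e0 i : 0 <= e i by apply: fine_ge0; exact: integral_ge0.
have gI i : (\int[leb]_(x in I i) (g x ^+ 2)%:E <=
    (2 / h * (\int[leb]_(x in I i) g x) ^+ 2 + 2 * h ^+ 2 * W * e i)%:E)%E.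
  have IE : - M + h *+ i.+1 = - M + h *+ i + h by rewrite mulrSr addrA.
  rewrite /I IE; apply: le_trans (mean_approx h0 _ mg _) _.
  - by apply: (@mulr_ge0 _ (W * h) (e i)); rewrite ?mulr_ge0// ltW.
  - move=> s t sI tI; have := gE _ _ s t _ sI tI; rewrite ltrDl => /(_ h0).
    by rewrite -IE eE -EFinM lee_fin IE (addrAC (- M + _)) subrr add0r.
  rewrite lee_fin lerD2l le_eqVlt; apply/orP; left; apply/eqP; ring.
have -> : (\int[leb]_x (g x ^+ 2)%:E = \int[leb]_(x in `[(- M)%R, M[) (g x ^+ 2)%:E)%E.
  rewrite [RHS]integral_mkcond; apply: eq_integral => x _.
  rewrite patchE; case: ifPn => // /negP; rewrite inE/= in_itv/= => /negP xM.
  rewrite gM ?expr0n//; move: xM; rewrite negb_and -ltNge -leNgt ler_normr; lra.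
have := @integral_itv_split _ (- M) h K mg2 (fun x => _) (ltW h0).
rewrite hK => -> //; last by move=> x; rewrite lee_fin sqr_ge0.
apply: le_trans (lee_sum _ (fun (i : 'I_K) _ => gI i)) _.
rewrite sumEFin big_split/= EFinD; apply: leeD => //.
rewrite -mulr_sumr EFinM; apply: lee_wpmul2l.
  by rewrite lee_fin mulr_ge0// mulr_ge0// sqr_ge0.
rewrite -sumEFin.
under eq_bigr do rewrite -eE.
have := @integral_itv_split _ (- M) h K mE' E0' (ltW h0); rewrite hK => <-.
by apply: ge0_subset_integral => //; exact: measurable_itv.
Qed.

End one_dimensional.

Section friedrichs.
Context (R : realType).
Local Notation leb := (@lebesgue_measure R).
Local Notation lebn n := (lebesgue_rV R n).

Definition tensor n (a : R -> R) (w : 'rV[R]_n -> R) (x : 'rV[R]_n.+1) : R :=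
  a (rV_uncons x).1 * w (rV_uncons x).2.

Lemma tensor_cons n a (w : 'rV[R]_n -> R) t v :
  tensor a w (rV_cons (t : measurableTypeR R, v)) = a t * w v.
Proof. by rewrite /tensor rV_consK. Qed.

Lemma L2_tensor n a (w : 'rV[R]_n -> R) :
  L2 leb setT a -> L2 (lebn n) setT w -> L2 (lebn n.+1) setT (tensor a w).
Proof.
move=> a2 w2.
have mt : measurable_fun setT (tensor a w).
  apply: measurable_funM.
    apply: (measurableT_comp a2.1); apply: measurableT_comp => //.
    exact: measurable_rV_uncons.
  apply: (measurableT_comp w2.1); apply: measurableT_comp => //.
  exact: measurable_rV_uncons.
apply: L2P => //; rewrite tonelli_rV; last 2 first.
- by apply/measurable_EFinP; exact: measurable_funX.
- by move=> x; rewrite lee_fin sqr_ge0.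
have E t : (\int[lebn n]_v (tensor a w (rV_cons (t : measurableTypeR R, v)) ^+ 2)%:E =
    (ip (lebn n) setT w w)%:E * (a t * a t)%:E)%E.
  rewrite EFin_ip// muleC -ge0_integralZl//.
  - by apply: eq_integral => v _; rewrite tensor_cons -EFinM; congr EFin; ring.
  - by apply/measurable_EFinP; apply: measurable_funM; exact: w2.1.
  - by move=> v _; rewrite lee_fin -expr2 sqr_ge0.
  - by rewrite lee_fin -expr2 sqr_ge0.
under eq_integral do rewrite E.
rewrite ge0_integralZl//.
- by rewrite -EFin_ip// -EFinM ltry.
- by apply/measurable_EFinP; apply: measurable_funM; exact: a2.1.
- by move=> t _; rewrite lee_fin -expr2 sqr_ge0.
- by rewrite lee_fin ip_ge0.
Qed.

Lemma L2_itv (c a b : R) : a <= b -> L2 leb setT (fun x => c * \1_(`[a, b[%classic) x).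
Proof.
move=> ab; apply: L2Z => //; apply: L2P; first exact: measurable_indic.
have E x : ((\1_(`[a, b[%classic) x ^+ 2)%:E = (\1_(`[a, b[%classic) x)%:E :> \bar R)%E.
  by rewrite indicE; case: (x \in _); rewrite ?expr1n ?expr0n.
under eq_integral do rewrite E.
by rewrite integral_indic//= setIT [X in (X < _)%E]leb_itv// ltry.
Qed.

Lemma C1_box_L2 n M (f : 'rV[R]_n -> R) :
  continuous f -> box_supported M f -> L2 (lebn n) setT f.
Proof.
move=> cf sf; split; first exact: continuous_measurable_rV.
apply: (@C1_box_integrable _ _ M) => [x|x i xi].
- by apply: continuousM; exact: cf.
- by rewrite mulfE (sf x i)// mul0r.
Qed.

Section slices.
Context n (M : R) (f : 'rV[R]_n.+1 -> R) (cf : continuous f) (sf : box_supported M f).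

Lemma slice_cont t : continuous (slice f t) /\ box_supported M (slice f t).
Proof.
split=> [v B /cf|v i vi]; first exact: continuous_rV_cons.
by apply: (sf (i := lift ord0 i)); rewrite mxE liftK.
Qed.

Lemma slice_L2 t : L2 (lebn n) setT (slice f t).
Proof. by have [cs ss] := slice_cont t; exact: C1_box_L2 cs ss. Qed.

Lemma slice_out t : M < `|t| -> slice f t = 0.
Proof.
move=> tM; apply/funext => v; apply: (sf (i := ord0)).
by rewrite mxE unlift_none.
Qed.

Let ff_ge0 x : (0 <= (f x * f x)%:E)%E.
Proof. by rewrite lee_fin -expr2 sqr_ge0. Qed.

Let mff : measurable_fun setT (fun x => (f x * f x)%:E).
Proof. by apply/measurable_EFinP; apply: measurable_funM; exact: continuous_measurable_rV. Qed.

Lemma slice_normE t :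
  (ip (lebn n) setT (slice f t) (slice f t))%:E =
  (\int[lebn n]_v (f (rV_cons (t : measurableTypeR R, v)) * f (rV_cons (t : measurableTypeR R, v)))%:E)%E.
Proof. by rewrite EFin_ip//; exact: slice_L2. Qed.

Lemma measurable_slice_norm :
  measurable_fun setT (fun t => ip (lebn n) setT (slice f t) (slice f t)).
Proof.
apply/measurable_EFinP; rewrite (_ : _ \o _ = fun t : measurableTypeR R =>
  (\int[lebn n]_v (f (rV_cons (t, v)) * f (rV_cons (t, v)))%:E)%E).
  apply: (@measurable_fun_fubini_tonelli_F _ _ _ _ _ (lebn n)
    (fun p : measurableTypeR R * _ => (f (rV_cons p) * f (rV_cons p))%:E)) => //.
  exact: measurableT_comp mff (@measurable_rV_cons R n).
by apply/funext => t; exact: slice_normE.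
Qed.

Lemma integral_slice_norm :
  (\int[leb]_t (ip (lebn n) setT (slice f t) (slice f t))%:E =
   (ip (lebn n.+1) setT f f)%:E)%E.
Proof.
rewrite EFin_ip//; last 2 first.
- exact: (C1_box_L2 cf sf).
- exact: (C1_box_L2 cf sf).
by rewrite tonelli_rV//; apply: eq_integral => t _; exact: slice_normE.
Qed.

End slices.

Section slice_pairing.
Context n (M : R) (f : 'rV[R]_n.+1 -> R) (cf : continuous f) (sf : box_supported M f).
Variables (w : 'rV[R]_n -> R) (w2 : L2 (lebn n) setT w).

Let pairing t := ip (lebn n) setT (slice f t) w.

Let integrable_tensor a : L2 leb setT a ->
  (lebn n.+1).-integrable setT (EFin \o (f * tensor a w)).
Proof. by move=> a2; apply: L2M => //; [exact: C1_box_L2 sf|exact: L2_tensor]. Qed.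

Let pairingE a t : L2 leb setT a ->
  (\int[lebn n]_v ((f * tensor a w) (rV_cons (t : measurableTypeR R, v)))%:E =
   (a t * pairing t)%:E)%E.
Proof.
move=> a2.
have sl2 := slice_L2 cf sf t.
rewrite /pairing -(ipZl (mu := lebn n) _ (a t) sl2 w2)// EFin_ip//; last exact: L2Z.
apply: eq_integral => v _; rewrite mulfE tensor_cons scalefE; congr EFin.
by rewrite /slice; ring.
Qed.

Lemma integral_slice_pairing a : L2 leb setT a ->
  (\int[leb]_t (a t * pairing t)%:E = (ip (lebn n.+1) setT f (tensor a w))%:E)%E.
Proof.
move=> a2; have [E _] := fubini_rV (integrable_tensor a2).
rewrite EFin_ip//; last 2 first.
- exact: C1_box_L2 sf.
- exact: L2_tensor.
rewrite -[RHS]/(\int[lebn n.+1]_x (EFin \o (f * tensor a w)%R) x)%E E.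
by apply: eq_integral => t _; rewrite [RHS]pairingE.
Qed.

Lemma measurable_slice_pairing : measurable_fun setT pairing.
Proof.
(* the slices vanish outside [[-K, K[], so multiplying by its indicator leaves the
   pairing unchanged and makes Fubini's theorem applicable *)
pose K := `|M| + 1; pose a := fun x : R => 1 * \1_(`[- K, K[%classic) x : R.
have K0 : 0 <= K by rewrite /K addr_ge0.
have a2 : L2 leb setT a by apply: L2_itv; rewrite ge0_cp.
have mF := measurable_fubini_F (integrable_rV_pair (integrable_tensor a2)).
apply/measurable_EFinP; apply: eq_measurable_fun mF => t _.
rewrite /fubini_F [LHS]pairingE//=; congr EFin.
rewrite /a mul1r indicE; case: (boolP (t \in _)) => [_|/negP]; first by rewrite mul1r.
rewrite mul0r inE /= in_itv/= => Kt; rewrite /pairing (slice_out sf) ?ip0l//.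
have := ler_norm M; have := ler_norm t; have := ler_norm (- t); rewrite normrN.
move: Kt => /negP; rewrite negb_and -ltNge -leNgt /K; lra.
Qed.

End slice_pairing.

(** By Cauchy-Schwarz the increments of the pairing of the slices with [w] are
    controlled by those of the slices, hence by the first partial derivative. *)
Lemma sqr_increment_pairing n M (f : 'rV[R]_n.+1 -> R) Df (w : 'rV[R]_n -> R) a b s t :
  C1_box M f Df -> L2 (lebn n) setT w -> a < b -> s \in `[a, b[ -> t \in `[a, b[ ->
  (((ip (lebn n) setT (slice f t) w - ip (lebn n) setT (slice f s) w) ^+ 2)%:E <=
   (ip (lebn n) setT w w * (b - a))%:E *
     \int[leb]_(x in `[a, b[)
       (ip (lebn n) setT (slice (Df ord0) x) (slice (Df ord0) x))%:E)%E.
Proof.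
move=> fD w2 ab; have [[cf sf] cD dD] := fD; have [cD0 sD0] := cD ord0.
wlog st : s t / s <= t.
  move=> H sI tI; have [/H|/ltW/H] := leP s t; first exact.
  by rewrite -sqrrN opprB; exact.
rewrite !in_itv/= => /andP[as_ sb] /andP[at_ tb].
have s2 x : L2 (lebn n) setT (slice f x) by exact: slice_L2 sf x.
have D2 x : L2 (lebn n) setT (slice (Df ord0) x) by exact: slice_L2 sD0 x.
have d2 : L2 (lebn n) setT (slice f t - slice f s) by exact: L2B.
rewrite -ipBl//.
apply: (@le_trans _ _ ((ip (lebn n) setT w w)%:E *
    (ip (lebn n) setT (slice f t - slice f s) (slice f t - slice f s))%:E)%E).
  by rewrite -EFinM lee_fin mulrC ip_CS.
rewrite EFinM -muleA; apply: lee_wpmul2l; first by rewrite lee_fin ip_ge0.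
rewrite EFin_ip//.
pose phi (p : measurableTypeR R * 'rV[R]_n) :=
  ((Df ord0 (rV_cons p) ^+ 2) * \1_(`[a, b[%classic) p.1)%:E.
have mphi : measurable_fun setT phi.
  apply/measurable_EFinP; apply: measurable_funM.
    apply: measurable_funX; apply: measurableT_comp (@measurable_rV_cons R n).
    exact: continuous_measurable_rV.
  apply: measurableT_comp => //; exact: measurable_indic.
have phi0 p : (0 <= phi p)%E by rewrite lee_fin mulr_ge0 ?sqr_ge0// indicE.
have b_a : (0 <= (b - a)%:E)%E by rewrite lee_fin subr_ge0 ltW.
have indE (u : R -> R) : measurable_fun setT u -> (forall x, 0 <= u x) ->
    (\int[leb]_(x in `[a, b[) (u x)%:E = \int[leb]_x (u x * \1_(`[a, b[%classic) x)%:E)%E.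
  move=> mu_ u0; rewrite integral_mkcond; apply: eq_integral => x _.
  by rewrite patchE indicE; case: ifPn => _; rewrite ?mulr1 ?mulr0.
apply: (@le_trans _ _ (\int[lebn n]_v ((b - a)%:E * \int[leb]_x phi (x, v)))%E).
  apply: ge0_le_integral => //.
  - by move=> v _; rewrite lee_fin -expr2 sqr_ge0.
  - by apply/measurable_EFinP; apply: measurable_funM; exact: d2.1.
  - have mG := @measurable_fun_fubini_tonelli_G _ _ _ _ R leb phi mphi phi0.
    exact: (measurable_funeM (b - a)%:E mG).
  - move=> v _; rewrite -expr2.
    have cv (h : 'rV[R]_n.+1 -> R) : continuous h ->
        continuous (fun x : R => h (rV_cons (x : measurableTypeR R, v))).
      by move=> ch x B /ch; exact: continuous_rV_consl.
    rewrite -indE; last 2 first.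
    + by apply: measurable_funX; apply: continuous_measurable_fun; exact: cv.
    + by move=> x; rewrite sqr_ge0.
    apply: (@sqr_increment_le _ (fun x : R => f (rV_cons (x : measurableTypeR R, v)))) => //.
    + exact: cv.
    + move=> x; apply: is_derive_line (dD ord0 (rV_cons (x : measurableTypeR R, v))) => h.
      by rewrite -rV_cons_ord0 -rV_consD scaler0 add0r.
    + exact: ltW.
rewrite ge0_integralZl//; last first.
- by move=> v _; exact: integral_ge0.
- exact: (@measurable_fun_fubini_tonelli_G _ _ _ _ R leb phi mphi phi0).
rewrite -(@fubini_tonelli _ _ _ _ R leb (lebn n) phi mphi phi0).
apply: lee_wpmul2l => //; rewrite indE; last 2 first.
- exact: measurable_slice_norm cD0 sD0.
- by move=> x; exact: ip_ge0.
rewrite le_eqVlt; apply/orP; left; apply/eqP; apply: eq_integral => x _.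
rewrite EFinM EFin_ip// muleC -ge0_integralZl//.
- by apply: eq_integral => v _; rewrite /phi -EFinM mulrC expr2.
- by apply/measurable_EFinP; apply: measurable_funM; exact: (D2 x).1.
- by move=> v _; rewrite lee_fin -expr2 sqr_ge0.
Qed.

Lemma integral_rV0 (phi : 'rV[R]_0 -> R) :
  \int[lebn 0]_x phi x = phi 0.
Proof.
rewrite /Rintegral integral_dirac//; first by rewrite diracE mem_set// mul1e.
apply/measurable_EFinP; apply: continuous_measurable_rV => x B /= /nbhs_singleton Bx.
by apply/nbhs_rVP; exists 1 => // y _; rewrite /= (_ : y = x)//; apply/rowP => -[].
Qed.

(** By induction on the dimension. On each slice of [f] the inequality in
    dimension [n] bounds the norm by the derivatives along the slice and by the
    pairings [g l t] of the slice with finitely many functions [w l]. As functions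
    of [t], these have increments controlled by the first partial derivative
    ([sqr_increment_pairing]), so [friedrichs1] replaces their norms by finitely
    many averages. The averages are the pairings of [f] with the products of the
    indicators of intervals with the [w l]. *)
Lemma friedrichs n (M eps : R) : 0 < eps ->
  exists (T : finType) (w : T -> 'rV[R]_n -> R),
    (forall l, L2 (lebn n) setT (w l)) /\
    forall f Df, C1_box M f Df ->
      ip (lebn n) setT f f <= eps * \sum_p ip (lebn n) setT (Df p) (Df p) +
                              \sum_l ip (lebn n) setT f (w l) ^+ 2.
Proof.
move=> eps0; elim: n => [|n [T [w [w2 IHn]]]].
  exists unit, (fun _ _ => 1); split=> [_|f Df _].
    apply: L2P; first exact: measurable_cst.
    rewrite (_ : (fun _ => _) = cst 1%E); last by apply/funext => x; rewrite expr1n.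
    by rewrite integral_cst//= mul1e diracE ltry.
  rewrite big_ord0 mulr0 add0r /ip [leLHS]integral_rV0 big_const card_unit/= addr0.
  by rewrite [X in _ <= X ^+ 2](_ : _ = f 0) ?expr2// [LHS]integral_rV0 -[RHS]mulr1.
pose W l := ip (lebn n) setT (w l) (w l).
have W0 l : 0 <= W l by exact: ip_ge0.
pose S := \sum_l W l.
have S0 : 0 <= S by apply: sumr_ge0.
pose M' := `|M| + 1.
have M'0 : 0 < M' by rewrite /M' ltr_wpDl.
(* large enough for the intervals to have a length [h] such that
   [2 h^2 S <= eps] *)
pose K := Num.bound (2 * M' * (1 + (2 * S) / eps)).
have K_gt : 2 * M' * (1 + (2 * S) / eps) < K%:R.
  by rewrite /K archi_boundP// mulr_ge0 ?addr_ge0 ?divr_ge0 ?mulr_ge0// ltW.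
have KR : 0 < K%:R :> R.
  by apply: le_lt_trans K_gt; rewrite mulr_ge0 ?addr_ge0 ?divr_ge0 ?mulr_ge0// ltW.
pose h := 2 * M' / K%:R.
have h0 : 0 < h by rewrite divr_gt0// mulr_gt0.
have hS : h * (1 + (2 * S) / eps) <= 1.
  rewrite /h mulrAC ler_pdivrMr// mul1r; exact: ltW.
have hS2 : 2 * h ^+ 2 * S <= eps.
  have t0 : 0 <= 2 * S / eps by rewrite divr_ge0 ?mulr_ge0// ltW.
  have h1 : h <= 1 by nra.
  have : h * (2 * S / eps) <= 1 by nra.
  rewrite mulrA ler_pdivrMr// mul1r; nra.
pose I (i : 'I_K) : set R := `[(- M' + h *+ i), (- M' + h *+ i.+1)[%classic.
(* with this factor the squared pairings with the [a i] are the terms of the sum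
   in [friedrichs1] *)
pose c := Num.sqrt (2 / h).
have c2 : c ^+ 2 = 2 / h by rewrite sqr_sqrtr// divr_ge0// ltW.
pose a i : R -> R := fun x => c * \1_(I i) x.
have a2 i : L2 leb setT (a i).
  by apply: L2_itv; rewrite lerD2l mulrSr lerDl ltW.
exists (T * 'I_K)%type, (fun li => tensor (a li.2) (w li.1)); split=> [li|f Df fD].
  exact: L2_tensor.
have [[cf sf] cD dD] := fD; have [cD0 sD0] := cD ord0.
pose g l t := ip (lebn n) setT (slice f t) (w l).
pose E t := ip (lebn n) setT (slice (Df ord0) t) (slice (Df ord0) t).
have mg l : measurable_fun [set: measurableTypeR R] (g l).
  have X := measurable_slice_pairing cf sf (w2 l).
  exact: X.
have mE : measurable_fun setT E by exact: measurable_slice_norm cD0 sD0.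
have E0 t : 0 <= E t by exact: ip_ge0.
have IE : (\int[leb]_t (E t)%:E = (ip (lebn n.+1) setT (Df ord0) (Df ord0))%:E)%E.
  exact: integral_slice_norm cD0 sD0.
have gL2 l : L2 leb setT (g l).
  apply: L2P => //.
  have cs t : g l t ^+ 2 <= ip (lebn n) setT (slice f t) (slice f t) * W l.
    by apply: ip_CS => //; exact: slice_L2 cf sf t.
  apply: (@le_lt_trans _ _ ((W l)%:E *
      \int[leb]_t (ip (lebn n) setT (slice f t) (slice f t))%:E)%E).
    have ms : measurable_fun [set: measurableTypeR R]
        (fun t => (ip (lebn n) setT (slice f t) (slice f t))%:E).
      by apply/measurable_EFinP; exact: measurable_slice_norm cf sf.
    have mg2 : measurable_fun [set: measurableTypeR R] (fun t => (g l t ^+ 2)%:E).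
      by apply/measurable_EFinP; apply: measurable_funX; exact: mg.
    rewrite -(ge0_integralZl _ _ ms)//.
    - apply: ge0_le_integral => //.
      + by move=> t _; rewrite lee_fin sqr_ge0.
      + exact: measurable_funeM.
      + by move=> t _; rewrite -EFinM lee_fin mulrC.
    - by move=> t _; rewrite lee_fin ip_ge0.
    - by rewrite lee_fin.
  by rewrite (integral_slice_norm cf sf) -EFinM ltry.
have c0 : c != 0 by rewrite sqrtr_eq0 -ltNge divr_gt0.
have pairE l i : ip (lebn n.+1) setT f (tensor (a i) (w l)) = c * \int[leb]_(x in I i) g l x.
  transitivity (ip leb setT (a i) (g l)).
    by apply: EFin_inj; rewrite -(integral_slice_pairing cf sf (w2 l) (a2 i)) EFin_ip.
  rewrite Rintegral_mkcond -RintegralZl//.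
    apply: eq_Rintegral => t _; rewrite -[LHS]/(a i t * g l t) /a patchE indicE.
    by case: (t \in I i); rewrite ?mulr1 ?mulr0 ?mul0r ?mulr0.
  rewrite (_ : _ \o _ = EFin \o (c^-1 *: (a i * g l))).
    exact/L1Z/L2M.
  apply/funext => t; rewrite /= patchE scalefE mulfE /a indicE; congr EFin.
  by case: (t \in I i); rewrite ?mulr1 ?mulr0 ?mul0r ?mulr0// mulKf.
have gI l : (\int[leb]_t (g l t ^+ 2)%:E <=
   (\sum_(i < K) ip (lebn n.+1) setT f (tensor (a i) (w l)) ^+ 2 +
    2 * h ^+ 2 * W l * ip (lebn n.+1) setT (Df ord0) (Df ord0))%:E)%E.
  apply: le_trans (@friedrichs1 _ (g l) E M' (W l) h K erefl _ M'0 (W0 l) (mg l) mE E0 _ _ _) _.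
  - by rewrite -(ltr0n R).
  - move=> t tM; rewrite /g (slice_out sf) ?ip0l//.
    by have := ler_norm M; rewrite /M' in tM; lra.
  - by move=> x y s t xy sI tI; exact: sqr_increment_pairing fD (w2 l) xy sI tI.
  - by rewrite IE ltry.
  rewrite IE -EFinM -EFinD lee_fin lerD2r; apply: ler_sum => i _.
  by rewrite pairE exprMn c2.
have N2 : (ip (lebn n.+1) setT f f <=
    eps * \sum_(p < n) ip (lebn n.+1) setT (Df (lift ord0 p)) (Df (lift ord0 p)) +
    \sum_l (\sum_(i < K) ip (lebn n.+1) setT f (tensor (a i) (w l)) ^+ 2 +
      2 * h ^+ 2 * W l * ip (lebn n.+1) setT (Df ord0) (Df ord0))).
  rewrite -lee_fin EFinD EFinM -[X in (_ <= _ * X + _)%E]sumEFin -[X in (_ <= _ + X)%E]sumEFin.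
  rewrite -(integral_slice_norm cf sf).
  pose eD p t := ip (lebn n) setT (slice (Df (lift ord0 p)) t) (slice (Df (lift ord0 p)) t).
  have meD p : measurable_fun [set: measurableTypeR R] (eD p).
    have [cDp sDp] := cD (lift ord0 p); have X := measurable_slice_norm cDp sDp.
    exact: X.
  have eD0 p t : 0 <= eD p t by exact: ip_ge0.
  have mf : measurable_fun [set: measurableTypeR R]
      (fun t => ip (lebn n) setT (slice f t) (slice f t)).
    have X := measurable_slice_norm cf sf; exact: X.
  have mg2 l : measurable_fun [set: measurableTypeR R] (fun t => g l t ^+ 2).
    exact: measurable_funX.
  have g20 l t : 0 <= g l t ^+ 2 by exact: sqr_ge0.
  have mr1 : measurable_fun [set: measurableTypeR R] (fun t => (\sum_p eD p t)%:E).
    by apply/measurable_EFinP; exact: measurable_sum.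
  have mr2 : measurable_fun [set: measurableTypeR R] (fun t => (\sum_l g l t ^+ 2)%:E).
    by apply/measurable_EFinP; exact: measurable_sum.
  apply: (@le_trans _ _ (\int[leb]_t (eps%:E * (\sum_p eD p t)%:E +
                                       (\sum_l g l t ^+ 2)%:E))%E).
    apply: ge0_le_integral => //.
    - by move=> t _; rewrite lee_fin ip_ge0.
    - exact/measurable_EFinP.
    - by apply: emeasurable_funD => //; exact: measurable_funeM.
    - by move=> t _; rewrite -EFinM -EFinD lee_fin; exact: IHn (C1_box_slice t fD).
  rewrite ge0_integralD//; last 3 first.
  - by move=> t _; rewrite -EFinM lee_fin mulr_ge0 ?sumr_ge0// ltW.
  - exact: measurable_funeM.
  - by move=> t _; rewrite lee_fin sumr_ge0.
  apply: leeD; last first.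
    by rewrite ge0_integral_sumr//; apply: lee_sum => l _; exact: gI.
  rewrite (ge0_integralZl _ _ mr1)//; last 2 first.
  - by move=> t _; rewrite lee_fin sumr_ge0.
  - by rewrite lee_fin ltW.
  apply: lee_wpmul2l; first by rewrite lee_fin ltW.
  rewrite ge0_integral_sumr//; apply: lee_sum => p _.
  by have [cDp sDp] := cD (lift ord0 p); rewrite (integral_slice_norm cDp sDp).
rewrite big_ord_recl mulrDr (le_trans N2)//.
rewrite -(pair_big xpredT xpredT (fun l i => ip (lebn n.+1) setT f (tensor (a i) (w l)) ^+ 2))/=.
rewrite big_split/= -mulr_suml -mulr_sumr -/S.
have := ip_ge0 (lebn n.+1) setT (Df ord0); nra.
Qed.

End friedrichs.

(** * Smooth functions and test functions *)
Section smooth_functions.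
Context (R : realType) (n : nat).
Implicit Types (f g : 'rV[R]_n -> R) (i p q : 'I_n) (x : 'rV[R]_n) (U : set 'rV[R]_n).

Lemma is_derive_partial f p x : differentiable f x ->
  is_derive x (delta_mx ord0 p) f (partial p f x).
Proof. by move=> /diff_derivable df; apply/derivableP; exact: df. Qed.

Lemma partialE f p x df : is_derive x (delta_mx ord0 p) f df -> partial p f x = df.
Proof. by case. Qed.

Lemma partialM f g p : (forall x, differentiable f x) -> (forall x, differentiable g x) ->
  partial p (f * g) = partial p f * g + f * partial p g.
Proof.
move=> df dg; apply/funext => x.
have fx := is_derive_partial p (df x); have gx := is_derive_partial p (dg x).
by rewrite (partialE (is_deriveM fx gx)) !pointwE addrC mulrC.
Qed.

Lemma partialD f g p : (forall x, differentiable f x) -> (forall x, differentiable g x) ->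
  partial p (f + g) = partial p f + partial p g.
Proof.
move=> df dg; apply/funext => x.
have fx := is_derive_partial p (df x); have gx := is_derive_partial p (dg x).
exact: partialE (is_deriveD fx gx).
Qed.

Lemma partial_cst (c : R) p : partial p (cst c) = cst 0.
Proof. by apply/funext => x; exact: partialE (is_derive_cst c x _). Qed.

Definition coordf q (x : 'rV[R]_n) : R := x ord0 q.

Lemma is_derive_coord p q x : is_derive x (delta_mx ord0 p) (coordf q) (p == q)%:R.
Proof.
have := is_deriveD (is_deriveZ (p == q)%:R (is_derive_id (0 : R) 1))
                   (is_derive_cst (coordf q x) (0 : R) 1).
rewrite addr0 [X in is_derive _ _ _ X]mulr1 => d.
apply: is_derive_line d => h; rewrite /coordf !mxE eqxx/= addr0 eq_sym [h%:A]mulr1.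
by rewrite mulrC.
Qed.

(** Finitely many derivatives, so that the product rule lends itself to an
    induction on their number. *)
Let smooth_upto k f := forall (s : seq 'I_n) x, (size s <= k)%N ->
  differentiable (foldr (@partial R n) f s) x.

Let smooth_uptoS k f : smooth_upto k.+1 f <->
  (forall x, differentiable f x) /\ forall p, smooth_upto k (partial p f).
Proof.
split => [fk|[df fk] s x].
  split => [x|p s x sk]; first exact: (fk [::] x).
  by have := fk (rcons s p) x; rewrite foldr_rcons size_rcons; exact.
case/lastP: s => [|s p]; first by move=> _; exact: df.
by rewrite foldr_rcons size_rcons ltnS; exact: fk.
Qed.

Let smooth_upto_le k l f : (k <= l)%N -> smooth_upto l f -> smooth_upto k f.
Proof. by move=> kl fl s x sk; apply: fl; exact: leq_trans kl. Qed.

Let smooth_uptoD k f g : smooth_upto k f -> smooth_upto k g -> smooth_upto k (f + g).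
Proof.
elim: k f g => [|k IHk] f g fk gk.
  move=> s x; rewrite leqn0 size_eq0 => /eqP -> /=.
  by apply: differentiableD; [exact: (fk [::])|exact: (gk [::])].
have /smooth_uptoS[df f'k] := fk; have /smooth_uptoS[dg g'k] := gk.
apply/smooth_uptoS; split => [x|p]; first exact: differentiableD.
by rewrite partialD//; exact: IHk.
Qed.

Let smooth_uptoM k f g : smooth_upto k f -> smooth_upto k g -> smooth_upto k (f * g).
Proof.
elim: k f g => [|k IHk] f g fk gk.
  move=> s x; rewrite leqn0 size_eq0 => /eqP -> /=.
  by apply: differentiableM; [exact: (fk [::])|exact: (gk [::])].
have /smooth_uptoS[df f'k] := fk; have /smooth_uptoS[dg g'k] := gk.
apply/smooth_uptoS; split => [x|p]; first exact: differentiableM.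
by rewrite partialM//; apply: smooth_uptoD; apply: IHk => //; exact: smooth_upto_le (leqnSn k) _.
Qed.

Lemma smoothD f g : smooth f -> smooth g -> smooth (f + g).
Proof. by move=> sf sg s x; apply: (@smooth_uptoD (size s)) => // s' y _. Qed.

Lemma smoothM f g : smooth f -> smooth g -> smooth (f * g).
Proof. by move=> sf sg s x; apply: (@smooth_uptoM (size s)) => // s' y _. Qed.

Lemma smooth_partial f p : smooth f -> smooth (partial p f).
Proof. by move=> sf s x; have := sf (rcons s p) x; rewrite foldr_rcons. Qed.

Lemma smooth_diff f x : smooth f -> differentiable f x.
Proof. by move=> sf; exact: (sf [::] x). Qed.

Lemma smooth_cst (c : R) : @smooth R n (cst c).
Proof.
suff H s : exists c', foldr (@partial R n) (cst c) s = cst c'.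
  by move=> s x; have [c' ->] := H s; exact: differentiable_cst.
elim: s => [|p s [c' IHs]] /=; first by exists c.
by exists 0; rewrite IHs partial_cst.
Qed.

Lemma partial_coord p q : partial p (coordf q) = cst (p == q)%:R.
Proof. by apply/funext => x; exact: partialE (is_derive_coord p q x). Qed.

Lemma smooth_coord q : smooth (coordf q).
Proof.
move=> s x; case/lastP: s => [|s p] /=; first exact: differentiable_coord.
by rewrite foldr_rcons partial_coord; exact: smooth_cst.
Qed.

Lemma smooth_continuous f : smooth f -> continuous f.
Proof. by move=> sf x; apply: differentiable_continuous; exact: smooth_diff. Qed.

Section test_functions.
Variable U : set 'rV[R]_n.

Let supp f := closure [set x | f x != 0].

Lemma supp_near0 f x : ~ supp f x -> \forall y \near x, f y = 0.
Proof.
move=> fx; have : interior (~` [set x | f x != 0]) x by rewrite interiorC.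
by apply: filterS => y /negP/negPn/eqP.
Qed.

Lemma test_sub f g : test_function U f -> smooth g ->
  (forall x, g x != 0 -> supp f x) -> test_function U g.
Proof.
move=> [sf cf Uf] sg gf.
have fg : supp g `<=` supp f 
  by rewrite /supp ((closure_id _).1 (@closed_closure _ [set x | f x != 0])); exact: closure_subset.
split => //; last exact: subset_trans fg Uf.
exact: subclosed_compact (@closed_closure _ _) cf fg.
Qed.

Lemma test_out f x : test_function U f -> ~ U x -> f x = 0.
Proof.
move=> [_ _ Uf] Ux; apply/eqP/negPn/negP => fx; apply: Ux; apply: Uf.
exact: subset_closure.
Qed.

Lemma test_near0 f x : test_function U f -> ~ U x -> \forall y \near x, f y = 0.
Proof. by move=> [_ _ Uf] Ux; apply: supp_near0 => /Uf. Qed.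

Lemma testM f g : smooth g -> test_function U f -> test_function U (g * f).
Proof.
move=> sg tf; apply: (test_sub tf); first by apply: smoothM => //; case: tf.
move=> x; rewrite mulfE mulf_eq0 negb_or => /andP[_ fx]; exact: subset_closure.
Qed.

Lemma testZ a f : test_function U f -> test_function U (a *: f).
Proof. exact: (@testM _ (cst a) (smooth_cst a)). Qed.

Lemma test_partial f p : test_function U f -> test_function U (partial p f).
Proof.
move=> tf; apply: (test_sub tf); first by apply: smooth_partial; case: tf.
move=> x; apply: contraNP => /supp_near0 f0; apply/eqP.
by rewrite /partial (@near_eq_derive _ _ _ f (cst 0)) ?derive_cst.
Qed.

Lemma testD f g : test_function U f -> test_function U g -> test_function U (f + g).
Proof.
move=> [sf cf Uf] [sg cg Ug].
have fgs : supp (f + g) `<=` supp f `|` supp g.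
  rewrite -closureU; apply: closure_subset => x /=; rewrite addfE => fg.
  by have [fx|] := eqVneq (f x) 0; [right; move: fg; rewrite fx add0r|left].
split; first exact: smoothD.
- apply: (subclosed_compact (@closed_closure _ _) _ fgs); exact: compactU.
- by move=> x /fgs[/Uf|/Ug].
Qed.

End test_functions.

End smooth_functions.

(** * Weak derivatives *)
Lemma sqr_sum_le (R : realType) n (y : 'I_n -> R) :
  (\sum_p y p) ^+ 2 <= n%:R * \sum_p y p ^+ 2.
Proof.
have E : 2 * (\sum_p y p) ^+ 2 <= 2 * (n%:R * \sum_p y p ^+ 2).
  rewrite expr2 big_distrlr/= mulr_sumr.
  apply: (@le_trans _ _ (\sum_p \sum_q (y p ^+ 2 + y q ^+ 2))).
    apply: ler_sum => p _; rewrite mulr_sumr; apply: ler_sum => q _.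
    by have := sqr_ge0 (y p - y q); rewrite sqrrB; lra.
  rewrite (eq_bigr (fun p => y p ^+ 2 *+ n + \sum_q y q ^+ 2)) => [|p _]; last first.
    by rewrite big_split/= sumr_const card_ord.
  rewrite big_split/= sumr_const card_ord sumrMnl -mulr2n.
  by rewrite mulrA -[_ *+ n]mulr_natl -[leLHS]mulr_natl mulrA.
by move: E; rewrite ler_pM2l.
Qed.

Section weak_derivatives.
Context (R : realType) (n : nat) (U : set 'rV[R]_n) (M : R).
Hypotheses (oU : open U) (UM : forall x i, U x -> `|x ord0 i| <= M).
Implicit Types (f g u v : 'rV[R]_n -> R) (d e : 'I_n -> 'rV[R]_n -> R) (p q : 'I_n).
Local Notation mu := (lebesgue_rV R n).
Local Notation L2U := (L2 mu U).
Local Notation ipU := (ip mu U).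
Local Notation test := (test_function U).

Let mU : measurable U.
Proof. exact: open_measurable_rV. Qed.

Definition bounded_cont f :=
  (forall x, U x -> {for x, continuous f}) /\
  exists2 C, 0 <= C & forall x, U x -> `|f x| <= C.

(** The powers of the height are singular outside of the half space, so nothing
    is asked of the factors outside of [U]. *)
Definition weight f (df : 'I_n -> 'rV[R]_n -> R) :=
  bounded_cont f /\
  forall p, bounded_cont (df p) /\
    (forall x, U x -> is_derive x (delta_mx ord0 p) f (df p x)).

Lemma vanish_box f : (forall x, ~ U x -> f x = 0) -> box_supported M f.
Proof.
by move=> f0 x i xi; apply: f0 => Ux; have := UM i Ux; rewrite leNgt xi.
Qed.

Lemma continuous_mul_test f g : (forall x, U x -> {for x, continuous f}) ->
  test g -> continuous (f * g).
Proof.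
move=> cf tg x; have [Ux|Ux] := pselect (U x).
  by apply: continuousM; [exact: cf|apply: smooth_continuous; case: tg].
have fg0 : \forall y \near x, (f * g) y = 0.
  by apply: filterS (test_near0 tg Ux) => y gy; rewrite mulfE gy mulr0.
rewrite /continuous_at mulfE (test_out tg Ux) mulr0.
by move=> B /nbhs_singleton B0; apply: filterS fg0 => y /= ->.
Qed.

(** Near a point outside of [U] the test function vanishes, hence so does the
    product, whatever [f] is there. *)
Lemma C1_box_mul_test f df g : weight f df -> test g ->
  C1_box M (f * g) (fun p => df p * g + f * partial p g).
Proof.
move=> [[cf _] dfP] tg; have sg : smooth g by case: tg.
split.
- split; first exact: continuous_mul_test.
  by apply: vanish_box => x Ux; rewrite mulfE (test_out tg Ux) mulr0.
- move=> p; have [[cdf _] _] := dfP p; have tpg := test_partial p tg; split.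
    by move=> x; apply: continuousD; exact: continuous_mul_test.
  apply: vanish_box => x Ux.
  by rewrite !pointwE (test_out tg Ux) (test_out tpg Ux) !mulr0 addr0.
- move=> p x; have [_ dfx] := dfP p.
  have [Ux|Ux] := pselect (U x).
    have := is_deriveM (dfx x Ux) (is_derive_partial p (smooth_diff x sg)).
    by move=> H; apply: (is_derive_eq H); rewrite !pointwE /GRing.scale/= addrC mulrC.
  rewrite !pointwE (test_out tg Ux) (test_out (test_partial p tg) Ux) !mulr0 addr0.
  have d0 : is_derive x (delta_mx ord0 p) (cst 0 : 'rV[R]_n -> R) 0.
    exact: is_derive_cst.
  apply: near_eq_is_derive d0.
  by apply: filterS (test_near0 tg Ux) => y gy; rewrite mulfE gy mulr0.
Qed.

Lemma weight1 : weight (cst 1) (fun _ => 0).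
Proof.
split=> [|p].
  by split=> [x _|]; [exact: cst_continuous|exists 1 => // x _; rewrite normr1].
split=> [|x _]; last exact: is_derive_cst.
by split=> [x _|]; [exact: cst_continuous|exists 0 => // x _; rewrite normr0].
Qed.

Lemma test_C1_box g : test g -> C1_box M g (fun p => partial p g).
Proof.
move=> /(C1_box_mul_test weight1); rewrite (_ : cst 1 * g = g); last first.
  by apply/funext => x; rewrite mulfE mul1r.
by congr C1_box; apply/funext => p; apply/funext => x; rewrite !pointwE mul0r add0r mul1r.
Qed.

Lemma vanish_Rintegral f : (forall x, ~ U x -> f x = 0) ->
  Rintegral mu U f = Rintegral mu setT f.
Proof.
move=> f0; rewrite Rintegral_mkcond; apply: eq_Rintegral => x _.
by rewrite patchE; case: ifPn => // /negP; rewrite inE => /f0 ->.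
Qed.

Lemma test_L2 g : test g -> L2U g.
Proof.
move=> tg; have [[cg sg] _ _] := test_C1_box tg.
have [mg g1] := C1_box_L2 cg sg.
split; first exact: measurable_funTS.
exact: integrableS g1.
Qed.

Lemma test_integral_partial f df g p : weight f df -> test g ->
  Rintegral mu U (df p * g + f * partial p g) = 0.
Proof.
move=> wf tg; rewrite vanish_Rintegral.
  by rewrite /Rintegral (integral_partial0 p (C1_box_mul_test wf tg)).
move=> x Ux; rewrite !pointwE (test_out tg Ux) (test_out (test_partial p tg) Ux).
by rewrite !mulr0 addr0.
Qed.

Lemma L2_bounded_cont f g : bounded_cont f -> L2U g -> L2U (f * g).
Proof.
move=> [cf [C C0 fC]]; apply: (L2_mul _ _ fC) => //.
exact: continuous_on_measurable_rV.
Qed.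

(** Membership of [u] in H^1_0, with the [d p] as weak partial derivatives, for
    the Euclidean metric. *)
Definition sob u d :=
  [/\ L2U u, forall p, L2U (d p) & forall eps, 0 < eps -> exists2 g, test g &
    ipU (g - u) (g - u) <= eps /\ forall p, ipU (partial p g - d p) (partial p g - d p) <= eps].

Lemma sob_L2 u d : sob u d -> L2U u. Proof. by case. Qed.

Lemma sob_L2d u d p : sob u d -> L2U (d p). Proof. by case. Qed.

Lemma sob_test g : test g -> sob g (fun p => partial p g).
Proof.
move=> tg; split => [|p|eps eps0]; first exact: test_L2.
  exact/test_L2/test_partial.
by exists g => //; rewrite subrr ip0l; split => [|p]; rewrite ?subrr ?ip0l ltW.
Qed.

Lemma sob_closed u d : L2U u -> (forall p, L2U (d p)) ->
  (forall eps, 0 < eps -> exists v e, sob v e /\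
     ipU (v - u) (v - u) <= eps /\ forall p, ipU (e p - d p) (e p - d p) <= eps) ->
  sob u d.
Proof.
move=> u2 d2 H; split => // eps eps0.
have [v [e [ve [vu ed]]]] := H (eps / 4) (divr_gt0 eps0 (ltr0n _ 4)).
have [v2 e2 /(_ (eps / 4) (divr_gt0 eps0 (ltr0n _ 4)))[g tg [gv ge]]] := ve.
have tri f1 f2 f3 : L2U f1 -> L2U f2 -> L2U f3 ->
    ipU (f1 - f2) (f1 - f2) <= eps / 4 -> ipU (f2 - f3) (f2 - f3) <= eps / 4 ->
    ipU (f1 - f3) (f1 - f3) <= eps.
  move=> f12 f22 f32 l1 l2; rewrite (_ : f1 - f3 = (f1 - f2) + (f2 - f3)); last first.
    by rewrite addrA subrK.
  have := ipD_le mU (L2B mU f12 f22) (L2B mU f22 f32); lra.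
exists g => //; split=> [|p].
  by apply: tri gv vu => //; exact: test_L2.
by apply: tri (ge p) (ed p) => //; exact/test_L2/test_partial.
Qed.

Lemma sobD a u d v e : sob u d -> sob v e ->
  sob (a *: u + v) (fun p => a *: d p + e p).
Proof.
move=> [u2 d2 ud] [v2 e2 ve]; split => [|p|eps eps0].
- by apply: L2D => //; exact: L2Z.
- by apply: L2D => //; exact: L2Z.
pose c := 2 * (a ^+ 2 + 1).
have c0 : 0 < c by rewrite mulr_gt0// ltr_wpDl ?sqr_ge0.
have ec0 : 0 < eps / (2 * c) by rewrite divr_gt0// mulr_gt0.
have [f tf [fu fd]] := ud _ ec0; have [g tg [gv ge]] := ve _ ec0.
have tri f1 f2 g1 g2 : L2U f1 -> L2U f2 -> L2U g1 -> L2U g2 ->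
    ipU (f1 - f2) (f1 - f2) <= eps / (2 * c) -> ipU (g1 - g2) (g1 - g2) <= eps / (2 * c) ->
    ipU ((a *: f1 + g1) - (a *: f2 + g2)) ((a *: f1 + g1) - (a *: f2 + g2)) <= eps.
  move=> f12 f22 g12 g22 l1 l2.
  have f_2 := L2B mU f12 f22; have g_2 := L2B mU g12 g22.
  rewrite (_ : _ - (a *: f2 + g2) = a *: (f1 - f2) + (g1 - g2)); last first.
    by rewrite scalerBr opprD addrACA.
  apply: le_trans (ipD_le mU (L2Z mU a f_2) g_2) _.
  rewrite ipZl// ?ipZr//; last exact: L2Z.
  set X := ipU _ _ in l1 *; set Y := ipU _ _ in l2 *.
  apply: (@le_trans _ _ (c * (eps / (2 * c) + eps / (2 * c)))).
    move: (eps / (2 * c)) l1 l2 => k l1 l2; have a0 := sqr_ge0 a.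
    have : a ^+ 2 * X <= a ^+ 2 * k by exact: ler_wpM2l.
    have := ip_ge0 mu U (f1 - f2); have := ip_ge0 mu U (g1 - g2); rewrite -/X -/Y /c => Y0 X0; nra.
  by rewrite le_eqVlt; apply/orP; left; apply/eqP; field; exact: lt0r_neq0.
exists (a *: f + g); first by apply: testD => //; exact: testZ.
split => [|p]; first by apply: tri fu gv => //; exact: test_L2.
have -> : partial p (a *: f + g) = a *: partial p f + partial p g.
  have sf : smooth f by case: tf.
  have sg : smooth g by case: tg.
  have sa : smooth (cst a * f) by apply: smoothM => //; exact: smooth_cst.
  rewrite partialD; last 2 first.
  - by move=> x; exact: (smooth_diff x sa).
  - by move=> x; exact: smooth_diff.
  congr (_ + _); rewrite -[a *: f]/(cst a * f) partialM; last 2 first.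
  - by move=> x; exact: differentiable_cst.
  - by move=> x; exact: smooth_diff.
  by rewrite partial_cst; apply/funext => x; rewrite !pointwE mul0r add0r.
by apply: tri (fd p) (ge p) => //; exact/test_L2/test_partial.
Qed.

(** By density, since the form is continuous for the H^1 norm. Identities that
    hold for test functions are carried over to H^1_0 in this way. *)
Lemma sob_functional0 a (b : 'I_n -> 'rV[R]_n -> R) u d :
  L2U a -> (forall p, L2U (b p)) ->
  (forall g, test g -> ipU g a + \sum_p ipU (partial p g) (b p) = 0) ->
  sob u d -> ipU u a + \sum_p ipU (d p) (b p) = 0.
Proof.
move=> a2 b2 H [u2 d2 ud].
pose K := \sum_p ipU (b p) (b p).
have K0 : 0 <= K by apply: sumr_ge0 => p _; exact: ip_ge0.
set L := (X in X = 0).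
pose C := 2 * ipU a a + 2 * n%:R * K.
have C0 : 0 <= C by rewrite addr_ge0 ?mulr_ge0 ?ip_ge0.
have le eps : 0 < eps -> L ^+ 2 <= C * eps.
  move=> eps0; have [g tg [gu gd]] := ud _ eps0.
  have g2 := test_L2 tg.
  have pg2 p : L2U (partial p g) by exact/test_L2/test_partial.
  have -> : L = - (ipU (g - u) a + \sum_p ipU (partial p g - d p) (b p)).
    rewrite ipBl//; under eq_bigr do rewrite ipBl//.
    rewrite sumrB addrACA -opprD (H g tg) sub0r opprK//.
  rewrite sqrrN.
  have l1 : ipU (g - u) a ^+ 2 <= eps * ipU a a.
    apply: le_trans (ip_CS mU (L2B mU g2 u2) a2) _.
    by rewrite ler_wpM2r ?ip_ge0.
  have l2 : (\sum_p ipU (partial p g - d p) (b p)) ^+ 2 <= n%:R * (eps * K).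
    apply: le_trans (sqr_sum_le _) _; rewrite ler_wpM2l// mulr_sumr.
    apply: ler_sum => p _.
    apply: le_trans (ip_CS mU (L2B mU (pg2 p) (d2 p)) (b2 p)) _.
    by rewrite ler_wpM2r ?ip_ge0.
  rewrite /C; set X := ipU (g - u) a in l1 *; set Y := \sum_p _ in l2 *.
  by have := sqr_ge0 (X - Y); nra.
apply/eqP/negPn/negP => L0.
have L2_gt0 : 0 < L ^+ 2 by rewrite lt_neqAle eq_sym sqrf_eq0 L0 sqr_ge0.
have e0 : 0 < L ^+ 2 / (2 * (C + 1)) by rewrite divr_gt0// mulr_gt0// ltr_wpDl.
have := le _ e0; rewrite mulrA ler_pdivlMr ?mulr_gt0 ?ltr_wpDl//; nra.
Qed.

End weak_derivatives.

Section weak_products.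
Context (R : realType) (n : nat) (U : set 'rV[R]_n) (M : R).
Hypotheses (oU : open U) (UM : forall x i, U x -> `|x ord0 i| <= M).
Implicit Types (f g u v : 'rV[R]_n -> R) (d e : 'I_n -> 'rV[R]_n -> R) (p q : 'I_n).
Local Notation mu := (lebesgue_rV R n).
Local Notation L2U := (L2 mu U).
Local Notation ipU := (ip mu U).
Local Notation test := (test_function U).
Local Notation sob := (sob U).

Let mU : measurable U.
Proof. exact: open_measurable_rV. Qed.

Lemma bounded_cont_coord q : bounded_cont U (coordf q).
Proof.
split=> [x _|]; first exact: (smooth_continuous (smooth_coord q)).
by exists `|M| => // x Ux; rewrite (le_trans (UM q Ux))// ler_norm.
Qed.

Lemma ip_mul_le f C g : measurable_fun U f -> (forall x, U x -> `|f x| <= C) -> L2U g ->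
  ipU (f * g) (f * g) <= C ^+ 2 * ipU g g.
Proof.
move=> mf fC g2; rewrite -(ipZl mU)//; apply: ip_le => //.
- exact: L2_mul fC g2.
- exact: L2_mul fC g2.
- exact: L2Z.
move=> x Ux; rewrite !pointwE.
rewrite (_ : f x * g x * _ = f x ^+ 2 * g x ^+ 2); last by ring.
rewrite (_ : C ^+ 2 * g x * _ = C ^+ 2 * g x ^+ 2); last by ring.
rewrite ler_wpM2r ?sqr_ge0//.
by rewrite -real_normK ?num_real// lerXn2r ?nnegrE// ?fC// (le_trans _ (fC _ Ux)).
Qed.

Lemma sob_mul_coord q u d : sob u d ->
  sob (coordf q * u) (fun p => coordf q * d p + (p == q)%:R *: u).
Proof.
move=> [u2 d2 ud]; have bq := bounded_cont_coord q.
have L2q g : L2U g -> L2U (coordf q * g) by exact: L2_bounded_cont.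
split=> [|p|eps eps0]; first exact: L2q.
  by apply: L2D => //; [exact: L2q|exact: L2Z].
pose c := 2 * `|M| ^+ 2 + 2.
have c0 : 0 < c by rewrite ltr_wpDl// mulr_ge0.
have ec0 : 0 < eps / c by rewrite divr_gt0.
have ecE : c * (eps / c) = eps by field; exact: lt0r_neq0.
have cq g k : L2U g -> ipU g g <= k -> ipU (coordf q * g) (coordf q * g) <= `|M| ^+ 2 * k.
  move=> g2 gk; have [cont [C C0 bC]] := bq.
  apply: le_trans (ip_mul_le _ (C := `|M|) _ g2) _.
  - exact: continuous_on_measurable_rV.
  - by move=> x Ux; rewrite (le_trans (UM q Ux))// ler_norm.
  - by rewrite ler_wpM2l.
have [g tg [gu gd]] := ud _ ec0; have g2 := test_L2 oU UM tg.
exists (coordf q * g); first by apply: testM => //; exact: smooth_coord.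
have k0 := ltW ec0; have M0 := sqr_ge0 `|M|.
rewrite -{}ecE; move: (eps / c) gu gd k0 ec0 => k gu gd k0 _.
split=> [|p].
  rewrite -mulrBr; apply: le_trans (cq _ _ (L2B mU g2 u2) gu) _.
  by rewrite /c; nra.
have pg2 : L2U (partial p g) by exact/(test_L2 oU UM)/test_partial.
have gud : L2U (g - u) by exact: L2B.
have gpd : L2U (partial p g - d p) by exact: L2B.
have -> : partial p (coordf q * g) - (coordf q * d p + (p == q)%:R *: u) =
    coordf q * (partial p g - d p) + (p == q)%:R *: (g - u).
  rewrite partialM; last 2 first.
  - by move=> x; exact: (smooth_diff x (smooth_coord q)).
  - by move=> x; apply: smooth_diff; case: tg.
  by rewrite partial_coord; apply/funext => x; rewrite !pointwE; ring.
apply: le_trans (ipD_le mU (L2q _ gpd) (L2Z mU _ gud)) _.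
have := cq _ _ gpd (gd p); rewrite ipZl ?ipZr//; last exact: L2Z.
have := ip_ge0 mu U (g - u); move: gu.
by rewrite /c; case: (p == q) => /=; rewrite ?mul1r ?mul0r; nra.
Qed.

Let sum_delta d p g : (forall q, L2U (d q)) -> L2U g ->
  \sum_q ipU (d q) ((q == p)%:R *: g) = ipU (d p) g.
Proof.
move=> d2 g2; rewrite (bigD1 p)//= eqxx scale1r big1 ?addr0// => q /negPf ->.
by rewrite ipZr// mul0r.
Qed.

(** For test functions this says that the integral of the [p]-th partial
    derivative of [f u v] vanishes; then [u] and [v] are replaced in turn by
    elements of H^1_0. *)
Lemma sob_parts f df u d v e p : weight U f df -> sob u d -> sob v e ->
  ipU (d p) (f * v) + ipU u (f * e p) + ipU u (df p * v) = 0.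
Proof.
move=> wf; have [bf dfP] := wf; have [bdf _] := dfP p.
have L2f g : L2U g -> L2U (f * g) by exact: L2_bounded_cont.
have L2df g : L2U g -> L2U (df p * g) by exact: L2_bounded_cont.
have tt g h : test g -> test h ->
    ipU (partial p g) (f * h) + ipU g (f * partial p h) + ipU g (df p * h) = 0.
  move=> tg th.
  have g2 := test_L2 oU UM tg; have h2 := test_L2 oU UM th.
  have pg2 := test_L2 oU UM (test_partial p tg).
  have ph2 := test_L2 oU UM (test_partial p th).
  have sg : smooth g by case: tg.
  have sh : smooth h by case: th.
  have tgh : test (g * h) by exact: testM.
  rewrite -(test_integral_partial UM p wf tgh) partialM; last 2 first.
  - by move=> x; exact: smooth_diff.
  - by move=> x; exact: smooth_diff.
  rewrite /ip.
  have L1a := L2M mU pg2 (L2f _ h2); have L1b := L2M mU g2 (L2f _ ph2).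
  have L1c := L2M mU g2 (L2df _ h2).
  rewrite -(RintegralD mU L1a L1b) -(RintegralD mU _ L1c); last exact: L1D.
  by apply: eq_Rintegral => x _; rewrite !pointwE; ring.
have st u' d' h : sob u' d' -> test h ->
    ipU (d' p) (f * h) + ipU u' (f * partial p h) + ipU u' (df p * h) = 0.
  move=> ud th; have [u2 d2 _] := ud.
  have h2 := test_L2 oU UM th; have ph2 := test_L2 oU UM (test_partial p th).
  rewrite -addrA addrC -ipDr//; [|exact: L2f|exact: L2df].
  rewrite -(sum_delta p d2 (L2f _ h2)).
  apply: (sob_functional0 oU UM _ _ _ ud) => [|q|g tg].
  - by apply: L2D => //; [exact: L2f|exact: L2df].
  - by apply: L2Z => //; exact: L2f.
  have g2 := test_L2 oU UM tg.
  rewrite (sum_delta p (fun q => test_L2 oU UM (test_partial q tg)) (L2f _ h2)).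
  by rewrite ipDr//; [rewrite addrC addrA; exact: tt|exact: L2f|exact: L2df].
move=> ud ve; have [u2 d2 _] := ud; have [v2 e2 _] := ve.
have cf a g h : ipU g (a * h) = ipU h (a * g).
  by apply: eq_ip => // x _; rewrite !pointwE; ring.
rewrite (cf f (d p)) (cf f u) (cf _ u).
rewrite -addrA (addrC (ipU (e p) _)) addrA -ipDr//; [|exact: L2f|exact: L2df].
rewrite -(sum_delta p e2 (L2f _ u2)).
apply: (sob_functional0 oU UM _ _ _ ve) => [|q|g tg].
- by apply: L2D => //; [exact: L2f|exact: L2df].
- by apply: L2Z => //; exact: L2f.
have g2 := test_L2 oU UM tg; have pg2 := test_L2 oU UM (test_partial p tg).
rewrite (sum_delta p (fun q => test_L2 oU UM (test_partial q tg)) (L2f _ u2)).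
rewrite ipDr//; [|exact: L2f|exact: L2df].
rewrite (cf f g) (cf f (partial p g)) (cf _ g) -addrA (addrC (ipU u (df p * g))) addrA.
exact: st.
Qed.

(** By density from [friedrichs]. The approximation by test functions loses
    factors 2 in the squared norms, which is why [friedrichs] is applied with
    [eps / 4] and its functions are doubled. *)
Lemma sob_friedrichs eps : 0 < eps -> exists (T : finType) (w : T -> 'rV[R]_n -> R),
  (forall l, L2U (w l)) /\
  forall u d, sob u d ->
    ipU u u <= eps * \sum_p ipU (d p) (d p) + \sum_l ipU u (w l) ^+ 2.
Proof.
move=> eps0; have e40 : 0 < eps / 4 by rewrite divr_gt0.
have [T [w [w2 Hw]]] := friedrichs n M e40.
have w2U l : L2U (w l).
  have [mw iw] := w2 l; split; first exact: measurable_funTS.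
  exact: integrableS iw.
exists T, (fun l => 2 *: w l); split=> [l|u d [u2 d2 ud]]; first exact: L2Z.
have Ht g : test g -> ipU g g <= eps / 4 * \sum_p ipU (partial p g) (partial p g) +
    \sum_l ipU g (w l) ^+ 2.
  move=> tg; have := Hw _ _ (test_C1_box UM tg).
  have E h k : test h -> ipU h k = ip mu setT h k.
    move=> th; apply: (vanish_Rintegral (U := U)) => x Ux.
    by rewrite mulfE (test_out th Ux) mul0r.
  rewrite (E g g tg).
  rewrite (eq_bigr (fun p => ip mu setT (partial p g) (partial p g)) (fun p _ => E _ _ (test_partial p tg))).
  have -> // : \sum_l ipU g (w l) ^+ 2 = \sum_l ip mu setT g (w l) ^+ 2.
  by apply: eq_bigr => l _; rewrite E.
set B := (X in _ <= X).
pose W := \sum_l ipU (w l) (w l).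
pose K := 2 + eps * n%:R + 4 * W.
have W0 : 0 <= W by apply: sumr_ge0 => l _; exact: ip_ge0.
have K0 : 0 < K by rewrite /K !ltr_wpDr// mulr_ge0// ltW.
have le k : 0 < k -> ipU u u <= B + K * k.
  move=> k0; have [g tg [gu gd]] := ud _ k0.
  have g2 := test_L2 oU UM tg.
  have pg2 p := test_L2 oU UM (test_partial p tg).
  have dec f h : L2U f -> L2U h -> ipU f f <= 2 * ipU h h + 2 * ipU (h - f) (h - f).
    move=> f2 h2; have fh2 := L2B mU h2 f2.
    have := ipD_le mU h2 (L2N mU fh2).
    by rewrite opprB addrC subrK -opprB ipNl// ?ipNr ?opprK//; exact: L2N.
  have l1 : ipU u u <= 2 * ipU g g + 2 * k.
    by apply: le_trans (dec _ _ u2 g2) _; rewrite lerD2l ler_pM2l.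
  have l2 p : ipU (partial p g) (partial p g) <= 2 * ipU (d p) (d p) + 2 * k.
    apply: le_trans (dec _ _ (pg2 p) (d2 p)) _; rewrite lerD2l ler_pM2l//.
    have pd2 := L2B mU (pg2 p) (d2 p).
    by rewrite -opprB ipNl// ?ipNr ?opprK//; exact: L2N.
  have l3 l : ipU g (w l) ^+ 2 <= 2 * ipU u (w l) ^+ 2 + 2 * (k * ipU (w l) (w l)).
    have := ip_CS mU (L2B mU g2 u2) (w2U l); rewrite ipBl// => cs.
    have : ipU (g - u) (g - u) * ipU (w l) (w l) <= k * ipU (w l) (w l).
      by rewrite ler_wpM2r ?ip_ge0.
    move: cs; set x := ipU g _; set y := ipU u _ => cs le2.
    by have := sqr_ge0 (x - 2 * y); nra.
  have s2 : \sum_p ipU (partial p g) (partial p g) <= 2 * \sum_p ipU (d p) (d p) + n%:R * (2 * k).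
    apply: le_trans (ler_sum _ (fun p _ => l2 p)) _.
    by rewrite big_split/= -mulr_sumr sumr_const card_ord [n%:R * _]mulr_natl.
  have s3 : \sum_l ipU g (w l) ^+ 2 <= 2 * \sum_l ipU u (w l) ^+ 2 + 2 * (k * W).
    apply: le_trans (ler_sum _ (fun l _ => l3 l)) _.
    by rewrite big_split/= -!mulr_sumr.
  have -> : B = eps * \sum_p ipU (d p) (d p) + 4 * \sum_l ipU u (w l) ^+ 2.
    rewrite /B; congr (_ + _); rewrite mulr_sumr; apply: eq_bigr => l _.
    by rewrite ipZr//; ring.
  have l4 := Ht g tg; rewrite /K; move: l1 l4 s2 s3.
  set a := ipU u u; set b := ipU g g; set c := \sum_p ipU (partial p g) _.
  set c' := \sum_p ipU (d p) _; set h := \sum_l ipU g _ ^+ 2.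
  set h' := \sum_l ipU u _ ^+ 2 => l1 l4 s2 s3.
  have l5 : eps / 4 * c <= eps / 4 * (2 * c' + n%:R * (2 * k)) by rewrite ler_pM2l.
  lra.
rewrite leNgt; apply/negP => lt.
have k0 : 0 < (ipU u u - B) / (2 * K) by rewrite divr_gt0 ?subr_gt0// mulr_gt0.
have := le _ k0; rewrite (_ : K * _ = (ipU u u - B) / 2); last by field; exact: lt0r_neq0.
by move: lt; lra.
Qed.

End weak_products.

(** * The hyperbolic Dirichlet problem in weak form *)
Section hyperbolic_forms.
Context (R : realType) (m : nat) (Omega : set 'rV[R]_m.+1).
Local Notation n := m.+1.
Local Notation h := (@height R m).
Implicit Types (u v g : 'rV[R]_n -> R) (d e : 'I_n -> 'rV[R]_n -> R) (p q : 'I_n).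
Local Notation mu := (lebesgue_rV R n).
Local Notation L2O := (L2 mu Omega).
Local Notation ipO := (ip mu Omega).
Local Notation test := (test_function Omega).
Local Notation sob := (sob Omega).

(** A bound on the hyperbolic distance to [p] bounds the square of the Euclidean
    distance by a multiple of the heights of both points. *)
Lemma hbounded_box b : hdomain Omega -> hbounded Omega ->
  (forall x, Omega x -> h x ^+ 2 <= b) ->
  exists M : R, forall x i, Omega x -> `|x ord0 i| <= M.
Proof.
move=> [Oh _ _ _] [p [r [hp pr]]] hb; rewrite /half_space /= in hp.
pose B := 1 + `|b|; pose K := 2 * h p * B * expR r.
exists (\sum_i `|p ord0 i| + 1 + K) => x i Ox.
have hx : 0 < h x by exact: Oh.
have hxB : h x <= B.
  have := hb x Ox; have := ler_norm b; rewrite /B; nra.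
pose S := \sum_i (p ord0 i - x ord0 i) ^+ 2.
have S0 : 0 <= S by apply: sumr_ge0 => j _; exact: sqr_ge0.
pose D := 2 * h p * h x; have D0 : 0 < D by rewrite /D !mulr_gt0.
pose t := 1 + S / D.
have t1 : 1 <= t by rewrite /t lerDl divr_ge0// ltW.
have tr : t <= expR r.
  have : ln t <= r.
    apply: le_trans (pr x Ox); rewrite /hdist /arcosh -/S -/D -/t.
    have t0 : 0 < t by exact: lt_le_trans t1.
    have tt : t <= t + Num.sqrt (t ^+ 2 - 1) by rewrite lerDl sqrtr_ge0.
    by rewrite ler_ln// posrE// (lt_le_trans t0 tt).
  by rewrite -ler_expR lnK// posrE (lt_le_trans _ t1).
have SK : S <= K.
  have : S / D <= expR r by apply: le_trans tr; rewrite /t lerDr.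
  rewrite ler_pdivrMr// => /le_trans; apply.
  by rewrite mulrC ler_wpM2r ?expR_ge0// /D ler_wpM2l// mulr_ge0// ltW.
have pi : `|p ord0 i| <= \sum_i `|p ord0 i|.
  by rewrite (bigD1 i)//= lerDl sumr_ge0.
have Si : (p ord0 i - x ord0 i) ^+ 2 <= S.
  by rewrite /S (bigD1 i)//= lerDl sumr_ge0// => j _; exact: sqr_ge0.
have yi : `|p ord0 i - x ord0 i| <= 1 + K.
  have := le_trans Si SK; rewrite -[X in X <= _]real_normK ?num_real//.
  have := normr_ge0 (p ord0 i - x ord0 i); nra.
have := ler_normB (p ord0 i) (p ord0 i - x ord0 i); rewrite subKr; lra.
Qed.

Variables (M a b : R).
Hypotheses (oO : open Omega) (OM : forall x i, Omega x -> `|x ord0 i| <= M).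
Hypotheses (Oh : Omega `<=` @half_space R m) (a0 : 0 < a).
Hypothesis (hab : forall x, Omega x -> a <= h x ^+ 2 <= b).

Let mO : measurable Omega. Proof. exact: open_measurable_rV. Qed.

Let h_gt0 x : Omega x -> 0 < h x. Proof. exact: Oh. Qed.

Let h_le x : Omega x -> h x <= M.
Proof. by move=> Ox; apply: le_trans (OM ord_max Ox); exact: ler_norm. Qed.

Let s := Num.sqrt a.

Let s_gt0 : 0 < s. Proof. by rewrite sqrtr_gt0. Qed.

Let h_ge x : Omega x -> s <= h x.
Proof.
move=> Ox; have /andP[l _] := hab Ox.
by rewrite -(ger0_norm (ltW (h_gt0 Ox))) -sqrtr_sqr /s ler_wsqrtr.
Qed.

Lemma is_derive_height p (x : 'rV[R]_n) :
  is_derive x (delta_mx ord0 p) h (p == ord_max)%:R.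
Proof. exact: (is_derive_coord p ord_max x). Qed.

(** Densities of the measures [h^j dV], where [dV = h^-n dx] is the volume. *)
Definition hw j (x : 'rV[R]_n) : R := h x ^+ j * h x ^- n.

Definition dhw j p (x : 'rV[R]_n) : R :=
  (p == ord_max)%:R * ((j.+1%:R - n%:R) * hw j x).

Let continuous_hX k x : {for x, continuous (fun y => h y ^+ k)}.
Proof.
have ch : {for x, continuous h} by exact: (smooth_continuous (smooth_coord ord_max)).
by apply: (@continuous_comp _ _ _ h (fun t => t ^+ k) _ ch); exact: exprn_continuous.
Qed.

Lemma continuous_hw j x : Omega x -> {for x, continuous (hw j)}.
Proof.
move=> Ox; apply: (continuousM (@continuous_hX j x)).
apply: continuousV (@continuous_hX n x).
by rewrite expf_neq0// gt_eqF// h_gt0.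
Qed.

Lemma hw_gt0 j x : Omega x -> 0 < hw j x.
Proof. by move=> Ox; rewrite mulr_gt0 ?invr_gt0 ?exprn_gt0 ?h_gt0. Qed.

Lemma hw_le j x : Omega x -> hw j x <= M ^+ j / s ^+ n.
Proof.
move=> Ox; have h0 := h_gt0 Ox; apply: ler_pM.
- by rewrite exprn_ge0// ltW.
- by rewrite invr_ge0 exprn_ge0// ltW.
- by rewrite lerXn2r ?nnegrE ?h_le// ltW// (lt_le_trans h0)// h_le.
- by rewrite lef_pV2 ?posrE ?exprn_gt0// lerXn2r ?nnegrE ?h_ge// ltW.
Qed.

Lemma hw_ge j : exists2 c, 0 < c & forall x, Omega x -> c <= hw j x.
Proof.
exists (s ^+ j / (1 + `|M|) ^+ n) => [|x Ox].
  by rewrite divr_gt0 ?exprn_gt0// ltr_wpDr.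
have h0 := h_gt0 Ox; apply: ler_pM.
- by rewrite exprn_ge0// ltW.
- by rewrite invr_ge0 exprn_ge0// addr_ge0.
- by rewrite lerXn2r ?nnegrE ?h_ge// ltW.
- rewrite lef_pV2 ?posrE ?exprn_gt0// ?ltr_wpDr// lerXn2r ?nnegrE ?addr_ge0 ?(ltW h0)//.
  by rewrite (le_trans (h_le Ox))// (le_trans (ler_norm M))// lerDr.
Qed.

Lemma bounded_cont_hw j : bounded_cont Omega (hw j).
Proof.
split=> [x Ox|]; first exact: continuous_hw.
exists `|M ^+ j / s ^+ n| => // x Ox.
by rewrite gtr0_norm ?hw_gt0// (le_trans (hw_le j Ox))// ler_norm.
Qed.

Lemma weight_hw j : weight Omega (hw j.+1) (dhw j).
Proof.
split=> [|p]; first exact: bounded_cont_hw.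
have [ch [C C0 hC]] := bounded_cont_hw j; split.
  split=> [x Ox|].
    apply: continuousM; first exact: cst_continuous.
    by apply: continuousM; [exact: cst_continuous|exact: ch].
  exists (`|j.+1%:R - n%:R| * C) => [|x Ox]; first by rewrite mulr_ge0.
  rewrite /dhw; case: (p == ord_max) => /=; rewrite ?mul1r ?mul0r ?normr0 ?mulr_ge0//.
  by rewrite normrM ler_wpM2l// hC.
move=> x Ox; have h0 := h_gt0 Ox; have hn0 : h x != 0 by rewrite gt_eqF.
have dh := is_derive_height p x.
have dX := is_deriveX n dh; have dj := is_deriveX j.+1 dh.
have hXn0 : (h ^+ n) x != 0 by rewrite exprfctE expf_neq0.
have dv : is_derive x (delta_mx ord0 p) (fun y => ((h ^+ n) y)^-1)
    (- (h x ^+ n) ^- 2 * (n%:R * h x ^+ m * (p == ord_max)%:R)).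
  have [dX1 dX2] := dX.
  by apply: DeriveDef; [exact: derivableV|rewrite deriveV// dX2 exprfctE].
have -> : hw j.+1 = h ^+ j.+1 * (fun y => ((h ^+ n) y)^-1).
  by apply/funext => y; rewrite mulfE !exprfctE.
apply: (is_derive_eq (is_deriveM dj dv)).
rewrite /dhw /hw !exprfctE /GRing.scale/= !exprS.
have hm : h x ^+ m != 0 by rewrite expf_neq0.
by field; rewrite hn0 hm.
Qed.

Lemma L2_hw j g : L2O g -> L2O (hw j * g).
Proof. by apply: L2_bounded_cont => //; exact: bounded_cont_hw. Qed.

Lemma ip_hwC j u v : ipO u (hw j * v) = ipO v (hw j * u).
Proof. by apply: eq_ip => // x _; rewrite !pointwE; ring. Qed.

Lemma hw_norm_ge j : exists2 c, 0 < c & forall f : 'rV[R]_n -> R, measurable_fun Omega f ->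
  forall k : R, (\int[mu]_(x in Omega) (f x ^+ 2 * hw j x)%:E <= (c * k)%:E)%E ->
  L2O f /\ ipO f f <= k.
Proof.
have [c c0 hc] := hw_ge j; exists c => // f mf k le.
have mhw : measurable_fun Omega (hw j).
  by apply: continuous_on_measurable_rV => // x; exact: continuous_hw.
have mf2 : measurable_fun Omega (fun x => (f x ^+ 2)%:E).
  by apply/measurable_EFinP; exact: measurable_funX.
have le2 : (c%:E * \int[mu]_(x in Omega) (f x ^+ 2)%:E <= (c * k)%:E)%E.
  apply: le_trans le; rewrite -ge0_integralZl//; last 2 first.
  - by move=> x _; rewrite lee_fin sqr_ge0.
  - by rewrite lee_fin ltW.
  apply: ge0_le_integral => //.
  - by move=> x _; rewrite -EFinM lee_fin mulr_ge0 ?sqr_ge0// ltW.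
  - exact: measurable_funeM.
  - by apply/measurable_EFinP; apply: measurable_funM => //; exact: measurable_funX.
  - by move=> x Ox; rewrite -EFinM lee_fin mulrC ler_wpM2l ?sqr_ge0// hc.
have f2 : L2O f.
  apply: L2P => //; rewrite ltey; apply/eqP => fy; move: le2; rewrite fy.
  by rewrite gt0_muley ?lte_fin// leye_eq.
split=> //; move: le2.
have -> : (\int[mu]_(x in Omega) (f x ^+ 2)%:E)%E = (ipO f f)%:E.
  by rewrite EFin_ip//; apply: eq_integral => x _; rewrite expr2.
by rewrite -EFinM lee_fin ler_pM2l.
Qed.

(** The hyperbolic gradient is [h^2] times the Euclidean one, so that the weak
    derivatives are the components of [G] divided by [h^2]. *)
Lemma H10_sob u : H10 Omega u -> exists d, sob u d.
Proof.
move=> [mu_ [phi [G [mG tphi cu cG]]]].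
pose d p (x : 'rV[R]_n) := G x ord0 p * (h x ^+ 2)^-1.
have mhV k : measurable_fun Omega (fun x => h x ^- k).
  apply: continuous_on_measurable_rV => // x Ox.
  by apply: continuousV (@continuous_hX k x); rewrite expf_neq0// gt_eqF// h_gt0.
have md p : measurable_fun Omega (d p).
  by apply: measurable_funM (mhV 2%N); exact: (measurableT_comp (measurable_rV_coord p) mG).
have [c0 c00 N0] := hw_norm_ge 0; have [c2 c20 N2] := hw_norm_ge 2.
have mt g : test g -> measurable_fun Omega g by move=> /(test_L2 oO OM)[].
have close eps : 0 < eps -> exists j, (L2O (phi j - u) /\ ipO (phi j - u) (phi j - u) <= eps) /\
    forall p, L2O (partial p (phi j) - d p) /\ ipO (partial p (phi j) - d p) (partial p (phi j) - d p) <= eps.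
  move=> eps0.
  have e0 : (0 < (c0 * eps)%:E)%E by rewrite lte_fin mulr_gt0.
  have e2 : (0 < (c2 * eps)%:E)%E by rewrite lte_fin mulr_gt0.
  have /filter_ex[j [lu lG]] : \forall j \near \oo,
      (hintegral Omega (fun x => (phi j x - u x) ^+ 2)%R < (c0 * eps)%:E)%E /\
      (hintegral Omega (fun x => hnorm2 x (hgrad (phi j) x - G x))%R < (c2 * eps)%:E)%E.
    have nb (e : \bar R) : (0 < e)%E -> nbhs 0%E [set y : \bar R | (y < e)%E].
      by move=> e00; apply: open_nbhs_nbhs; split => //; exact: open_ereal_lt_ereal.
    by apply: filterI; [exact: (cu _ (nb _ e0))|exact: (cG _ (nb _ e2))].
  exists j; split.
    apply: N0; first by apply: measurable_funB => //; exact: mt.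
    apply: le_trans (ltW lu); rewrite le_eqVlt; apply/orP; left; apply/eqP.
    by apply: eq_integral => x _; rewrite /hw mul1r.
  have mtd p : measurable_fun Omega (partial p (phi j) - d p).
    by apply: measurable_funB; [exact: (mt _ (test_partial p (tphi j)))|exact: md].
  move=> p; apply: N2 => //.
  apply: le_trans (ltW lG); apply: ge0_le_integral => //.
  - by move=> x Ox; rewrite lee_fin mulr_ge0 ?sqr_ge0// ltW// hw_gt0.
  - apply/measurable_EFinP; apply: measurable_funM; first exact: measurable_funX.
    by apply: continuous_on_measurable_rV => // x; exact: continuous_hw.
  - apply/measurable_EFinP; apply: measurable_funM; last exact: mhV.
    apply: measurable_funM; last exact: mhV.
    apply: measurable_sum => i; apply: measurable_funX.
    rewrite (_ : (fun x => _) = (fun x => h x ^+ 2 * partial i (phi j) x - rV_coord i (G x))).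
      apply: measurable_funB; last exact: (measurableT_comp (measurable_rV_coord i) mG).
      apply: measurable_funM; last exact: (mt _ (test_partial i (tphi j))).
      by apply: continuous_on_measurable_rV => // x _; exact: continuous_hX.
    by apply/funext => x; rewrite /hgrad /rV_coord !mxE.
  - move=> x Ox; rewrite lee_fin /hnorm2 /hw mulrA; apply: ler_wpM2r.
      by rewrite invr_ge0 exprn_ge0// ltW// h_gt0.
    rewrite (bigD1 p)//= mulrDl /hgrad !mxE /d.
    have hx := h_gt0 Ox; have hx0 : h x != 0 by rewrite gt_eqF.
    have -> : (h x ^+ 2 * partial p (phi j) x - G x ord0 p) ^+ 2 / h x ^+ 2 =
      (partial p (phi j) - (fun x => G x ord0 p * (h x ^+ 2)^-1)) x ^+ 2 * h x ^+ 2.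
      by rewrite !pointwE; field.
    by rewrite lerDl mulr_ge0 ?invr_ge0 ?sqr_ge0// sumr_ge0// => i _; rewrite sqr_ge0.
have L2s f g : L2O (f - g) -> L2O f -> L2O g.
  by move=> fg2 f2; rewrite -(subKr f g); exact: L2B.
exists d; have [j [[l1 _] l2]] := close 1 ltr01.
have u2 : L2O u by exact: (L2s _ _ l1 (test_L2 oO OM (tphi j))).
have d2 p : L2O (d p) by exact: (L2s _ _ (l2 p).1 (test_L2 oO OM (test_partial p (tphi j)))).
split => // eps /close[k [[_ ku] kd]]; exists (phi k) => //; split=> // p.
exact: (kd p).2.
Qed.

Lemma hintegralE f g v : L2O g -> L2O v -> (forall x, Omega x -> f x * h x ^- n = g x * v x) ->
  hintegral Omega f = (ipO g v)%:E.
Proof.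
move=> g2 v2 E; rewrite EFin_ip//; apply: eq_integral => x /set_mem Ox.
by rewrite E.
Qed.

Lemma sob_H10 u d : sob u d -> H10 Omega u.
Proof.
move=> [u2 d2 ud]; split; first exact: u2.1.
have /choice[phi phiP] : forall j : nat, exists g, test g /\
    (ipO (g - u) (g - u) <= j.+1%:R^-1 /\
     forall p, ipO (partial p g - d p) (partial p g - d p) <= j.+1%:R^-1).
  by move=> j; have [|g tg ge] := ud (j.+1%:R^-1); [rewrite invr_gt0|exists g].
(* cut off outside of [Omega], where the [d p] need not be measurable *)
pose G (x : 'rV[R]_n) : 'rV[R]_n := \row_p (h x ^+ 2 * (d p \_ Omega) x).
have tphi j : test (phi j) by case: (phiP j).
have phi2 j := test_L2 oO OM (tphi j).
have pphi2 j p := test_L2 oO OM (test_partial p (tphi j)).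
have to0 (f : nat -> \bar R) C : (forall j, (0 <= f j)%E) ->
    (forall j, (f j <= (C * j.+1%:R^-1)%:E)%E) -> f j @[j --> \oo] --> 0%E.
  move=> f0 fC; apply: (@squeeze_cvge _ _ _ _ (cst 0%E) _ (fun j => (C * j.+1%:R^-1)%:E)).
  - by near=> j; rewrite f0 fC.
  - exact: cvg_cst.
  - apply/cvg_EFin; first exact: nearW.
    rewrite -[X in _ --> X](mulr0 C); apply: cvgM; first exact: cvg_cst.
    exact: cvg_harmonic.
have hwC j : exists2 C, 0 <= C & forall g k, L2O g -> ipO g g <= k -> ipO g (hw j * g) <= C * k.
  have [_ [C C0 hC]] := bounded_cont_hw j; exists C => // g k g2 gk.
  apply: (@le_trans _ _ (C * ipO g g)); last exact: ler_wpM2l.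
  rewrite -(ipZl mO)//; apply: ip_le => //.
  - exact: L2_hw.
  - exact: L2Z.
  move=> x Ox; rewrite !pointwE.
  rewrite (_ : _ * (hw j x * _) = hw j x * g x ^+ 2); last by ring.
  rewrite (_ : C * _ * _ = C * g x ^+ 2); last by ring.
  by rewrite ler_wpM2r ?sqr_ge0// (le_trans (ler_norm _))// hC.
have [C0 C00 HC0] := hwC 0; have [C2 C20 HC2] := hwC 2.
exists phi, G; split => //.
- apply: measurable_funTS; apply: measurable_fun_rVP => p.
  rewrite (_ : _ \o _ = (fun x => h x ^+ 2 * (d p \_ Omega) x)); last first.
    by apply/funext => x; rewrite /= /rV_coord mxE.
  apply: measurable_funM; first by apply: continuous_measurable_rV => x; exact: continuous_hX.
  by apply/(measurable_restrictT _ mO); have [] := d2 p.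
- apply: (to0 _ C0) => j.
    apply: integral_ge0 => x Ox; rewrite lee_fin mulr_ge0 ?sqr_ge0// invr_ge0 exprn_ge0//.
    by rewrite ltW// h_gt0.
  rewrite (@hintegralE _ (phi j - u) (hw 0 * (phi j - u))); last 3 first.
  + exact: L2B.
  + by apply: L2_hw; exact: L2B.
  + by move=> x _; rewrite !pointwE /hw expr0; ring.
  by rewrite lee_fin HC0//; [exact: L2B|case: (phiP j) => _ []].
- apply: (to0 _ (n%:R * C2)) => j.
    apply: integral_ge0 => x Ox; have h0 := ltW (h_gt0 Ox).
    rewrite lee_fin; apply: mulr_ge0; last by rewrite invr_ge0 exprn_ge0.
    apply: divr_ge0; last by rewrite exprn_ge0.
    by apply: sumr_ge0 => p _; exact: sqr_ge0.
  have pd2 p : L2O (partial p (phi j) - d p) by exact: L2B.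
  rewrite (_ : hintegral _ _ =
    (\sum_p ipO (partial p (phi j) - d p) (hw 2 * (partial p (phi j) - d p)))%:E).
    rewrite lee_fin -mulrA mulr_natl -[X in _ *+ X]card_ord -sumr_const.
    by apply: ler_sum => p _; rewrite HC2//; case: (phiP j) => _ [].
  rewrite -sumEFin; under [RHS]eq_bigr => p _ do
    rewrite (EFin_ip mO (pd2 p) (L2_hw 2 (pd2 p))).
  rewrite -ge0_integral_sum//; last 2 first.
  - by move=> p; apply/measurable_EFinP; apply: measurable_funM;
      [exact: (pd2 p).1|exact: (L2_hw 2 (pd2 p)).1].
  - move=> p x Ox; rewrite lee_fin !pointwE mulrCA mulr_ge0 ?(ltW (hw_gt0 _ Ox))//.
    by rewrite -expr2 sqr_ge0.
  apply: eq_integral => x /set_mem Ox; rewrite sumEFin; congr EFin.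
  rewrite /hnorm2 !mulr_suml; apply: eq_bigr => p _.
  have hx0 : h x != 0 by rewrite gt_eqF// h_gt0.
  rewrite /hgrad /G !mxE patchE mem_set// !pointwE /hw.
  by field; rewrite expf_neq0.
Unshelve. all: by end_near. Qed.

(** The Laplacian of [g] is [h^n] times the divergence of [h^2 h^-n D g], and
    the volume is [h^-n] times Lebesgue measure: [sob_parts] with the weight
    [hw 2] moves one derivative to [u]. *)
Lemma weak_eigenE lambda u d g : sob u d -> test g ->
  hintegral Omega (fun x => u x * hlaplacian g x) =
  hintegral Omega (fun x => - lambda * u x * g x) <->
  \sum_p ipO (d p) (hw 2 * partial p g) = lambda * ipO u (hw 0 * g).
Proof.
move=> su tg; have [u2 d2 _] := su.
have g2 := test_L2 oO OM tg.
have pg2 p := test_L2 oO OM (test_partial p tg).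
have ppg2 p := test_L2 oO OM (test_partial p (test_partial p tg)).
have L2dhw p f : L2O f -> L2O (dhw 1 p * f).
  by apply: L2_bounded_cont => //; have [_ /(_ p)[]] := weight_hw 1.
have K2 p : L2O (dhw 1 p * partial p g + hw 2 * partial p (partial p g)).
  by apply: L2D => //; [exact: L2dhw|exact: L2_hw].
rewrite (@hintegralE (fun x => - lambda * u x * g x) (- lambda *: u) (hw 0 * g)); last 3 first.
- exact: L2Z.
- exact: L2_hw.
- move=> x _; rewrite !pointwE /hw expr0 mul1r; ring.
rewrite (@hintegralE _ u (\sum_p (dhw 1 p * partial p g + hw 2 * partial p (partial p g)))); last 3 first.
- exact: u2.
- exact: L2_sum.
- move=> x Ox; rewrite /hlaplacian /hdiv sumfE.
  have hn0 : h x ^+ n != 0 by rewrite expf_neq0// gt_eqF// h_gt0.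
  have E (S : R) : u x * (h x ^+ n * S) * h x ^- n = u x * S by field.
  rewrite E; congr (_ * _).
  apply: eq_bigr => p _.
  have [_ _ /(_ p x) D] := C1_box_mul_test OM (weight_hw 1) (test_partial p tg).
  transitivity (partial p (hw 2 * partial p g) x); last exact: partialE D.
  congr (partial p _ x); apply/funext => y.
  by rewrite /hgrad !mxE mulfE /hw mulrA [h y ^- n * _]mulrC.
rewrite ip_sumr// ipZl//; last exact: L2_hw.
have -> : \sum_p ipO u (dhw 1 p * partial p g + hw 2 * partial p (partial p g)) =
    - \sum_p ipO (d p) (hw 2 * partial p g).
  rewrite -sumrN; apply: eq_bigr => p _.
  have := sob_parts oO OM p (weight_hw 1) su (sob_test oO OM (test_partial p tg)).
  rewrite ipDr//; [|exact: L2dhw|exact: L2_hw].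
  have A (x y z : R) : x + y + z = 0 -> z + y = - x by lra.
  exact: A.
split=> [[/eqP]|->]; last by rewrite mulNr.
by rewrite mulNr eqr_opp => /eqP.
Qed.

(** The weak equation extends from test functions to H^1_0 by density. *)
Lemma eigen_weak lambda u d v e : sob u d -> sob v e ->
  dirichlet_eigenspace Omega lambda u ->
  \sum_p ipO (d p) (hw 2 * e p) = lambda * ipO u (hw 0 * v).
Proof.
move=> su sv [_ H]; have [u2 d2 _] := su; have [v2 e2 _] := sv.
apply/eqP; rewrite eq_sym -subr_eq0 -opprB oppr_eq0 addrC; apply/eqP.
rewrite -mulNr -(ipZl mO)//; last exact: L2_hw.
rewrite (_ : ipO (- lambda *: u) _ = ipO v (hw 0 * (- lambda *: u))); last exact: ip_hwC.
under eq_bigr do rewrite ip_hwC.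
apply: (sob_functional0 oO OM _ _ _ sv).
- by apply: L2_hw; exact: L2Z.
- by move=> p; exact: L2_hw.
move=> g tg; under eq_bigr do rewrite ip_hwC.
rewrite ip_hwC ipZl//; last by apply: L2_hw; exact: (test_L2 oO OM tg).
by rewrite ((weak_eigenE lambda su tg).1 (H g tg)) mulNr addNr.
Qed.

End hyperbolic_forms.

(** * Positive semidefinite forms *)
Section psd_forms.
Context (R : realType) (V : lmodType R).
Implicit Types (S : set V) (B E : V -> V -> R) (u v w : V).

Definition linear_set S := S 0 /\ forall (c : R) u v, S u -> S v -> S (c *: u + v).

Definition psd_form S B := [/\ forall u v, S u -> S v -> B u v = B v u,
  forall (c : R) u v w, S u -> S v -> S w -> B (c *: u + v) w = c * B u w + B v w
  & forall u, S u -> 0 <= B u u].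

Lemma psd_formS S S' B : S' `<=` S -> psd_form S B -> psd_form S' B.
Proof.
move=> sS [BC BD B0]; split=> [u v su sv|c u v w su sv sw|u su].
- by rewrite BC//; exact: sS.
- by rewrite BD//; exact: sS.
- by apply: B0; exact: sS.
Qed.

Section algebra.
Variables (S : set V) (B : V -> V -> R).
Hypotheses (sS : linear_set S) (fB : psd_form S B).

Lemma lset_lin (c : R) u v : S u -> S v -> S (c *: u + v). Proof. by case: sS => _; apply. Qed.

Lemma lset_scale (c : R) u : S u -> S (c *: u).
Proof. by move=> su; rewrite -[_ *: _]addr0; apply: lset_lin => //; case: sS. Qed.

Lemma lset_add u v : S u -> S v -> S (u + v).
Proof. by move=> su sv; rewrite -[u]scale1r; exact: lset_lin. Qed.

Lemma lset_sub u v : S u -> S v -> S (u - v).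
Proof. by move=> su sv; apply: lset_add => //; rewrite -scaleN1r; exact: lset_scale. Qed.

Lemma lset_sum (I : Type) (s : seq I) (P : pred I) (F : I -> V) :
  (forall i, P i -> S (F i)) -> S (\sum_(i <- s | P i) F i).
Proof. by move=> SF; apply: big_ind => //; [case: sS|exact: lset_add]. Qed.

Lemma form_sym u v : S u -> S v -> B u v = B v u. Proof. by case: fB => + _ _; apply. Qed.

Lemma form_ge0 u : S u -> 0 <= B u u. Proof. by case: fB => _ _; apply. Qed.

Lemma form_lin (c : R) u v w : S u -> S v -> S w -> B (c *: u + v) w = c * B u w + B v w.
Proof. by case: fB => _ + _; apply. Qed.

Lemma form_0l w : S w -> B 0 w = 0.
Proof.
have [s0 _] := sS => sw; have := form_lin 1 s0 s0 sw.
by rewrite scaler0 addr0 mul1r => /eqP; rewrite -subr_eq subrr eq_sym => /eqP.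
Qed.

Lemma form_Dl u v w : S u -> S v -> S w -> B (u + v) w = B u w + B v w.
Proof. by move=> su sv sw; rewrite -[u in LHS]scale1r form_lin// mul1r. Qed.

Lemma form_Zl (c : R) u w : S u -> S w -> B (c *: u) w = c * B u w.
Proof.
have [s0 _] := sS => su sw.
by rewrite -[c *: u]addr0 form_lin// form_0l// addr0.
Qed.

Lemma form_Bl u v w : S u -> S v -> S w -> B (u - v) w = B u w - B v w.
Proof.
move=> su sv sw; rewrite -scaleN1r addrC form_lin// addrC.
by rewrite mulN1r.
Qed.

Lemma form_suml (I : Type) (s : seq I) (P : pred I) (F : I -> V) w :
  (forall i, P i -> S (F i)) -> S w ->
  B (\sum_(i <- s | P i) F i) w = \sum_(i <- s | P i) B (F i) w.
Proof.
move=> SF sw; pose K u (r : R) := S u /\ B u w = r.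
suff [] : K (\sum_(i <- s | P i) F i) (\sum_(i <- s | P i) B (F i) w) by [].
apply: big_ind2 => [|u1 r1 u2 r2 [s1 <-] [s2 <-]|i Pi].
- by split; [case: sS|exact: form_0l].
- by split; [exact: lset_add|rewrite form_Dl].
- by split => //; exact: SF.
Qed.

Lemma form_combl (I : Type) (s : seq I) (c : I -> R) (F : I -> V) w :
  (forall i, S (F i)) -> S w ->
  B (\sum_(i <- s) c i *: F i) w = \sum_(i <- s) c i * B (F i) w.
Proof.
move=> SF sw; rewrite form_suml//; first by apply: eq_bigr => i _; rewrite form_Zl.
by move=> i _; exact: lset_scale.
Qed.

Lemma form_sq (c : R) u v : S u -> S v ->
  B (c *: u + v) (c *: u + v) = c ^+ 2 * B u u + 2 * c * B u v + B v v.
Proof.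
move=> su sv; have sw := lset_lin c su sv.
rewrite form_lin// (form_sym su sw) (form_sym sv sw) !form_lin// (form_sym sv su); ring.
Qed.

Lemma form_sqD u v : S u -> S v -> B (u + v) (u + v) = B u u + 2 * B u v + B v v.
Proof. by move=> su sv; rewrite -[u in LHS]scale1r form_sq//; ring. Qed.

Lemma form_sqB u v : S u -> S v -> B (u - v) (u - v) = B u u - 2 * B u v + B v v.
Proof. by move=> su sv; rewrite addrC -scaleN1r form_sq// (form_sym sv su); ring. Qed.

Lemma form_sqZ (c : R) u : S u -> B (c *: u) (c *: u) = c ^+ 2 * B u u.
Proof. by move=> su; have sc := lset_scale c su; rewrite form_Zl// form_sym// form_Zl//; ring. Qed.

End algebra.

(** The form is nonnegative at [v - t u] and at [v + t u]. *)
Lemma form_young S B t u v : linear_set S -> psd_form S B -> S u -> S v -> 0 < t ->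
  `|2 * B u v| <= t * B u u + t^-1 * B v v.
Proof.
move=> sS fB su sv t0.
have K (r : R) : r ^+ 2 = 1 -> 2 * (r * B u v) <= t * B u u + t^-1 * B v v.
  move=> r1; have := form_ge0 fB (lset_lin sS (- r * t) su sv).
  rewrite (form_sq sS fB)// exprMn sqrrN r1 mul1r -(@pmulr_rge0 _ t^-1) ?invr_gt0//.
  rewrite (_ : t^-1 * (t ^+ 2 * _ + _ + _) = t * B u u - 2 * (r * B u v) + t^-1 * B v v).
    by move: (t * B u u) (t^-1 * B v v) (r * B u v) => x y z; lra.
  by field; rewrite gt_eqF.
rewrite ler_norml; have := K 1 (expr1n _ _); have := K (-1); rewrite sqrrN expr1n => /(_ erefl).
by move: (t * _) (t^-1 * _) => x y h1 h2; apply/andP; split; lra.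
Qed.

Lemma small_natSinv (e : R) : 0 < e -> exists J, forall k, (J <= k)%N -> k.+1%:R^-1 <= e.
Proof.
move=> e0; exists (Num.bound e^-1) => k Jk.
rewrite -[leRHS]invrK lef_pV2 ?posrE ?invr_gt0// ltW//.
have := @archi_boundP _ e^-1; rewrite invr_ge0 => /(_ (ltW e0)) /lt_le_trans; apply.
by rewrite ler_nat leqW.
Qed.

Lemma le_small (x y K : R) : 0 <= K ->
  (forall eta, 0 < eta -> eta <= 1 -> x <= y + eta * K) -> x <= y.
Proof.
move=> K0 H; apply/ler_addgt0Pr => e e0; have K1 : 0 < K + 1 by rewrite ltr_wpDl.
apply: le_trans (H (Num.min 1 (e / (K + 1))) _ _) _.
- by rewrite lt_min ltr01 divr_gt0.
- by rewrite ge_min lexx.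
rewrite lerD2l; apply: le_trans (ler_wpM2r K0 (_ : _ <= e / (K + 1))) _.
  by rewrite ge_min lexx orbT.
rewrite mulrAC ler_pdivrMr// ler_wpM2l ?(ltW e0)// lerDl; exact: ler01.
Qed.

(** By compactness of [[-C, C]], [f] has a limit along the ultrafilter. *)
Lemma ultra_osc (T : Type) (F : set_system T) (f : T -> R) C eta : UltraFilter F ->
  (forall x, `|f x| <= C) -> 0 < eta ->
  exists2 A, F A & forall x y, A x -> A y -> `|f x - f y| <= eta.
Proof.
move=> FU fC eta0; have FP := @ultra_proper _ _ FU.
have [|p [_ clp]] := @segment_compact R (- C) C (f @ F) (fmap_proper_filter f FP).
  by apply: (@filterS _ F _ setT) filterT => x _; rewrite /= in_itv/= -ler_norml.
exists (f @^-1` ball p (eta / 2)); last first.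
  move=> x y; rewrite /ball/= => px py; rewrite (_ : f x - f y = (p - f y) - (p - f x)); last by ring.
  by apply: le_trans (ler_normB _ _) _; rewrite [eta]splitr lerD// ltW.
have [//|nF] := in_ultra_setVsetC (f @^-1` ball p (eta / 2)) FU.
have : (~` ball p (eta / 2)) `&` ball p (eta / 2) !=set0.
  by apply: clp; [exact: nF|apply: nbhsx_ballx; rewrite divr_gt0].
by move=> [y []].
Qed.

(** Completeness for sequences that converge at the rate used in
    [L2_complete]. *)
Definition form_complete S B := forall w : nat -> V, (forall k, S (w k)) ->
  (forall k j, (k <= j)%N -> B (w j - w k) (w j - w k) <= 8^-1 ^+ k) ->
  exists2 v, S v & forall eps, 0 < eps -> exists k0, forall k, (k0 <= k)%N ->
    B (v - w k) (v - w k) <= eps.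

(** Compactness of the embedding for the norm [B + E] into the space with norm
    [B], in the form in which Friedrichs' inequality provides it. *)
Definition form_compact S B E := forall eps, 0 < eps ->
  exists (T : finType) (l : T -> V -> R) (C : R),
  [/\ 0 <= C, forall t u v, S u -> S v -> l t (u - v) = l t u - l t v,
      forall t u, S u -> l t u ^+ 2 <= C * (B u u + E u u)
    & forall u, S u -> B u u <= eps * E u u + \sum_t l t u ^+ 2].

Section minimizer.
Variables (S : set V) (B E : V -> V -> R).
Hypotheses (sS : linear_set S) (fB : psd_form S B) (fE : psd_form S E).
Hypotheses (cN : form_complete S (fun u v => B u v + E u v)) (kB : form_compact S B E).

Lemma form_ratio mu : (forall u, S u -> B u u = 1 -> mu <= E u u) ->
  forall u, S u -> mu * B u u <= E u u.
Proof.
move=> H u su; have := form_ge0 fB su; rewrite le_eqVlt => /orP[/eqP<-|B0].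
  by rewrite mulr0 (form_ge0 fE).
pose c := (Num.sqrt (B u u))^-1.
have c2 : c ^+ 2 = (B u u)^-1 by rewrite exprVn sqr_sqrtr// ltW.
have := H (c *: u) (lset_scale sS c su).
rewrite (form_sqZ sS fB)// (form_sqZ sS fE)// c2 mulVf ?gt_eqF// => /(_ erefl).
by rewrite mulrC ler_pdivlMr.
Qed.

(** The direct method. Along an ultrafilter a minimizing sequence is Cauchy for
    [B] by compactness, and then for [E] by the parallelogram identity, because
    the half-sum of two elements that nearly minimize cannot do much better. A
    subsequence converges to a minimizer, and the first variation of
    [E - mu * B] vanishes there. *)
Lemma minimizer : (exists2 u, S u & 0 < B u u) ->
  exists v mu, [/\ S v, B v v = 1, forall u, S u -> E v u = mu * B v u
    & forall u, S u -> mu * B u u <= E u u].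
Proof.
move=> [u0 su0 Bu0]; pose A := [set E u u | u in [set u | S u /\ B u u = 1]].
have A0 : A !=set0.
  pose c := (Num.sqrt (B u0 u0))^-1; pose u := c *: u0.
  exists (E u u), u => //; split; first exact: lset_scale.
  by rewrite (form_sqZ sS fB)// exprVn sqr_sqrtr ?(ltW Bu0)// mulVf// gt_eqF.
have Alb : lbound A 0 by move=> _ [u [su _] <-]; exact: (form_ge0 fE su).
pose mu := inf A; have mu0 : 0 <= mu by exact: lb_le_inf.
have muE : forall u, S u -> mu * B u u <= E u u.
  apply: form_ratio => u su u1; apply: ge_inf; first by exists 0.
  by exists u.
have /choice[w wP] : forall j : nat, exists w, [/\ S w, B w w = 1 & E w w <= mu + j.+1%:R^-1].
  move=> j; have j0 : (0 : R) < j.+1%:R^-1 by rewrite invr_gt0.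
  have [|_ [w [sw w1] <-] lt] := inf_adherent j0 (E := A); first by split=> //; exists 0.
  by exists w; split => //; exact: ltW.
have sw j : S (w j) by case: (wP j).
have w1 j : B (w j) (w j) = 1 by case: (wP j).
have wE j : E (w j) (w j) <= mu + j.+1%:R^-1 by case: (wP j).
have wE1 j : E (w j) (w j) <= mu + 1.
  by apply: le_trans (wE j) _; rewrite lerD2l invf_le1// ler1n.
have wB i j := lset_sub sS (sw i) (sw j).
have [F [FU Foo]] := @ultraFilterLemma _ (\oo : set_system nat) _.
have FP := @ultra_proper _ _ FU.
have small eps : 0 < eps -> exists2 X, F X & forall i j, X i -> X j ->
    B (w i - w j) (w i - w j) + E (w i - w j) (w i - w j) <= eps.
  move=> eps0.
  pose D := 4 * (mu + 1).
  have m1 : 0 < 1 + mu by lra.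
  have D0 : 0 < D by rewrite /D mulr_gt0// addrC.
  pose e1 := eps / (4 * D * (1 + mu)).
  have e10 : 0 < e1 by rewrite divr_gt0// mulr_gt0// mulr_gt0.
  have [T [l [C [C0 lB lC Bl]]]] := kB e10.
  have T1 : 0 < 1 + #|T|%:R :> R by rewrite ltr_wpDr.
  pose eta := Num.sqrt (eps / (4 * (1 + #|T|%:R) * (1 + mu))).
  have eta2 : eta ^+ 2 = eps / (4 * (1 + #|T|%:R) * (1 + mu)).
    by rewrite sqr_sqrtr// ltW// divr_gt0// !mulr_gt0.
  have eta0 : 0 < eta by rewrite sqrtr_gt0 divr_gt0// !mulr_gt0.
  have lw t : exists2 X, F X & forall i j, X i -> X j -> `|l t (w i) - l t (w j)| <= eta.
    apply: (@ultra_osc _ _ (fun i => l t (w i)) (Num.sqrt (C * (1 + (mu + 1))))) => // i.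
    rewrite -(@ler_pXn2r _ 2)// ?nnegrE ?sqrtr_ge0//.
    rewrite real_normK ?num_real// sqr_sqrtr; last by rewrite mulr_ge0// !addr_ge0.
    apply: le_trans (lC t _ (sw i)) _; rewrite ler_wpM2l// w1 lerD2l; exact: wE1.
  have /choice[X XP] : forall t, exists X, F X /\
      forall i j, X i -> X j -> `|l t (w i) - l t (w j)| <= eta.
    by move=> t; have [X] := lw t; exists X.
  have FX : F [set i | forall t, X t i] by apply: filter_forall => t; exact: (XP t).1.
  have [J iJ] := @small_natSinv (eps / 16) (divr_gt0 eps0 (ltr0n _ 16)).
  exists ([set i | forall t, X t i] `&` [set i | (J <= i)%N]).
    by apply: filterI => //; apply: Foo; exists J.
  move=> i j [Xi Ji] [Xj Jj].
  have Eij : E (w i - w j) (w i - w j) <= D.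
    have := form_ge0 fE (lset_add sS (sw i) (sw j)).
    rewrite (form_sqD sS fE)// (form_sqB sS fE)//.
    have := wE1 i; have := wE1 j; rewrite /D; lra.
  have Bij : B (w i - w j) (w i - w j) * (1 + mu) <= eps / 2.
    have l2 : \sum_t l t (w i - w j) ^+ 2 <= #|T|%:R * eta ^+ 2.
      rewrite mulr_natl -sumr_const; apply: ler_sum => t _.
      rewrite lB// -[X in X <= _]real_normK ?num_real//.
      rewrite lerXn2r ?nnegrE ?(ltW eta0)//; exact: (XP t).2.
    have l1 := Bl _ (wB i j).
    have e1w := ltW e10.
  have l3 : B (w i - w j) (w i - w j) <= e1 * D + #|T|%:R * eta ^+ 2.
      by apply: le_trans l1 _; rewrite lerD// ler_wpM2l// ltW.
    apply: le_trans (ler_wpM2r _ l3) _; first by rewrite addr_ge0.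
    have h1 : e1 * D * (1 + mu) = eps / 4.
      by rewrite /e1; field; rewrite !gt_eqF.
    have h2 : #|T|%:R * eta ^+ 2 * (1 + mu) <= eps / 4.
      rewrite eta2 [leLHS](_ : _ = (eps / 4) * (#|T|%:R / (1 + #|T|%:R))); last first.
        by field; rewrite !gt_eqF.
      apply: ler_piMr; first by rewrite divr_ge0// ltW.
      by rewrite ler_pdivrMr// mul1r lerDr.
    rewrite mulrDl h1; lra.
  have Esum := muE _ (lset_add sS (sw i) (sw j)).
  move: Esum Bij; rewrite (form_sqD sS fE)// (form_sqD sS fB)// (form_sqB sS fE)// (form_sqB sS fB)// !w1.
  have := wE i; have := wE j; have := iJ i Ji; have := iJ j Jj.
  have arith (c x e xi xj ri rj k : R) : 0 < k -> rj <= k / 16 -> ri <= k / 16 -> xj <= c + rj ->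
      xi <= c + ri -> c * (1 + 2 * x + 1) <= xi + 2 * e + xj ->
      (1 - 2 * x + 1) * (1 + c) <= k / 2 ->
      1 - 2 * x + 1 + (xi - 2 * e + xj) <= k.
    by nra.
  exact: arith eps0.
have /choice[X XP] : forall k : nat, exists X, F X /\ forall i j, X i -> X j ->
    B (w i - w j) (w i - w j) + E (w i - w j) (w i - w j) <= 8^-1 ^+ k.
  by move=> k; have [|X] := small (8^-1 ^+ k); [rewrite exprn_gt0|exists X].
(* a subsequence that is Cauchy at the rate [8^-k] *)
have /choice[s sP] : forall k : nat, exists i, (k <= i)%N /\ forall j, (j <= k)%N -> X j i.
  move=> k; have : F ([set i | (k <= i)%N] `&` [set i | forall j : 'I_k.+1, X j i]).
    apply: filterI; first by apply: Foo; exists k.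
    by apply: (@filter_forall _ _ (fun j : 'I_k.+1 => X j)) => j; exact: (XP j).1.
  move=> /filter_ex[i [ki Xi]]; exists i; split => // j jk.
  by have := Xi (Ordinal (jk : (j < k.+1)%N)).
have [v sv vw] : exists2 v, S v & forall eps, 0 < eps -> exists k0, forall k, (k0 <= k)%N ->
    B (v - w (s k)) (v - w (s k)) + E (v - w (s k)) (v - w (s k)) <= eps.
  apply: (cN (w := w \o s)) => [k|k j kj /=]; first exact: sw.
  by apply: (XP k).2; [apply: (sP j).2|apply: (sP k).2].
have close eta : 0 < eta -> eta <= 1 ->
    `|B v v - 1| <= 3 * eta /\ E v v <= mu + eta * (mu + 4).
  move=> eta0 eta1; have [k0 kP] := vw (eta ^+ 2) (exprn_gt0 2 eta0).
  have [J iJ] := small_natSinv eta0; pose k := maxn k0 J.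
  have wk : E (w (s k)) (w (s k)) <= mu + eta.
    apply: le_trans (wE _) _; rewrite lerD2l; apply: iJ; exact: leq_trans (leq_maxr _ _) (sP k).1.
  have := kP k (leq_maxl _ _); have [sw' z] := (sw (s k), lset_sub sS sv (sw (s k))).
  have B0 := form_ge0 fB z; have E0 := form_ge0 fE z => N.
  have Bz : B (v - w (s k)) (v - w (s k)) <= eta ^+ 2 by lra.
  have Ez : E (v - w (s k)) (v - w (s k)) <= eta ^+ 2 by lra.
  have vE : v = w (s k) + (v - w (s k)) by rewrite addrC subrK.
  have e2 : eta ^+ 2 <= eta by rewrite expr2 ler_piMl// ltW.
  have ti x : x <= eta ^+ 2 -> eta^-1 * x <= eta.
    by move=> le; rewrite mulrC ler_pdivrMr// -expr2.
  have := form_young sS fB sw' z eta0; have := form_young sS fE sw' z eta0.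
  have := ti _ Bz; have := ti _ Ez; rewrite w1 !ler_norml.
  have := form_sqD sS fB sw' z; have := form_sqD sS fE sw' z; rewrite -vE w1 => -> ->.
  move: (eta^-1 * _) (eta^-1 * _) => x y tx ty /andP[e1 e2'] /andP[b1 b2].
  have wk2 : eta * E (w (s k)) (w (s k)) <= eta * (mu + 1) by rewrite ler_wpM2l// ltW.
  split; last by nra.
  by apply/andP; split; nra.
have v1 : B v v = 1.
  have : `|B v v - 1| <= 0.
    by apply: (@le_small _ _ 3) => // eta e0 e1; rewrite add0r mulrC; case: (close eta e0 e1).
  by rewrite normr_le0 subr_eq0 => /eqP.
have vmu : E v v = mu.
  apply/eqP; rewrite eq_le; apply/andP; split; last by have := muE v sv; rewrite v1 mulr1.
  by apply: (@le_small _ _ (mu + 4)) => [|eta e0 e1]; [rewrite addr_ge0|case: (close eta e0 e1)].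
exists v, mu; split => // u su; apply/eqP; rewrite -subr_eq0; apply/eqP.
(* [E - mu * B] takes the value [2 t b + t^2 a] at [v + t u], which would be
   negative for small [t] of the sign opposite to [b] *)
pose a := E u u - mu * B u u; pose b := E v u - mu * B v u.
have a0 : 0 <= a by rewrite subr_ge0 muE.
have a1 : 0 < a + 1 by rewrite ltr_wpDl.
rewrite -/b; apply/eqP/negPn/negP => bn0.
have b2 : 0 < b ^+ 2 by rewrite lt_neqAle eq_sym sqrf_eq0 bn0 sqr_ge0.
have := muE _ (lset_lin sS (- b / (a + 1)) su sv).
rewrite (form_sq sS fB)// (form_sq sS fE)// v1 vmu (form_sym fB su sv) (form_sym fE su sv).
rewrite -subr_ge0 (_ : _ - _ = - (b ^+ 2 * (a + 2) / (a + 1) ^+ 2)).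
  by rewrite oppr_ge0 leNgt divr_gt0// ?exprn_gt0// mulr_gt0// ltr_wpDl.
have -> : E u u = a + mu * B u u by rewrite /a; ring.
have -> : E v u = b + mu * B v u by rewrite /b; ring.
by field; rewrite gt_eqF.
Qed.

End minimizer.

End psd_forms.

Section orthonormal_families.
Context (R : realType) (V : lmodType R).
Implicit Types (S P : set V) (B E : V -> V -> R) (u v w x p : V).

(** Vectors are considered modulo the null vectors of [B]: independence means
    that no nontrivial combination is null, and instead of expressing the [v i]
    by the [f j] the conclusion says that what is orthogonal to the [f j] is
    orthogonal to the [v i]. *)
Lemma gram_schmidt S B d (v : nat -> V) : linear_set S -> psd_form S B ->
  (forall i, S (v i)) ->
  (forall c : nat -> R, B (\sum_(i < d) c i *: v i) (\sum_(i < d) c i *: v i) = 0 ->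
    forall i, (i < d)%N -> c i = 0) ->
  exists f : nat -> V, [/\ forall j, exists c : nat -> R, f j = \sum_(i < d) c i *: v i,
    forall i j, (i < d)%N -> (j < d)%N -> B (f i) (f j) = (i == j)%:R
    & forall u, S u -> (forall j, (j < d)%N -> B u (f j) = 0) ->
        forall i, (i < d)%N -> B u (v i) = 0].
Proof.
move=> sS fB Sv; elim: d => [_|d IH ind].
  exists (fun=> 0); split=> // j; exists (fun=> 0); by rewrite big_ord0.
have [|f [fc fo fv]] := IH.
  move=> c cB i id; pose c' j := if (j < d)%N then c j else 0.
  have := ind c'; rewrite big_ord_recr/= {2 4}/c' ltnn scale0r addr0.
  have -> : \sum_(j < d) c' j *: v j = \sum_(j < d) c j *: v j.
    by apply: eq_bigr => j _; rewrite /c' ltn_ord.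
  by move=> /(_ cB i); rewrite /c' id; apply; exact: ltnW.
have Sf j : S (f j).
  by have [c ->] := fc j; apply: (lset_sum sS) => i _; exact: lset_scale.
pose a j := B (v d) (f j).
pose w := v d - \sum_(j < d) a j *: f j.
have Sw : S w by apply: (lset_sub sS) => //; apply: (lset_sum sS) => j _; exact: lset_scale.
have /choice[c cP] := fc.
pose e i := if (i < d)%N then - \sum_(j < d) a j * c j i else 1.
have wE : w = \sum_(i < d.+1) e i *: v i.
  rewrite big_ord_recr/= {2}/e ltnn scale1r addrC /w; congr (_ + _).
  rewrite (eq_bigr (fun j : 'I_d => \sum_(i < d) (a j * c j i) *: v i)); last first.
    by move=> j _; rewrite cP scaler_sumr; apply: eq_bigr => i _; rewrite scalerA.
  rewrite exchange_big/= -sumrN; apply: eq_bigr => i _.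
  by rewrite /e ltn_ord scaleNr scaler_suml.
have wf j : (j < d)%N -> B w (f j) = 0.
  move=> jd; rewrite (form_Bl fB)//; last by apply: (lset_sum sS) => i _; exact: lset_scale.
  rewrite (form_combl sS fB)// (bigD1 (Ordinal jd))//= fo// eqxx mulr1 big1 ?addr0 ?subrr//.
  by move=> i ij; rewrite fo// (negbTE (ij : (i : nat) != j)) mulr0.
have ww : 0 < B w w.
  rewrite lt_neqAle (form_ge0 fB Sw) andbT eq_sym; apply/eqP => w0.
  have := ind e; rewrite -wE => /(_ w0 d (ltnSn d)).
  by rewrite /e ltnn => /eqP; rewrite oner_eq0.
pose s := (Num.sqrt (B w w))^-1.
have s0 : s != 0 by rewrite invr_eq0 gt_eqF// sqrtr_gt0.
have s1 : B (s *: w) (s *: w) = 1.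
  by rewrite (form_sqZ sS fB)// exprVn sqr_sqrtr ?(ltW ww)// mulVf// gt_eqF.
have Ssw : S (s *: w) by exact: lset_scale.
have swf j : (j < d)%N -> B (s *: w) (f j) = 0.
  by move=> jd; rewrite (form_Zl sS fB)// wf// mulr0.
exists (fun j => if (j < d)%N then f j else s *: w); split.
- move=> j; case: ifP => _; last first.
    by exists (fun i => s * e i); rewrite wE scaler_sumr; apply: eq_bigr => i _; rewrite scalerA.
  exists (fun i => if (i < d)%N then c j i else 0); rewrite big_ord_recr/= ltnn scale0r addr0 cP.
  by apply: eq_bigr => i _; rewrite ltn_ord.
- move=> i j; rewrite !ltnS => id jd; case: ltnP => id'; case: ltnP => jd'.
  + exact: fo.
  + by rewrite (form_sym fB)// swf// ltn_eqF// (leq_trans id').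
  + by rewrite swf// gtn_eqF// (leq_trans jd').
  + by rewrite s1 (_ : i = j) ?eqxx//; apply/eqP; rewrite eqn_leq (leq_trans id jd') (leq_trans jd id').
- move=> u su uf.
  have uf' j : (j < d)%N -> B u (f j) = 0.
    by move=> jd; have := uf j (leqW jd); rewrite jd.
  have uw : B u w = 0.
    have := uf d (ltnSn d); rewrite ltnn (form_sym fB)// (form_Zl sS fB)// => /eqP.
    by rewrite mulf_eq0 (negbTE s0) => /eqP; rewrite (form_sym fB).
  move=> i; rewrite ltnS leq_eqVlt => /orP[/eqP->|id]; last exact: fv.
  rewrite (form_sym fB)// -[v d](subrK (\sum_(j < d) a j *: f j)) -/w.
  rewrite (form_Dl fB)//; last by apply: (lset_sum sS) => j _; exact: lset_scale.
  rewrite (form_sym fB Sw su) uw add0r (form_combl sS fB)// big1// => j _.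
  by rewrite (form_sym fB)// uf'// mulr0.
Qed.

(** Let [phi i] and [q i] be [x i] and [p i] minus their projections on
    [u 0, .., u (k - 1)], let [d i = lam k - lam i], [a i j = B (x i) (u j)] and
    [w i = - B (phi i) (p i)]. The equation for [x i] gives
    [B (p i) (u j) = (lam i - lam j) a i j] and
    [E (phi i) (phi i) = lam i B (phi i) (phi i) + w i]. The Rayleigh quotient of
    [phi i] then yields [d i |phi i|^2 <= w i], and Cauchy-Schwarz, in the form
    [2 d w <= d^2 |phi|^2 + |q|^2], improves this to [d i w i <= |q i|^2]. After
    multiplication by [d i] and summation, the terms that contain the [a i j]
    cancel because [a] is symmetric. *)
Lemma yang_commutator S P B E k (lam : nat -> R) (u x p : nat -> V) :
  linear_set S -> linear_set P -> S `<=` P -> psd_form P B -> psd_form S E ->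
  (forall i, S (u i)) -> (forall i j, B (u i) (u j) = (i == j)%:R) ->
  (forall i, (i < k)%N -> lam i <= lam k) ->
  (forall i w, S w -> E (u i) w = lam i * B (u i) w) ->
  (forall w, S w -> (forall i, (i < k)%N -> B w (u i) = 0) -> lam k * B w w <= E w w) ->
  (forall i, S (x i)) -> (forall i, P (p i)) ->
  (forall i j, B (x i) (u j) = B (x j) (u i)) ->
  (forall i w, S w -> E (x i) w = lam i * B (x i) w - B (p i) w) ->
  \sum_(i < k) (lam k - lam i) ^+ 2 * - B (x i) (p i) <=
  \sum_(i < k) (lam k - lam i) * B (p i) (p i).
Proof.
move=> sS sP SP fB fE Su uo lk Eu ray Sx Pp xu Ex.
have Pu i := SP _ (Su i); have Px i := SP _ (Sx i).
pose a i j := B (x i) (u j); pose b i j := (lam i - lam j) * a i j.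
have pu i j : B (p i) (u j) = b i j.
  have := Ex i (u j) (Su j); rewrite (form_sym fE)// Eu// (form_sym fB (Pu j) (Px i)) => E1.
  by rewrite /b /a mulrBl E1; ring.
pose phi i := x i - \sum_(j < k) a i j *: u j.
pose q i := p i - \sum_(j < k) b i j *: u j.
have Sc (c : nat -> R) : S (\sum_(j < k) c j *: u j).
  by apply: (lset_sum sS) => j _; exact: lset_scale.
have uk (c : nat -> R) j : (j < k)%N -> B (\sum_(l < k) c l *: u l) (u j) = c j.
  move=> jk; rewrite (form_combl sP fB)// (bigD1 (Ordinal jk))//= uo eqxx mulr1 big1 ?addr0//.
  by move=> i ij; rewrite uo (negbTE (ij : (i : nat) != j)) mulr0.
have Sphi i : S (phi i) by apply: (lset_sub sS).
have Pphi i := SP _ (Sphi i).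
have Pc c := SP _ (Sc c).
have Pq i : P (q i) by apply: (lset_sub sP).
have phiu i j : (j < k)%N -> B (phi i) (u j) = 0.
  by move=> jk; rewrite (form_Bl fB)// uk// subrr.
have qu i j : (j < k)%N -> B (q i) (u j) = 0.
  by move=> jk; rewrite (form_Bl fB)// uk// pu subrr.
have orth (c : nat -> R) w : P w -> (forall j, (j < k)%N -> B w (u j) = 0) ->
    B (\sum_(j < k) c j *: u j) w = 0.
  by move=> Pw wu; rewrite (form_combl sP fB)// big1// => j _; rewrite (form_sym fB)// wu// mulr0.
pose w i := - B (phi i) (p i).
have wE i : w i = - B (x i) (p i) + \sum_(j < k) (lam i - lam j) * a i j ^+ 2.
  rewrite /w (form_Bl fB)// opprB addrC (form_combl sP fB)//; congr (_ + _).
  by apply: eq_bigr => j _; rewrite (form_sym fB)// pu /b; ring.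
have wq i : w i = - B (phi i) (q i).
  rewrite /w (form_sym fB)// -[p i](subrK (\sum_(j < k) b i j *: u j)) -/(q i).
  rewrite (form_Dl fB)// orth//; last by move=> j; exact: phiu.
  by rewrite addr0 (form_sym fB).
have pp i : B (p i) (p i) = B (q i) (q i) + \sum_(j < k) b i j ^+ 2.
  rewrite -{1 2}[p i](subrK (\sum_(j < k) b i j *: u j)) -/(q i) addrC.
  rewrite (form_sqD sP fB)// (orth (b i) (q i))//; last by move=> j; exact: qu.
  rewrite mulr0 addr0 addrC (form_combl sP fB)//; congr (_ + _).
  by apply: eq_bigr => j _; rewrite (form_sym fB)// uk// expr2.
have del1 i : (lam k - lam i) * B (phi i) (phi i) <= w i.
  have : E (phi i) (phi i) = lam i * B (phi i) (phi i) + w i.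
    rewrite {1}/phi (form_Bl fE)// Ex// (form_combl sS fE)//.
    rewrite big1 ?subr0; last by move=> j _; rewrite Eu// (form_sym fB)// phiu// !mulr0.
    rewrite {3}/phi (form_Bl fB)// orth// ?subr0; last by move=> j; exact: phiu.
    by rewrite /w (form_sym fB (Pp i)).
  have := ray _ (Sphi i) (phiu i); rewrite mulrBl; lra.
have del2 i : (i < k)%N ->
    (lam k - lam i) ^+ 2 * w i <= (lam k - lam i) * B (q i) (q i).
  move=> ik; have d0 : 0 <= lam k - lam i by rewrite subr_ge0 lk.
  rewrite expr2 -mulrA ler_wpM2l//.
  have := form_ge0 fB (lset_lin sP (lam k - lam i) (Pphi i) (Pq i)).
  rewrite (form_sq sP fB)// -[B (phi i) (q i)]opprK -wq.
  have : (lam k - lam i) ^+ 2 * B (phi i) (phi i) <= (lam k - lam i) * w i.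
    by rewrite expr2 -mulrA ler_wpM2l.
  by nra.
pose T1 := \sum_(i < k) \sum_(j < k) (lam k - lam i) ^+ 2 * ((lam i - lam j) * a i j ^+ 2).
pose T2 := \sum_(i < k) \sum_(j < k) (lam k - lam i) * b i j ^+ 2.
have anti : T1 + T2 = 0.
  pose D (i j : 'I_k) := (lam k - lam i) ^+ 2 * ((lam i - lam j) * a i j ^+ 2) +
    (lam k - lam i) * b i j ^+ 2.
  have TE : T1 + T2 = \sum_(i < k) \sum_(j < k) D i j.
    by rewrite -big_split/=; apply: eq_bigr => i _; rewrite -big_split.
  have TN : \sum_(i < k) \sum_(j < k) D i j = - \sum_(i < k) \sum_(j < k) D i j.
    rewrite {1}exchange_big/= -sumrN; apply: eq_bigr => i _; rewrite -sumrN; apply: eq_bigr => j _.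
    by rewrite /D /b /a (xu j i); ring.
  rewrite TE; lra.
have le : \sum_(i < k) (lam k - lam i) ^+ 2 * w i <= \sum_(i < k) (lam k - lam i) * B (q i) (q i).
  by apply: ler_sum => i _; exact: del2.
have lhs : \sum_(i < k) (lam k - lam i) ^+ 2 * w i =
    \sum_(i < k) (lam k - lam i) ^+ 2 * - B (x i) (p i) + T1.
  rewrite -big_split/=; apply: eq_bigr => i _; rewrite wE mulrDr; congr (_ + _).
  by rewrite mulr_sumr.
have rhs : \sum_(i < k) (lam k - lam i) * B (p i) (p i) =
    \sum_(i < k) (lam k - lam i) * B (q i) (q i) + T2.
  by rewrite -big_split/=; apply: eq_bigr => i _; rewrite pp mulrDr mulr_sumr.
rewrite rhs; move: le; rewrite lhs; lra.
Qed.

End orthonormal_families.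

Section orthogonal_complement.
Context (R : realType) (V : lmodType R).
Implicit Types (S : set V) (B E N : V -> V -> R) (u v w : V).

Lemma form_compactS S S' B E : S' `<=` S -> form_compact S B E -> form_compact S' B E.
Proof.
move=> sS cB eps e0; have [T [l [C [C0 lB lC Bl]]]] := cB eps e0.
exists T, l, C; split=> // [t u v su sv|t u su|u su].
- by apply: lB; exact: sS.
- by apply: lC; exact: sS.
- by apply: Bl; exact: sS.
Qed.

Definition orth_compl S B k (U : nat -> V) : set V :=
  [set w | S w /\ forall i, (i < k)%N -> B w (U i) = 0].

Lemma linear_orth S B k U : linear_set S -> psd_form S B -> (forall i, S (U i)) ->
  linear_set (orth_compl S B k U).
Proof.
move=> sS fB SU; split=> [|c u v [su uU] [sv vU]].
  by split; [case: sS|move=> i _; exact: (form_0l sS fB)].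
split; first exact: lset_lin.
by move=> i ik; rewrite (form_lin fB)// uU// vU// mulr0 addr0.
Qed.

(** The conditions of orthogonality are closed, by [form_young]. *)
Lemma form_complete_orth S B N k U : linear_set S -> psd_form S B -> (forall i, S (U i)) ->
  (forall u, S u -> B u u <= N u u) ->
  form_complete S N -> form_complete (orth_compl S B k U) N.
Proof.
move=> sS fB SU BN cN w wU wC; have sw j : S (w j) by case: (wU j).
have [v sv vw] := cN w sw wC; exists v => //; split => // i ik.
suff : `|2 * B v (U i)| <= 0 by rewrite normr_le0 mulf_eq0 pnatr_eq0/= => /eqP.
apply: (@le_small _ _ _ (B (U i) (U i) + 1)); first by rewrite addr_ge0// (form_ge0 fB).
move=> eta e0 e1; have [k0 /(_ k0 (leqnn _)) le] := vw (eta ^+ 2) (exprn_gt0 2 e0).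
have sz := lset_sub sS sv (sw k0).
have -> : B v (U i) = B (U i) (v - w k0).
  by rewrite [RHS](form_sym fB)// (form_Bl fB)// (wU k0).2// subr0.
rewrite add0r mulrDr mulr1; apply: le_trans (form_young sS fB (SU i) sz e0) _.
rewrite lerD2l mulrC ler_pdivrMr// -expr2; exact: le_trans (BN _ sz) le.
Qed.

End orthogonal_complement.

(** * Mass and energy *)
Section pairs.
Context (R : realType) (A I : Type).
Implicit Types (w z : (A -> R) * (I -> A -> R)).

Lemma fst_lin (c : R) w z : (c *: w + z).1 = c *: w.1 + z.1.
Proof. by []. Qed.

Lemma snd_lin (c : R) w z p : (c *: w + z).2 p = c *: w.2 p + z.2 p.
Proof. by []. Qed.

Lemma snd_lin_fun (c : R) w z : (c *: w + z).2 = (fun p => c *: w.2 p + z.2 p).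
Proof. by []. Qed.

Lemma fst_comb (J : Type) (s : seq J) (c : J -> R) (F : J -> (A -> R) * (I -> A -> R)) :
  (\sum_(j <- s) c j *: F j).1 = \sum_(j <- s) c j *: (F j).1.
Proof. by elim/big_rec2: _ => // j u v _ <-. Qed.

End pairs.

Section spectrum.
Context (R : realType) (m : nat) (Omega : set 'rV[R]_m.+1).
Local Notation n := m.+1.
Local Notation h := (@height R m).
Local Notation mu := (lebesgue_rV R n).
Local Notation L2O := (L2 mu Omega).
Local Notation ipO := (ip mu Omega).
Local Notation test := (test_function Omega).
Local Notation sob := (sob Omega).
Variables (M a b : R).
Hypotheses (oO : open Omega) (OM : forall x i, Omega x -> `|x ord0 i| <= M).
Hypotheses (Oh : Omega `<=` @half_space R m) (a0 : 0 < a).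
Hypothesis (hab : forall x, Omega x -> a <= h x ^+ 2 <= b).

Let mO : measurable Omega. Proof. exact: open_measurable_rV. Qed.

Let L2w j g : L2O g -> L2O (hw j * g). Proof. exact: (L2_hw oO OM Oh a0 hab). Qed.

(** Functions paired with their gradients: a gradient is determined by its
    function only up to null sets, so it is kept as data. *)
Local Notation V := (('rV[R]_n -> R) * ('I_n -> 'rV[R]_n -> R))%type.
Implicit Types (w z : V).

Definition mass w z : R := ip mu Omega w.1 (hw 0 * z.1).

Definition energy w z : R := \sum_p ip mu Omega (w.2 p) (hw 2 * z.2 p).

Definition functions : set V := [set w | L2O w.1].

Definition sobolev : set V := [set w | sob w.1 w.2].

Definition jet (g : 'rV[R]_n -> R) : V := (g, fun p => partial p g).

Lemma test0 : test 0.
Proof.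
have E : [set x : 'rV[R]_n | (0 : 'rV[R]_n -> R) x != 0] = set0.
  by apply/seteqP; split => x //=; rewrite !pointwE eqxx.
by split; [exact: (smooth_cst 0)|rewrite E closure0; exact: compact0|rewrite E closure0].
Qed.

Lemma linear_functions : linear_set functions.
Proof. by split=> [|c u v u2 v2]; [exact: L2_0|apply: L2D => //; exact: L2Z]. Qed.

Lemma linear_sobolev : linear_set sobolev.
Proof.
split=> [|c u v su sv]; last first.
  by rewrite /sobolev /mkset fst_lin snd_lin_fun; exact: (sobD oO OM c su sv).
have := sob_test oO OM test0; rewrite /sobolev/= (_ : (fun p => partial p 0) = 0)//.
by apply/funext => p; exact: partial_cst.
Qed.

Lemma sobolev_functions : sobolev `<=` functions.
Proof. by move=> w; exact: sob_L2. Qed.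

Lemma sobolev_jet g : test g -> sobolev (jet g).
Proof. by move=> tg; exact: (sob_test oO OM tg). Qed.

Lemma hw_ip_ge0 j f : 0 <= ipO f (hw j * f).
Proof.
apply: Rintegral_ge0 => x Ox; rewrite ?pointwE mulrCA -expr2 mulr_ge0 ?sqr_ge0//.
exact/ltW/(hw_gt0 Oh).
Qed.

Lemma mass_form : psd_form functions mass.
Proof.
split=> [u v _ _|c u v w u2 v2 w2|u _]; first exact: ip_hwC.
- by rewrite /mass fst_lin ipDl ?ipZl//; solve [exact: L2w|exact: L2Z].
- exact: hw_ip_ge0.
Qed.

Lemma energy_form : psd_form sobolev energy.
Proof.
split=> [u v _ _|c u v w su sv sw|u _].
- by apply: eq_bigr => p _; exact: ip_hwC.
- rewrite mulr_sumr -big_split/=; apply: eq_bigr => p _.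
  have [[u2 v2] w2] := (sob_L2d p su, sob_L2d p sv, sob_L2d p sw).
  by rewrite snd_lin ipDl ?ipZl//; solve [exact: L2w|exact: L2Z].
- by apply: sumr_ge0 => p _; exact: hw_ip_ge0.
Qed.

(** The weights lie between positive constants, so the weighted norms are
    equivalent to the Euclidean ones. *)
Lemma hw_equiv j : exists c C, [/\ 0 < c, 0 < C & forall f, L2O f ->
  c * ipO f f <= ipO f (hw j * f) <= C * ipO f f].
Proof.
have [c c0 hc] := hw_ge OM Oh a0 hab j.
have [_ [C C0 hC]] := bounded_cont_hw OM Oh a0 hab j.
exists c, (C + 1); split => //; first by rewrite ltr_wpDl.
move=> f f2; rewrite -!(ipZl mO)//; apply/andP; split; apply: ip_le => //;
  try solve [exact: L2w|exact: L2Z]; move=> x Ox; rewrite !pointwE.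
- rewrite -mulrA [leRHS]mulrCA -expr2.
  by rewrite ler_wpM2r ?sqr_ge0// hc.
- rewrite -[leRHS]mulrA [leLHS]mulrCA -expr2 ler_wpM2r ?sqr_ge0//.
  by apply: le_trans (ler_norm _) _; rewrite (le_trans (hC x Ox))// lerDl.
Qed.

Lemma mass_ae w f : L2O w.1 -> L2O f -> {ae mu, forall x, Omega x -> w.1 x = f x} ->
  mass w w = ipO f (hw 0 * w.1).
Proof. by move=> w2 f2 wf; apply: ip_ae => //; exact: L2w. Qed.

Lemma mass_eq0 w : L2O w.1 -> mass w w = 0 -> {ae mu, forall x, Omega x -> w.1 x = 0}.
Proof.
move=> w2 w0; have [c [C [c0 _ /(_ _ w2)/andP[le _]]]] := hw_equiv 0.
apply: ip_eq0 => //; apply/eqP; rewrite eq_le ip_ge0 andbT.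
by rewrite -(ler_pM2l c0) mulr0 (le_trans le)// -/(mass w w) w0.
Qed.

(** [L2_complete] for the functions multiplied by the square root of [c]. *)
Lemma L2_complete_scale c (f : nat -> 'rV[R]_n -> R) : 0 < c ->
  (forall k, L2O (f k)) ->
  (forall k j, (k <= j)%N -> c * ipO (f j - f k) (f j - f k) <= 8^-1 ^+ k) ->
  exists g, L2O g /\ forall k, c * ipO (g - f k) (g - f k) <= 8^-1 ^+ k.
Proof.
move=> c0 f2 fC; pose s := Num.sqrt c.
have s2 : s ^+ 2 = c by rewrite sqr_sqrtr// ltW.
have s0 : s != 0 by rewrite gt_eqF// sqrtr_gt0.
have E (g1 g2 : 'rV[R]_n -> R) : L2O g1 -> L2O g2 ->
    ipO (s *: g1 - s *: g2) (s *: g1 - s *: g2) = c * ipO (g1 - g2) (g1 - g2).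
  move=> g12 g22; have g3 : L2O (g1 - g2) by exact: L2B.
  rewrite -scalerBr ipZl ?ipZr ?mulrA -?expr2 ?s2//; exact: L2Z.
have [|k j kj|g [g2 gf]] := @L2_complete _ _ _ mu Omega mO (fun k => s *: f k).
- by move=> k; exact: L2Z.
- by rewrite E// fC.
exists (s^-1 *: g); split => [|k]; first exact: L2Z.
rewrite -E//; last exact: L2Z.
by rewrite scalerA divff// scale1r.
Qed.

Lemma sobolev_complete : form_complete sobolev (fun u v => mass u v + energy u v).
Proof.
move=> w sw wC; have [c [C [c0 C0 hc]]] := hw_equiv 0.
have [c' [C' [c0' C0' hc']]] := hw_equiv 2.
have w2 k := sobolev_functions (sw k).
have d2 k p := sob_L2d p (sw k).
have le1 u v : sobolev u -> sobolev v ->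
    c * ipO (u.1 - v.1) (u.1 - v.1) <= mass (u - v) (u - v) + energy (u - v) (u - v).
  move=> su sv; have uv2 : L2O (u.1 - v.1) by apply: L2B => //; exact: sobolev_functions.
  have /andP[le _] := hc _ uv2; apply: le_trans le _; rewrite lerDl.
  by apply: (form_ge0 energy_form); exact: (lset_sub linear_sobolev).
have le2 u v p : sobolev u -> sobolev v ->
    c' * ipO (u.2 p - v.2 p) (u.2 p - v.2 p) <= mass (u - v) (u - v) + energy (u - v) (u - v).
  move=> su sv; have uv2 : L2O (u.2 p - v.2 p) by apply: L2B => //; [exact: sob_L2d su|exact: sob_L2d sv].
  have /andP[le _] := hc' _ uv2; apply: le_trans le _.
  rewrite /energy (bigD1 p)//= addrCA lerDl addr_ge0//.
    by apply: (form_ge0 mass_form); apply: (lset_sub linear_functions); exact: sobolev_functions.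
  by apply: sumr_ge0 => q _; exact: hw_ip_ge0.
have [u [u2 uw]] := L2_complete_scale c0 w2
  (fun k j kj => le_trans (le1 _ _ (sw j) (sw k)) (wC k j kj)).
have /choice[d dP] : forall p, exists g, L2O g /\
    forall k, c' * ipO (g - (w k).2 p) (g - (w k).2 p) <= 8^-1 ^+ k.
  move=> p; have [g gP] := L2_complete_scale c0' (fun k => d2 k p)
    (fun k j kj => le_trans (le2 _ _ p (sw j) (sw k)) (wC k j kj)).
  by exists g.
have u2' k : L2O (u - (w k).1) by exact: (L2B mO u2 (w2 k)).
have d2' k p : L2O (d p - (w k).2 p) by exact: (L2B mO (dP p).1 (d2 k p)).
have ipN (f g : 'rV[R]_n -> R) : ipO (f - g) (f - g) = ipO (g - f) (g - f).
  by apply: eq_ip => x _; rewrite !pointwE; ring.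
have small eps : 0 < eps -> exists k0, forall k, (k0 <= k)%N ->
    ipO (u - (w k).1) (u - (w k).1) <= eps /\
    forall p, ipO (d p - (w k).2 p) (d p - (w k).2 p) <= eps.
  move=> e0; have [|J HJ] := @small_natSinv R (Num.min (c * eps) (c' * eps)).
    by rewrite lt_min !mulr_gt0.
  exists J => k Jk; have : 8^-1 ^+ k <= Num.min (c * eps) (c' * eps).
    apply: le_trans (HJ k Jk); rewrite exprVn lef_pV2 ?posrE ?exprn_gt0//.
    by rewrite -natrX ler_nat ltn_expl.
  rewrite le_min => /andP[l1 l2]; split => [|p].
    by rewrite -(ler_pM2l c0) (le_trans (uw k)).
  by rewrite -(ler_pM2l c0') (le_trans ((dP p).2 k)).
exists (u, d).
  apply: (sob_closed oO OM) => //; first by move=> p; exact: (dP p).1.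
  move=> eps /small[k0 /(_ k0 (leqnn _))[l1 l2]].
  exists (w k0).1, (w k0).2; split; first exact: sw.
  by split=> [|p]; rewrite ipN.
move=> eps e0; pose K := C + n%:R * C'; have K0 : 0 < K by rewrite ltr_wpDr// mulr_ge0// ltW.
have [k0 kP] := small _ (divr_gt0 e0 K0); exists k0 => k /kP[l1 l2].
rewrite (_ : eps = C * (eps / K) + \sum_(p < n) C' * (eps / K)); last first.
  by rewrite sumr_const card_ord -[_ *+ n]mulr_natl [n%:R * _]mulrA -mulrDl -/K mulrC divfK// gt_eqF.
rewrite lerD//; [|apply: ler_sum => p _].
- have /andP[_ le] := hc _ (u2' k); apply: le_trans le _.
  by rewrite ler_wpM2l// ltW.
- have /andP[_ le] := hc' _ (d2' k p); apply: le_trans le _.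
  by rewrite ler_wpM2l// ltW.
Qed.

(** [sob_friedrichs], transported from the Euclidean norms to the weighted ones. *)
Lemma sobolev_compact : form_compact sobolev mass energy.
Proof.
move=> eps e0; have [c [C [c0 C0 hc]]] := hw_equiv 0.
have [c' [C' [c0' C0' hc']]] := hw_equiv 2.
have [T [w [w2 Hw]]] := sob_friedrichs oO OM (divr_gt0 (mulr_gt0 e0 c0') C0).
pose s := Num.sqrt C; have s2 : s ^+ 2 = C by rewrite sqr_sqrtr// ltW.
exists T, (fun t z => s * ipO z.1 (w t)), (\sum_t C / c * ipO (w t) (w t)).
have W0 t : 0 <= C / c * ipO (w t) (w t) by rewrite mulr_ge0 ?ip_ge0// divr_ge0// ltW.
split.
- by apply: sumr_ge0.
- move=> t u v su sv; have [u2 v2] := (sob_L2 su, sob_L2 sv).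
  by rewrite ipBl// mulrBr.
- move=> t u su; have u2 := sob_L2 su; rewrite exprMn s2.
  have /andP[le _] := hc _ u2.
  apply: (@le_trans _ _ (C / c * ipO (w t) (w t) * mass u u)).
    rewrite (_ : _ * mass u u = C * (mass u u / c * ipO (w t) (w t))); last by ring.
    rewrite ler_pM2l//; apply: le_trans (ip_CS mO u2 (w2 t)) _.
    by rewrite ler_wpM2r ?ip_ge0// ler_pdivlMr// mulrC.
  rewrite ler_pM ?mulr_ge0 ?ip_ge0 ?invr_ge0 ?(ltW C0) ?(ltW c0)//.
  + exact: hw_ip_ge0.
  + by rewrite (bigD1 t)//= lerDl sumr_ge0.
  + by rewrite lerDl; exact: (form_ge0 energy_form).
- move=> u su; have u2 := sob_L2 su; have /andP[_ le] := hc _ u2.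
  apply: le_trans le _.
  apply: (@le_trans _ _ (C * (eps * c' / C * \sum_p ipO (u.2 p) (u.2 p) + \sum_t ipO u.1 (w t) ^+ 2))).
    by rewrite ler_pM2l//; exact: (Hw _ _ su).
  rewrite mulrDr lerD//.
    rewrite (_ : C * (eps * c' / C * _) = eps * \sum_p c' * ipO (u.2 p) (u.2 p)); last first.
      by rewrite -mulr_sumr; field; rewrite gt_eqF.
    rewrite ler_pM2l//; apply: ler_sum => p _.
    by have /andP[] := hc' _ (sob_L2d p su).
  by rewrite mulr_sumr; apply: ler_sum => t _; rewrite exprMn s2.
Qed.

(** The eigenspace of [lambda], described by the two forms alone so that the
    general lemmas on forms apply to it. *)
Definition eigenpairs lambda : set V := [set w | sobolev w /\
  forall g, test g -> energy w (jet g) = lambda * mass w (jet g)].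

Lemma eigenpairsP lambda w : sobolev w ->
  eigenpairs lambda w <-> dirichlet_eigenspace Omega lambda w.1.
Proof.
move=> sw; split=> [[_ H]|[_ H]].
  split; first exact: (sob_H10 oO OM Oh a0 hab sw).
  by move=> g tg; apply/(weak_eigenE oO OM Oh a0 hab lambda sw tg); exact: H.
by split=> // g tg; apply/(weak_eigenE oO OM Oh a0 hab lambda sw tg); exact: H.
Qed.

Lemma eigenpairs_weak lambda w z : eigenpairs lambda w -> sobolev z ->
  energy w z = lambda * mass w z.
Proof.
move=> ew sz; have sw := ew.1.
by apply: (eigen_weak oO OM Oh a0 hab sw sz); apply/eigenpairsP.
Qed.

Lemma linear_eigenpairs lambda : linear_set (eigenpairs lambda).
Proof.
have [s0 sD] := linear_sobolev.
have [F0 FD] := linear_functions.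
split=> [|c u v [su eu] [sv ev]]; (split=> [|g tg]; first by [|exact: sD]).
- have sg := sobolev_jet tg; rewrite (form_0l linear_sobolev energy_form)//.
  by rewrite (form_0l linear_functions mass_form) ?mulr0//; exact: sobolev_functions.
- have sg := sobolev_jet tg; rewrite (form_lin energy_form)// eu// ev//.
  by rewrite (form_lin mass_form); [ring|exact: sobolev_functions..].
Qed.

End spectrum.

(** * The variational principle *)
Section eigenbasis.
Context (R : realType) (m : nat) (Omega : set 'rV[R]_m.+1).
Local Notation n := m.+1.
Local Notation h := (@height R m).
Local Notation mu := (lebesgue_rV R n).
Local Notation L2O := (L2 mu Omega).
Local Notation ipO := (ip mu Omega).
Local Notation test := (test_function Omega).
Local Notation sob := (sob Omega).
Local Notation mass := (mass Omega).
Local Notation energy := (energy Omega).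
Local Notation functions := (functions Omega).
Local Notation sobolev := (sobolev Omega).
Local Notation eigenpairs := (eigenpairs Omega).
Local Notation V := (('rV[R]_n -> R) * ('I_n -> 'rV[R]_n -> R))%type.
Variables (M a b : R).
Hypotheses (oO : open Omega) (OM : forall x i, Omega x -> `|x ord0 i| <= M).
Hypotheses (Oh : Omega `<=` @half_space R m) (a0 : 0 < a).
Hypothesis (hab : forall x, Omega x -> a <= h x ^+ 2 <= b).

Let mO : measurable Omega. Proof. exact: open_measurable_rV. Qed.

Let fM : psd_form sobolev mass.
Proof. exact: psd_formS (@sobolev_functions _ _ _) (mass_form oO OM Oh a0 hab). Qed.

Let fE : psd_form sobolev energy. Proof. exact: (energy_form oO OM Oh a0 hab). Qed.

Let linS : linear_set sobolev. Proof. exact: (linear_sobolev oO OM). Qed.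

(** [gram_schmidt] applied to a basis. The basis is independent modulo null
    functions, which are the null vectors of [mass]. *)
Lemma eigenspace_basis lambda d : has_dim Omega (dirichlet_eigenspace Omega lambda) d ->
  exists f : nat -> V, [/\ forall j, eigenpairs lambda (f j),
    forall i j, (i < d)%N -> (j < d)%N -> mass (f i) (f j) = (i == j)%:R
    & forall w, eigenpairs lambda w -> (forall j, (j < d)%N -> mass w (f j) = 0) ->
        mass w w = 0].
Proof.
move=> [v [vE vI vS]].
have /choice[e eP] : forall i, exists e, sob (v i) e.
  by move=> i; apply: (H10_sob oO OM Oh a0 hab); case: (vE i).
pose z (j : nat) : V := if insub j is Some i then (v i, e i) else 0.
have zE (i : 'I_d) : z i = (v i, e i) by rewrite /z valK.
have ez j : eigenpairs lambda (z j).
  rewrite /z; case: insubP => [i _ _|_].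
    by apply/(eigenpairsP oO OM Oh a0 hab); [exact: eP|exact: vE].
  by case: (linear_eigenpairs oO OM Oh a0 hab lambda).
have sz j : sobolev (z j) := (ez j).1.
have lE := linear_eigenpairs oO OM Oh a0 hab lambda.
have comb1 (c : nat -> R) : (\sum_(i < d) c i *: z i).1 = \sum_(i < d) c i *: v i.
  by rewrite fst_comb; apply: eq_bigr => i _; rewrite zE.
have v2 i : L2O (v i) by case: (eP i).
have comb2 (c : 'I_d -> R) : L2O (\sum_(i < d) c i *: v i).
  by apply: L2_sum => // i _; exact: L2Z.
have [|f [fc fo fv]] := @gram_schmidt R V sobolev mass d z linS fM sz.
  move=> c c0 i id.
  have sc : sobolev (\sum_(i < d) c i *: z i).
    by apply: (lset_sum linS) => j _; exact: lset_scale.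
  have := mass_eq0 oO OM Oh a0 hab (sobolev_functions sc) c0; rewrite comb1 => ae0.
  have := vI (fun i => c i) _ (Ordinal id); apply; apply: filterS ae0 => x /= + Ox.
  by move=> /(_ Ox); rewrite sumfE.
exists f; split=> // [j|w ew wf].
  by have [c ->] := fc j; apply: (lset_sum lE) => i _; exact: lset_scale.
have sw := ew.1; have w2 := sobolev_functions sw.
have wz i : (i < d)%N -> mass w (z i) = 0 by exact: fv.
have [c wc] := vS w.1 ((eigenpairsP oO OM Oh a0 hab lambda sw).1 ew); rewrite /ae_on in wc.
rewrite (mass_ae oO OM Oh a0 hab w2 (comb2 c)); last first.
  by apply: filterS wc => x /= + Ox => /(_ Ox); rewrite sumfE.
have w3 := L2_hw oO OM Oh a0 hab 0 w2.
rewrite ip_suml//; last by move=> i _; exact: L2Z.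
rewrite big1// => i _; rewrite ipZl//.
by have := wz i (ltn_ord i); rewrite (form_sym fM)// /mass zE /= => ->; rewrite mulr0.
Qed.

(** The multiplicity of an eigenvalue puts the indices [i] with [lam i = lambda]
    in bijection with an orthonormal basis of its eigenspace. Eigenspaces of
    different eigenvalues are orthogonal because [energy] is symmetric. *)
Lemma eigenbasis lam : dirichlet_eigenvalues Omega lam ->
  exists U : nat -> V, [/\ forall i, eigenpairs (lam i) (U i),
    forall i j, mass (U i) (U j) = (i == j)%:R
    & forall lambda w, eigenpairs lambda w ->
        (forall i, lam i = lambda -> mass w (U i) = 0) -> mass w w = 0].
Proof.
move=> [_ dimE].
have /choice[f fP] : forall lambda, exists fg : (nat -> V) * (nat -> nat),
    [/\ forall j, eigenpairs lambda (fg.1 j),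
      forall i j, lam i = lambda -> lam j = lambda ->
        mass (fg.1 (fg.2 i)) (fg.1 (fg.2 j)) = (i == j)%:R
    & forall w, eigenpairs lambda w ->
        (forall i, lam i = lambda -> mass w (fg.1 (fg.2 i)) = 0) -> mass w w = 0].
  move=> lambda; have [d [/eigenspace_basis[f [fE' fo fs]] /card_set_bijP[g [gf gi gs]]]] := dimE lambda.
  exists (f, g); split => //= [i j il jl|w ew wf].
    rewrite fo; [|exact: gf|exact: gf].
    have -> : (g i == g j) = (i == j) by apply/eqP/eqP => [|->//]; apply: gi; rewrite inE.
    by [].
  apply: fs => // j jd; have [i il <-] := gs j jd; exact: wf.
exists (fun i => (f (lam i)).1 ((f (lam i)).2 i)); split => [i|i j|lambda w ew wU].
- by case: (fP (lam i)).
- have [ei _ _] := fP (lam i); have [ej _ _] := fP (lam j).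
  have [ij|ij] := eqVneq (lam i) (lam j).
    by case: (fP (lam i)) => _ + _; rewrite -ij; apply.
  set u := (f (lam i)).1 _; set v := (f (lam j)).1 _.
  have su : sobolev u := (ei _).1; have sv : sobolev v := (ej _).1.
  have := eigenpairs_weak oO OM Oh a0 hab (ei ((f (lam i)).2 i)) sv.
  have := eigenpairs_weak oO OM Oh a0 hab (ej ((f (lam j)).2 j)) su.
  rewrite -/u -/v (form_sym fE)// (form_sym fM sv su) => -> /eqP.
  rewrite -subr_eq0 -mulrBl mulf_eq0 subr_eq0 eq_sym (negbTE ij)/= => /eqP ->.
  by case: (eqVneq i j) ij => [->|//]; rewrite eqxx.
- have [_ _] := fP lambda; apply=> // i il; have := wU i il; by rewrite il.
Qed.

(** If some admissible function had a smaller Rayleigh quotient, then so would a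
    minimizer [v]. The Euler-Lagrange equation holds against every test function,
    not only the admissible ones, since [v] is orthogonal to the [U i] for both
    forms; so [v] is an eigenfunction, for an eigenvalue below [lam k]. All
    eigenfunctions of that eigenvalue are combinations of the [U i] with [i < k],
    to which [v] is orthogonal. *)
Lemma rayleigh lam (U : nat -> V) k : {homo lam : i j / (i <= j)%N >-> i <= j} ->
  (forall i, eigenpairs (lam i) (U i)) ->
  (forall i j, mass (U i) (U j) = (i == j)%:R) ->
  (forall lambda w, eigenpairs lambda w ->
    (forall i, lam i = lambda -> mass w (U i) = 0) -> mass w w = 0) ->
  forall w, sobolev w -> (forall i, (i < k)%N -> mass w (U i) = 0) ->
  lam k * mass w w <= energy w w.
Proof.
move=> lam_mono eU oU cU w sw wU; rewrite leNgt; apply/negP => lt.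
have sU i : sobolev (U i) := (eU i).1.
pose S' := orth_compl sobolev mass k U.
have S'S : S' `<=` sobolev by move=> u [].
have linS' : linear_set S' := linear_orth k linS fM sU.
have w0 : 0 < mass w w.
  rewrite lt_neqAle (form_ge0 fM sw) andbT eq_sym; apply/eqP => w0.
  by move: lt; rewrite w0 mulr0 ltNge (form_ge0 fE sw).
have cS' : form_complete S' (fun u v => mass u v + energy u v).
  apply: (form_complete_orth linS fM sU) (sobolev_complete oO OM Oh a0 hab).
  by move=> u su; rewrite lerDl (form_ge0 fE).
have kS' := form_compactS S'S (sobolev_compact oO OM Oh a0 hab).
have [v [nu [[sv vU] v1 EL ray]]] := minimizer linS' (psd_formS S'S fM) (psd_formS S'S fE)
  cS' kS' (ex_intro2 _ _ w (conj sw wU) w0).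
have nuk : nu < lam k.
  have := le_lt_trans (ray w (conj sw wU)) lt; by rewrite ltr_pM2r.
have ev : eigenpairs nu v.
  split=> // g tg; have sg := sobolev_jet oO OM tg.
  pose c i := mass (jet g) (U i); pose r := jet g - \sum_(i < k) c i *: U i.
  have sc : sobolev (\sum_(i < k) c i *: U i).
    by apply: (lset_sum linS) => i _; exact: lset_scale.
  have S'r : S' r.
    split=> [|i ik]; first exact: (lset_sub linS).
    rewrite (form_Bl fM)// (form_combl linS fM)// (bigD1 (Ordinal ik))//= oU eqxx mulr1.
    rewrite big1 ?addr0 ?subrr// => j ji; rewrite oU.
    by rewrite (negbTE (ji : (j : nat) != i)) mulr0.
  have z0 (B : V -> V -> R) : psd_form sobolev B -> (forall i, (i < k)%N -> B v (U i) = 0) ->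
      B v r = B v (jet g).
    move=> fB vB; rewrite (form_sym fB)//; last exact: S'S.
    rewrite /r (form_Bl fB sg sc sv) (form_combl linS fB)// big1.
      by rewrite subr0 (form_sym fB sg sv).
    by move=> i _; rewrite (form_sym fB (sU i) sv) vB// mulr0.
  have := EL _ S'r; rewrite (z0 _ fM vU) z0// => i ik.
  by rewrite (form_sym fE)// (eigenpairs_weak oO OM Oh a0 hab (eU i))// (form_sym fM)// vU// mulr0.
have := cU nu v ev; rewrite v1 => H; suff /eqP : (1 : R) = 0 by rewrite oner_eq0.
apply: H => i il; apply: vU; rewrite ltnNge; apply/negP => ki.
by have := lam_mono _ _ ki; rewrite il leNgt nuk.
Qed.

End eigenbasis.

(** * Multiplication by the coordinates *)
Section coordinate_trial.
Context (R : realType) (m : nat) (Omega : set 'rV[R]_m.+1).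
Local Notation n := m.+1.
Local Notation h := (@height R m).
Local Notation mu := (lebesgue_rV R n).
Local Notation L2O := (L2 mu Omega).
Local Notation ipO := (ip mu Omega).
Local Notation mass := (mass Omega).
Local Notation energy := (energy Omega).
Local Notation functions := (functions Omega).
Local Notation sobolev := (sobolev Omega).
Local Notation eigenpairs := (eigenpairs Omega).
Local Notation V := (('rV[R]_n -> R) * ('I_n -> 'rV[R]_n -> R))%type.
Implicit Types (w z : V) (p q : 'I_n).
Variables (M a b : R).
Hypotheses (oO : open Omega) (OM : forall x i, Omega x -> `|x ord0 i| <= M).
Hypotheses (Oh : Omega `<=` @half_space R m) (a0 : 0 < a).
Hypothesis (hab : forall x, Omega x -> a <= h x ^+ 2 <= b).

Let mO : measurable Omega. Proof. exact: open_measurable_rV. Qed.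

Let L2w j g : L2O g -> L2O (hw j * g). Proof. exact: (L2_hw oO OM Oh a0 hab). Qed.

Let L2x q g : L2O g -> L2O (coordf q * g).
Proof. by apply: (L2_bounded_cont oO); exact: (bounded_cont_coord OM). Qed.

Definition trial q w : V :=
  (coordf q * w.1, fun p => coordf q * w.2 p + (p == q)%:R *: w.1).

(** The Laplacian of [x_q] is [drift q] times the height. *)
Definition drift q : R := (q == ord_max)%:R * (2 - n%:R).

(** [2 <grad x_q, grad u> + u Delta x_q], the commutator of the Laplacian with
    multiplication by [x_q], where [u] is the function [w.1]. It has no weak
    derivatives in general, and it only enters [mass], which depends on first
    components. *)
Definition commutator q w : V :=
  (h * (2 *: (h * w.2 q) + drift q *: w.1), 0).

Lemma trial1 q w : (trial q w).1 = coordf q * w.1. Proof. by []. Qed.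

Lemma trial2 q w p : (trial q w).2 p = coordf q * w.2 p + (p == q)%:R *: w.1.
Proof. by []. Qed.

Lemma commutator1 q w :
  (commutator q w).1 = h * (2 *: (h * w.2 q) + drift q *: w.1).
Proof. by []. Qed.

Let simp := (trial1, trial2, commutator1, pointwE).

Lemma sum_delta q (X : 'I_n -> R) : \sum_p (p == q)%:R * X p = X q.
Proof.
rewrite (bigD1 q)//= eqxx mul1r big1 ?addr0// => p pq.
by rewrite (negbTE pq) mul0r.
Qed.

Lemma sobolev_trial q w : sobolev w -> sobolev (trial q w).
Proof. exact: (sob_mul_coord oO OM). Qed.

Let L2comm q w : sobolev w -> L2O (2 *: (h * w.2 q) + drift q *: w.1).
Proof.
move=> sw; apply: L2D => //; apply: L2Z => //; last exact: sob_L2 sw.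
by apply: L2x; exact: sob_L2d sw.
Qed.

Lemma functions_commutator q w : sobolev w -> functions (commutator q w).
Proof. by move=> sw; apply: L2x; exact: L2comm. Qed.

Lemma mass_commutator q w z : sobolev w -> functions z ->
  mass (commutator q w) z = 2 * ipO (w.2 q) (hw 2 * z.1) + ipO w.1 (dhw 1 q * z.1).
Proof.
move=> sw z2; have d2 := sob_L2d q sw; have u2 := sob_L2 sw.
transitivity (ipO (2 *: w.2 q) (hw 2 * z.1) + ipO (drift q *: w.1) (hw 1 * z.1)); last first.
  rewrite (ipZl mO 2)//; last exact: L2w.
  by congr (_ + _); apply: eq_ip => x _; rewrite !simp /dhw /drift; ring.
rewrite [X in X + _](_ : _ = ipO (2 *: (h * w.2 q)) (hw 1 * z.1)); last first.
  by apply: eq_ip => x _; rewrite !simp /hw expr1 expr2; ring.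
rewrite -ipDl//; [|by apply: L2Z => //; exact: L2x|exact: L2Z|exact: L2w].
by apply: eq_ip => x _; rewrite !simp /hw expr0 expr1; ring.
Qed.

(** The weak form of [- Delta (x_q u) = lambda x_q u - commutator]: test the
    equation of [u] with [x_q z] and integrate by parts once. *)
Lemma energy_trial q lambda w z : eigenpairs lambda w -> sobolev z ->
  energy (trial q w) z = lambda * mass (trial q w) z - mass (commutator q w) z.
Proof.
move=> ew sz; have sw := ew.1; have szq := sobolev_trial q sz.
have u2 := sob_L2 sw; have v2 := sob_L2 sz.
have d2 p := sob_L2d p sw; have e2 p := sob_L2d p sz.
rewrite mass_commutator//.
have P := sob_parts oO OM q (weight_hw OM Oh a0 hab 1) sw sz.
have E : energy w (trial q z) =
    \sum_p ipO (w.2 p) (hw 2 * (coordf q * z.2 p)) + ipO (w.2 q) (hw 2 * z.1).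
  rewrite -(sum_delta q (fun p => ipO (w.2 p) (hw 2 * z.1))) -big_split/=.
  apply: eq_bigr => p _; rewrite -ipZr//; last exact: L2w.
  rewrite -ipDr//; [|by apply: L2w; exact: L2x|by apply: L2Z => //; exact: L2w].
  by apply: eq_ip => x _; rewrite !simp; ring.
have E' : energy (trial q w) z =
    \sum_p ipO (w.2 p) (hw 2 * (coordf q * z.2 p)) + ipO w.1 (hw 2 * z.2 q).
  rewrite -(sum_delta q (fun p => ipO w.1 (hw 2 * z.2 p))) -big_split/=.
  apply: eq_bigr => p _; rewrite -ipZl//; last exact: L2w.
  rewrite [X in _ = X + _](_ : _ = ipO (coordf q * w.2 p) (hw 2 * z.2 p)); last first.
    by apply: eq_ip => x _; rewrite !simp; ring.
  by rewrite -ipDl//; [exact: L2x|exact: L2Z|exact: L2w].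
have F : mass w (trial q z) = mass (trial q w) z.
  by apply: eq_ip => x _; rewrite !simp; ring.
have := eigenpairs_weak oO OM Oh a0 hab ew szq; rewrite E F E'.
move: P; set A := ipO (w.2 q) _; set A' := ipO w.1 _; set D := ipO w.1 _.
set T := \sum_p _; set L := lambda * _; lra.
Qed.

(** The integral of [u^2 |grad x_q|^2], obtained by writing
    [2 x_q u grad u] as [x_q grad (u^2)] and integrating by parts. *)
Lemma trial_commutator q w : sobolev w ->
  - mass (trial q w) (commutator q w) = ipO w.1 (hw 2 * w.1).
Proof.
move=> sw; have st := sobolev_trial q sw; have u2 := sob_L2 sw.
have d2 := sob_L2d q sw.
rewrite [mass _ _]ip_hwC -/(mass _ _) (mass_commutator q sw (sobolev_functions st)).
have := sob_parts oO OM q (weight_hw OM Oh a0 hab 1) sw st.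
rewrite [ipO w.1 (hw 2 * _)](_ : _ =
  ipO (w.2 q) (hw 2 * (trial q w).1) + ipO w.1 (hw 2 * w.1)).
  set A := ipO (w.2 q) _; set D := ipO w.1 (dhw 1 q * _); set W := ipO w.1 _; lra.
rewrite [X in _ = X + _](_ : _ = ipO w.1 (hw 2 * (coordf q * w.2 q))); last first.
  by apply: eq_ip => x _; rewrite !simp; ring.
rewrite -ipDr//; [|by apply: L2w; exact: L2x|exact: L2w].
by rewrite trial2 eqxx scale1r; apply: eq_ip => x _; rewrite !simp; ring.
Qed.

(** The commutator is [h (2 h D_q u + drift q * u)]; the factor [h] contributes at
    most [b] to the squared norm. What remains is [4 * energy], a cross term that
    is evaluated by parts since [2 u D_q u = D_q (u^2)], and a multiple of
    [mass]; the last two only occur for the last coordinate. *)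
Lemma commutator_bound lambda w : eigenpairs lambda w -> mass w w = 1 ->
  \sum_q mass (commutator q w) (commutator q w) <=
  4 * b * (lambda - (n%:R ^+ 2 - 2 * n%:R) / 4).
Proof.
move=> ew w1; have sw := ew.1; have u2 := sob_L2 sw; have d2 p := sob_L2d p sw.
pose g q := 2 *: (h * w.2 q) + drift q *: w.1.
have g2 q : L2O (g q) by exact: L2comm.
have le q : mass (commutator q w) (commutator q w) <= b * ipO (g q) (hw 0 * g q).
  rewrite -(ipZl mO)//; last exact: L2w.
  apply: ip_le => //.
  - by rewrite commutator1; exact: (L2x ord_max (g2 q)).
  - by rewrite commutator1; apply: L2w; exact: (L2x ord_max (g2 q)).
  - exact: L2Z.
  - exact: L2w.
  move=> x Ox; rewrite commutator1 -/(g q) !pointwE.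
  rewrite (_ : h x * g q x * _ = h x ^+ 2 * (hw 0 x * g q x ^+ 2)); last by ring.
  rewrite (_ : b * g q x * _ = b * (hw 0 x * g q x ^+ 2)); last by ring.
  rewrite ler_wpM2r//; first by rewrite mulr_ge0 ?sqr_ge0// ltW// (hw_gt0 Oh).
  by have /andP[] := hab Ox.
have gE q : ipO (g q) (hw 0 * g q) =
    4 * ipO (w.2 q) (hw 2 * w.2 q) + 4 * drift q * ipO (w.2 q) (hw 1 * w.1) + drift q ^+ 2.
  have X2 : L2O (h * w.2 q) by exact: L2x.
  rewrite (_ : hw 0 * g q = 2 *: (hw 0 * (h * w.2 q)) + drift q *: (hw 0 * w.1)); last first.
    by apply/funext => x; rewrite /g !simp; ring.
  have [Xw uw] := (L2w 0 X2, L2w 0 u2).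
  rewrite ipDl//; [|exact: L2Z|exact: L2Z|by apply: L2D => //; exact: L2Z].
  rewrite !ipDr//; try exact: L2Z.
  rewrite !ipZl// ?ipZr//; try exact: L2Z.
  rewrite (_ : ipO (h * w.2 q) (hw 0 * (h * w.2 q)) = ipO (w.2 q) (hw 2 * w.2 q)); last first.
    by apply: eq_ip => x _; rewrite !simp /hw expr0 expr2; ring.
  rewrite (_ : ipO (h * w.2 q) (hw 0 * w.1) = ipO (w.2 q) (hw 1 * w.1)); last first.
    by apply: eq_ip => x _; rewrite !simp /hw expr0 expr1; ring.
  rewrite (_ : ipO w.1 (hw 0 * (h * w.2 q)) = ipO (w.2 q) (hw 1 * w.1)); last first.
    by apply: eq_ip => x _; rewrite !simp /hw expr0 expr1; ring.
  rewrite -/(mass w w) w1; ring.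
apply: le_trans (ler_sum _ (fun q _ => le q)) _; rewrite -mulr_sumr.
under eq_bigr do rewrite gE.
rewrite !big_split/= -mulr_sumr -/(energy w w).
rewrite (eigenpairs_weak oO OM Oh a0 hab ew sw) w1 mulr1.
rewrite [X in _ + X + _](_ : _ = 4 * ((2 - n%:R) * ipO (w.2 ord_max) (hw 1 * w.1))); last first.
  rewrite -(sum_delta ord_max (fun q => (2 - n%:R) * ipO (w.2 q) (hw 1 * w.1))) mulr_sumr.
  by apply: eq_bigr => q _; rewrite /drift; ring.
rewrite [X in _ + X](_ : _ = (2 - n%:R) ^+ 2); last first.
  rewrite -(sum_delta ord_max (fun q => (2 - n%:R) ^+ 2)).
  by apply: eq_bigr => q _; rewrite /drift; case: (q == _); rewrite ?mul1r ?mul0r ?expr0n.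
have := sob_parts oO OM ord_max (weight_hw OM Oh a0 hab 0) sw sw.
rewrite [ipO w.1 (hw 1 * _)]ip_hwC.
rewrite [ipO w.1 (dhw 0 _ * _)](_ : _ = ipO ((1 - n%:R) *: w.1) (hw 0 * w.1)); last first.
  by apply: eq_ip => x _; rewrite !simp /dhw eqxx mul1r; ring.
rewrite ipZl//; last exact: L2w.
rewrite -/(mass w w) w1 mulr1; set X := ipO _ _ => HX.
have -> : X = (n%:R - 1) / 2.
  by have := HX; lra.
by rewrite le_eqVlt; apply/orP; left; apply/eqP; field.
Qed.

End coordinate_trial.

Theorem corollary1p8 (R : realType) (m : nat) (Omega : set 'rV[R]_m.+1)
    (hOmega : hdomain Omega) (hbd : hbounded Omega)
    (a b : R) (ha : 0 < a)
    (hab : forall x, Omega x -> a <= height x ^+ 2 <= b)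
    (lam : nat -> R) (hlam : dirichlet_eigenvalues Omega lam)
    (k : nat) (hk : (1 <= k)%N) :
  let n : R := m.+1%:R in
  \sum_(i < k) (lam k - lam i) ^+ 2 <=
  b / a * (4 / n) *
  \sum_(i < k) (lam k - lam i) * (lam i - (n ^+ 2 - 2 * n - 4) / 4).
Proof.
cbv zeta; set n : R := m.+1%:R; have [Oh oO _ [x0 Ox0]] := hOmega.
have n0 : 0 < n by rewrite ltr0n.
have b0 : 0 <= b.
  by have /andP[h1 h2] := hab x0 Ox0; rewrite (le_trans (ltW ha))// (le_trans h1).
have [|M OM] := hbounded_box (b := b) hOmega hbd.
  by move=> x /hab/andP[].
have [U [eU oU cU]] := eigenbasis oO OM Oh ha hab hlam.
have lam_mono := hlam.1.
have del0 i : (i < k)%N -> 0 <= lam k - lam i by move=> ik; rewrite subr_ge0 lam_mono// ltnW.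
have sU i : sobolev Omega (U i) := (eU i).1.
have yang (q : 'I_m.+1) : \sum_(i < k) (lam k - lam i) ^+ 2 * a <=
    \sum_(i < k) (lam k - lam i) * mass Omega (commutator q (U i)) (commutator q (U i)).
  have fE := energy_form oO OM Oh ha hab; have fM := mass_form oO OM Oh ha hab.
  apply: (@le_trans _ _ (\sum_(i < k) (lam k - lam i) ^+ 2 *
      - mass Omega (trial q (U i)) (commutator q (U i)))).
    apply: ler_sum => i _; rewrite ler_wpM2l ?sqr_ge0// (trial_commutator oO OM Oh ha hab)//.
    have u2 := sobolev_functions (sU i).
    rewrite -[a]mulr1 -(_ : mass Omega (U i) (U i) = 1); last by rewrite oU eqxx.
    have w2 j := L2_hw oO OM Oh ha hab j u2.
    have mO := open_measurable_rV oO.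
    rewrite /mass -(ipZl mO)//; apply: ip_le => //; first exact: L2Z.
    move=> x Ox; rewrite !pointwE.
    rewrite (_ : a * _ * _ = a * (hw 0 x * (U i).1 x ^+ 2)); last by ring.
    rewrite (_ : (U i).1 x * _ = height x ^+ 2 * (hw 0 x * (U i).1 x ^+ 2)); last by rewrite /hw expr0; ring.
    rewrite ler_wpM2r//; first by rewrite mulr_ge0 ?sqr_ge0// ltW// (hw_gt0 Oh).
    by have /andP[] := hab x Ox.
  apply: (@yang_commutator R _ (sobolev Omega) (functions Omega) (mass Omega) (energy Omega)
    k lam U (fun i => trial q (U i)) (fun i => commutator q (U i))) => //.
  - exact: linear_sobolev oO OM.
  - exact: linear_functions oO.
  - exact: sobolev_functions.
  - by move=> i ik; rewrite lam_mono// ltnW.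
  - by move=> i w; exact: (eigenpairs_weak oO OM Oh ha hab (eU i)).
  - exact: (rayleigh oO OM Oh ha hab lam_mono eU oU cU).
  - by move=> i; exact: (sobolev_trial oO OM).
  - by move=> i; exact: (functions_commutator oO OM).
  - by move=> i j; apply: eq_ip => x _; rewrite !trial1 !pointwE; ring.
  - by move=> i w sw; exact: (energy_trial oO OM Oh ha hab q (eU i) sw).
have le : n * \sum_(i < k) (lam k - lam i) ^+ 2 * a <= \sum_(i < k) \sum_q
    (lam k - lam i) * mass Omega (commutator q (U i)) (commutator q (U i)).
  rewrite exchange_big/= mulr_natl -[X in _ *+ X]card_ord -sumr_const.
  by apply: ler_sum => q _; exact: yang.
have le2 : n * \sum_(i < k) (lam k - lam i) ^+ 2 * a <=
    4 * b * \sum_(i < k) (lam k - lam i) * (lam i - (n ^+ 2 - 2 * n - 4) / 4).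
  apply: le_trans le _; rewrite [leRHS]mulr_sumr; apply: ler_sum => i _.
  rewrite -mulr_sumr mulrCA ler_wpM2l ?del0//.
  have u1 : mass Omega (U i) (U i) = 1 by rewrite oU eqxx.
  apply: le_trans (commutator_bound oO OM Oh ha hab (eU i) u1) _.
  rewrite ler_wpM2l ?mulr_ge0// -/n; lra.
rewrite -mulr_suml mulrA in le2.
rewrite -(ler_pM2r ha) -(ler_pM2l n0) mulrA (le_trans le2)// le_eqVlt; apply/orP; left.
by apply/eqP; field; rewrite !gt_eqF.
Qed.
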